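(* Let $G$ be a real Lie group acting on a manifold $M$, and assume that the action is $C^\infty$, i.e. that $(g,x)\mapsto gx:G\times M\to M$ is $C^\infty$. Let $G^\circ$ denote the identity component of $G$. Assume that the $G^\circ$-action on $M$ is fixpoint rare. Let $n:=\dim G$ and assume $n\ge 1$. Then there exists a $G$-invariant dense open subset $Q$ of the frame bundle $F^{n-1}M$ of order $n-1$ such that the $G$-action on $Q$ is locally free.
   Context: ''Manifold'' means Hausdorff, second countable, finite dimensional $C^\infty$ real manifold without boundary. $\mathbb{N}=\{1,2,\ldots\}$, $\mathbb{N}_0=\mathbb{N}\cup\{0\}$. An action of a group $H$ on a topological space $X$ is fixpoint rare if, for every $h\in H\setminus\{1_H\}$, the set $\{x\in X: hx=x\}$ has empty interior in $X$. An action of a topological group $G$ on a set $X$ is locally free if, for every $x\in X$, the stabilizer $\{g\in G: gx=x\}$ is discrete in $G$. Frame bundles. For manifolds $M,N$, $D_O^\infty(M,N)$ is the set of all $C^\infty$ maps $f:\mathrm{dom}[f]\to N$ with $\mathrm{dom}[f]$ open in $M$, with image $\mathrm{im}[f]$ open in $N$, and with $f:\mathrm{dom}[f]\to \mathrm{im}[f]$ a $C^\infty$ diffeomorphism. Compositions of partially defined maps are taken on the largest possible domain. Let $d:=\dim M$, $E:=\mathbb{R}^d$, $z:=0\in\mathbb{R}^d$, $j\in\mathbb{N}_0$. Let $\mathcal{R}_M^0:=\{\lambda\in D_O^\infty(\mathbb{R}^d,M): z\in\mathrm{dom}[\lambda]\}$. For $\lambda,\lambda'\in\mathcal{R}_M^0$,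 say that $\lambda$ and $\lambda'$ agree to order $j$ at $z$ if $\lambda(z)=\lambda'(z)$ and, in some chart of $M$ near this point, all partial derivatives of order $\le j$ of $\lambda$ and $\lambda'$ at $z$ coincide. Let $J_M^j\lambda$ be the equivalence class in $\mathcal{R}_M^0$ of $\lambda$ under this relation. The $j$th order frame bundle of $M$ is $F^jM:=\{J_M^j\lambda:\lambda\in\mathcal{R}_M^0\}$, with projection $\pi_M^j:F^jM\to M$, $\pi_M^j(J_M^j\lambda)=\lambda(z)$. For $d$-dimensional manifolds $M,N$ and $f\in D_O^\infty(M,N)$, define $F^jf:(\pi_M^j)^{-1}(\mathrm{dom}[f])\to(\pi_N^j)^{-1}(\mathrm{im}[f])$ by $(F^jf)(J_M^j\lambda)=J_N^j(f\circ\lambda)$. Manifold structure on $F^jM$: let $\mathcal{P}$ be the vector space of polynomial maps $E\to E$ of degree $\le j$ and let $m:=\dim\mathcal{P}$. For each linear isomorphism $\kappa:\mathcal{P}\to\mathbb{R}^m$ let $C_\kappa:F^jE\to\mathbb{R}^m$ be $C_\kappa(J_E^j\nu)=\kappa(\mathrm{Tay}_z^j(\nu))$, where $\mathrm{Tay}_z^j(\nu)\in\mathcal{P}$ is the order $j$ Taylor polynomial of $\nu$ at $z$. The maps $C_\kappa\circ(F^j\lambda):(\pi_M^j)^{-1}(\mathrm{dom}[\lambda])\to\mathbb{R}^m$, for all such $\kappa$ and all charts $\lambda\in D_O^\infty(M,\mathbb{R}^d)$, form an atlas making $F^jM$ a manifold. The $G$-action on $M$ induces a $G$-action on $F^jM$: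 $g\cdot q=(F^j\overline{g})(q)$, where $\overline{g}:M\to M$ is $\overline{g}(p)=gp$. *)

(* Defs.v *)
From HB Require Import structures.
From mathcomp Require Import all_boot all_order all_algebra.
From mathcomp Require Import all_classical all_reals all_analysis.

Set Implicit Arguments.
Unset Strict Implicit.
Unset Printing Implicit Defensive.

Import Order.TTheory GRing.Theory Num.Theory numFieldNormedType.Exports.
Local Open Scope classical_set_scope.
Local Open Scope ring_scope.

(* A partially defined map from X to Y is a function X -> option Y, with None
   outside its domain. Composition on the largest possible domain is then
   ssrfun.pcomp. *)
Section PartialMaps.
Context {X Y : choiceType}.
Implicit Type f : X -> option Y.

Definition pdom f : set X := [set x | isSome (f x)].

Definition ppreimage f (V : set Y) : set X := f @^-1` (some @` V).

Definition pinjective f := forall x x' y, f x = Some y -> f x' = Some y -> x = x'.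

Definition pinv f (y : Y) : option X := xget None (some @` [set x | f x = Some y]).

End PartialMaps.

(* Taking V = setT, this includes openness of the domain. *)
Definition pcontinuous (X Y : topologicalType) (f : X -> option Y) :=
  forall V : set Y, open V -> open (ppreimage f V).

Section EuclideanCalculus.
Context {R : realType}.

Definition iter_partial m n (s : seq 'I_m) (f : 'rV[R]_m -> 'rV[R]_n) :
    'rV[R]_m -> 'rV[R]_n :=
  foldr (fun i g x => 'D_(delta_mx 0 i) g x) f s.

(* Near a point of an open domain, odflt 0 \o f is f; its value elsewhere is
   irrelevant to the derivatives at that point. *)
Definition total_ext (X : Type) n (f : X -> option 'rV[R]_n) : X -> 'rV[R]_n :=
  odflt 0 \o f.

(* To be used for maps with open domain. *)
Definition partials_continuous m n (f : 'rV[R]_m -> option 'rV[R]_n) :=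
  forall (s : seq 'I_m) (x : 'rV[R]_m), pdom f x ->
    {for x, continuous (iter_partial s (total_ext f))} /\
    (forall i : 'I_m, derivable (iter_partial s (total_ext f)) x (delta_mx 0 i)).

Section Polynomials.
Variables d j : nat.

(* Several tuples give the same monomial, so the family c is not unique. *)
Definition poly_maps : set ('rV[R]_d -> 'rV[R]_d) :=
  [set p | exists c : seq 'I_d -> 'rV[R]_d, p = fun x : 'rV[R]_d =>
    \sum_(k < j.+1) \sum_(s : k.-tuple 'I_d) (\prod_(i <- s) x 0 i) *: c s].

Definition taylor (f : 'rV[R]_d -> 'rV[R]_d) : 'rV[R]_d -> 'rV[R]_d := fun x =>
  \sum_(k < j.+1) (k`!%:R)^-1 *:
    \sum_(s : k.-tuple 'I_d) (\prod_(i <- s) x 0 i) *: iter_partial s f 0.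

(* Only the restriction of kappa to poly_maps matters; such a kappa exists
   only for m = dim poly_maps. *)
Definition poly_maps_iso m (kappa : ('rV[R]_d -> 'rV[R]_d) -> 'rV[R]_m) :=
  set_bij poly_maps setT kappa /\
  (forall a p q, poly_maps p -> poly_maps q ->
     kappa (fun x => a *: p x + q x) = a *: kappa p + kappa q).

End Polynomials.
End EuclideanCalculus.

(* A topological space together with a set of charts, not yet subject to any
   axiom. *)
HB.mixin Record hasAtlas (R : realType) (d : nat) M of Topological M := {
  atlas : set (M -> option 'rV[R]_d)
}.

#[short(type="chartedType")]
HB.structure Definition Charted (R : realType) (d : nat) :=
  {M of Topological M & hasAtlas R d M}.

HB.instance Definition _ (R : realType) (d : nat) :=
  hasAtlas.Build R d 'rV[R]_d [set Some].

Definition prod_chart (R : realType) (d1 d2 : nat) (M N : Type)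
    (phi : M -> option 'rV[R]_d1) (psi : N -> option 'rV[R]_d2) (p : M * N) :
    option 'rV[R]_(d1 + d2) :=
  if (phi p.1, psi p.2) is (Some u, Some v) then Some (row_mx u v) else None.

HB.instance Definition _ (R : realType) (d1 d2 : nat)
    (M : chartedType R d1) (N : chartedType R d2) :=
  hasAtlas.Build R (d1 + d2)%N (M * N)%type
    [set chi | exists phi psi,
       [/\ atlas phi, atlas psi & chi = prod_chart phi psi]].

(* The topology is given, so the charts are required to be homeomorphisms from
   an open subset of M onto an open subset of R^d. The atlas need not be
   maximal. *)
HB.mixin Record Charted_isManifold (R : realType) (d : nat) M
    of Charted R d M := {
  atlas_homeo : forall phi : M -> option 'rV[R]_d, atlas phi ->
    [/\ pinjective phi, pcontinuous phi & pcontinuous (pinv phi)];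
  atlas_cover : forall x : M, exists2 phi : M -> option 'rV[R]_d,
    atlas phi & pdom phi x;
  atlas_compatible : forall phi psi : M -> option 'rV[R]_d,
    atlas phi -> atlas psi -> partials_continuous (pcomp psi (pinv phi));
  manifold_hausdorff : hausdorff_space M;
  manifold_second_countable : @second_countable M
}.

#[short(type="manifoldType")]
HB.structure Definition Manifold (R : realType) (d : nat) :=
  {M of Charted R d M & Charted_isManifold R d M}.

Section SmoothMaps.
Context {R : realType} {m n : nat} {M : chartedType R m} {N : chartedType R n}.

Definition psmooth (f : M -> option N) :=
  pcontinuous f /\
  (forall (phi : M -> option 'rV[R]_m) (psi : N -> option 'rV[R]_n),
     atlas phi -> atlas psi ->
     partials_continuous (pcomp psi (pcomp f (pinv phi)))).

Definition smooth (f : M -> N) := psmooth (fun x => Some (f x)).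

End SmoothMaps.

(* The set D_O^oo(M, N): the domain of pinv f is the image of f. *)
Definition pdiffeo (R : realType) (m n : nat) (M : chartedType R m)
    (N : chartedType R n) (f : M -> option N) :=
  [/\ pinjective f, psmooth f & psmooth (pinv f)].

HB.mixin Record isLieGroup (R : realType) (n : nat) G
    of Manifold R n G & Group G := {
  mulg_smooth : smooth (fun gh : G * G => (gh.1 * gh.2)%g : G);
  invg_smooth : smooth (fun g : G => (g^-1)%g : G)
}.

#[short(type="lieGroupType")]
HB.structure Definition LieGroup (R : realType) (n : nat) :=
  {G of Manifold R n G & Group G & isLieGroup R n G}.

Section FrameBundle.
Context {R : realType} {d : nat}.
Variable j : nat.

Definition frame_germ (M : chartedType R d) : set ('rV[R]_d -> option M) :=
  [set l | pdiffeo l /\ pdom l (0 : 'rV[R]_d)].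

Definition agree_to_order (M : chartedType R d) (l l' : 'rV[R]_d -> option M) :=
  l 0 = l' 0 /\
  exists phi : M -> option 'rV[R]_d,
    [/\ pdiffeo phi, pdom (pcomp phi l) (0 : 'rV[R]_d) &
        forall s : seq 'I_d, (size s <= j)%N ->
          iter_partial s (total_ext (pcomp phi l)) 0 =
          iter_partial s (total_ext (pcomp phi l')) 0].

Definition jet (M : chartedType R d) (l : 'rV[R]_d -> option M) :
    set ('rV[R]_d -> option M) :=
  [set l' | frame_germ l' /\ agree_to_order l l'].

Record frame_bundle (M : chartedType R d) : Type := Frame {
  frame_class : set ('rV[R]_d -> option M);
  frame_classP : exists2 l, frame_germ l & frame_class = jet l
}.

HB.instance Definition _ (M : chartedType R d) := gen_eqMixin (frame_bundle M).
HB.instance Definition _ (M : chartedType R d) :=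
  gen_choiceMixin (frame_bundle M).

Definition jet_frame (M : chartedType R d) (l : 'rV[R]_d -> option M) :
    option (frame_bundle M) :=
  if pselect (frame_germ l) is left lP
  then Some (Frame (ex_intro2 _ _ l lP erefl)) else None.

Definition frame_rep (M : chartedType R d) (q : frame_bundle M) :
    'rV[R]_d -> option M :=
  sval (cid2 (frame_classP q)).

(* F^j f for f in D_O^oo(M, N), a partial map; by the chain rule its value does
   not depend on the representative of q. It is defined at q exactly when the
   base point of q is in the domain of f. *)
Definition frame_map (M N : chartedType R d) (f : M -> option N)
    (q : frame_bundle M) : option (frame_bundle N) :=
  jet_frame (pcomp f (frame_rep q)).

Definition frame_coord m (kappa : ('rV[R]_d -> 'rV[R]_d) -> 'rV[R]_m)
    (q : frame_bundle 'rV[R]_d) : 'rV[R]_m :=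
  kappa (taylor j (total_ext (frame_rep q))).

Definition frame_chart (M : chartedType R d) m
    (kappa : ('rV[R]_d -> 'rV[R]_d) -> 'rV[R]_m) (l : M -> option 'rV[R]_d)
    (q : frame_bundle M) : option 'rV[R]_m :=
  omap (frame_coord kappa) (frame_map l q).

(* When the maps frame_chart kappa l form an atlas, the preimages of open sets
   under them generate the manifold topology defined by this atlas. *)
Definition frame_subbase (M : chartedType R d) : set (set (frame_bundle M)) :=
  [set W | exists m (kappa : ('rV[R]_d -> 'rV[R]_d) -> 'rV[R]_m)
                  (l : M -> option 'rV[R]_d) (O : set 'rV[R]_m),
     [/\ poly_maps_iso j kappa, pdiffeo l, open O &
         W = ppreimage (frame_chart kappa l) O]].

HB.instance Definition _ (M : chartedType R d) :=
  isSubBaseTopological.Build (frame_bundle M) (@frame_subbase M) id.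

End FrameBundle.

Arguments frame_bundle {R d} j M.

Section Actions.
Context {G : groupType} {X : Type}.

Definition group_action (act : G -> X -> X) :=
  (forall x, act 1%g x = x) /\ (forall g h x, act (g * h)%g x = act g (act h x)).

(* For actions given as partial maps; invariance of Q requires g to be defined
   on Q. *)
Definition invariant_set (act : G -> X -> option X) (Q : set X) :=
  forall g x, Q x -> exists2 y, act g x = Some y & Q y.

End Actions.

Definition fixpoint_rare (G : groupType) (X : topologicalType) (H : set G)
    (act : G -> X -> X) :=
  forall h, H h -> h <> 1%g -> interior [set x | act h x = x] = set0.

Definition discrete_subset (T : topologicalType) (S : set T) :=
  S `<=` isolated S.

Definition locally_free_on (G : topologicalType) (X : Type)
    (act : G -> X -> option X) (Q : set X) :=
  forall x, Q x -> discrete_subset [set g | act g x = Some x].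

Definition identity_component (R : realType) (n : nat) (G : lieGroupType R n) :
  set G := connected_component [set: G] 1%g.

Definition frame_action (R : realType) (d : nat) (G : Type)
    (M : chartedType R d) (j : nat) (act : G -> M -> M) (g : G) :
    frame_bundle j M -> option (frame_bundle j M) :=
  frame_map (fun x => Some (act g x)).

Arguments identity_component {R n} G.
Arguments frame_action {R d G M} j act g.

(* Main.v *)
From HB Require Import structures.
From mathcomp Require Import all_boot all_order all_algebra.
From mathcomp Require Import perm finmap ring lra.
From mathcomp Require Import all_classical all_reals all_analysis.
Require Import Defs.

Set Implicit Arguments.
Unset Strict Implicit.
Unset Printing Implicit Defensive.

Import Order.TTheory GRing.Theory Num.Theory numFieldNormedType.Exports.
Local Open Scope classical_set_scope.
Local Open Scope ring_scope.

(** Let [Q] be the interior of the set of frames of order [n - 1] whose stabilizer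
    is discrete. It is open, the action on it is locally free, and it is
    invariant, since the group acts by homeomorphisms of the frame bundle and the
    stabilizers along an orbit are conjugate. What has to be proved is that [Q] is
    dense. Frames move continuously along their germs ([shift_continuous]), so it
    is enough that every nonempty open set of the manifold contains a nonempty open
    set over which all frames have a discrete stabilizer ([discrete_frames_over]).

    Choose charts, and let [X_1, ..., X_n] be the generating vector fields of the
    action, that is, the derivatives of the action at the unit along the
    coordinates of the group. A generalized Wronskian theorem ([wronskian]) leaves
    two cases on a given open set.

    In the first case, at some point, hence at all points near it, the jets of
    order [n - 1] of [X_1, ..., X_n] are linearly independent: some [n] partial
    derivatives of their components form an invertible matrix. A group element
    that fixes a frame has the same jet of order [n - 1] as the identity at the
    base point ([stabilizer_jet]). The derivatives of these jets along the group
    are the jets of the [X_k], because partial derivatives commute; so near the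
    unit only the unit has the jet of the identity, and the stabilizer is
    discrete ([stabilizer_discrete]).

    In the second case, some nonzero combination of the [X_k] vanishes on an open
    set. Its flow would consist of elements of the identity component that fix this
    open set, against the hypothesis that fixed point sets have empty interior
    ([no_vanishing_generator]). The flow is not constructed: among the group
    elements near the unit that move finitely many points of the open set only
    slightly, compared with the gain in one coordinate of the group, one that
    maximizes this coordinate must lie on the boundary of the neighbourhood, since
    it could otherwise be multiplied by a further small step. Compactness then
    yields an element on this boundary that fixes the whole open set ([escape]).

    All analysis rests on partial derivatives. The increments of a function are
    written with partial derivatives at intermediate points ([coord_MVT]), from
    which follow the chain rule, the stability of smoothness and of jets under
    composition, and local injectivity. A chart composed with a diffeomorphism is
    a chart; this reduces the statements on frames to changes of charts. *)

(** * Mean value theorem and chain rule from partial derivatives *)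

Section MeanValue.
Context {R : realType}.

Lemma coord_norm_le m (v : 'rV[R]_m) i : `|v 0 i| <= `|v|.
Proof.
rewrite [leRHS]/Num.Def.normr /= mx_normrE.
by apply: (le_bigmax _ (fun ij => `|v ij.1 ij.2|) (0, i)).
Qed.

Lemma rV_norm_le m (v : 'rV[R]_m) c :
  0 <= c -> (forall i, `|v 0 i| <= c) -> `|v| <= c.
Proof.
move=> c0 vc; rewrite [leLHS]/Num.Def.normr /= mx_normrE; apply: bigmax_le => //.
by case=> i j _ /=; rewrite ord1.
Qed.

Lemma rV_norm_lt m (v : 'rV[R]_m) c :
  0 < c -> (forall i, `|v 0 i| < c) -> `|v| < c.
Proof.
move=> c0 vc; rewrite [ltLHS]/Num.Def.normr /= mx_normrE; apply: bigmax_lt => //.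
by case=> i j _ /=; rewrite ord1.
Qed.

Lemma norm_delta_mx_le m (i : 'I_m) : `|delta_mx 0 i : 'rV[R]_m| <= 1.
Proof.
apply: rV_norm_le => // j; rewrite mxE /=.
by case: (_ == _); rewrite ?normr1 ?normr0.
Qed.

(** The line through [x] in the direction [v] turns directional derivatives of
    [f] into derivatives of a function of one variable. *)
Lemma derive_line (V W : normedModType R) (f : V -> W) x v t :
  'D_1 (fun s : R => f (s *: v + x)) t = 'D_v f (t *: v + x) /\
  (derivable (fun s : R => f (s *: v + x)) t 1 <-> derivable f (t *: v + x) v).
Proof.
rewrite /derive /derivable.
suff -> : (fun h => h^-1 *: (((fun s : R => f (s *: v + x)) \o shift t) (h *: 1)
     - (fun s : R => f (s *: v + x)) t)) =
  (fun h => h^-1 *: ((f \o shift (t *: v + x)) (h *: v) - f (t *: v + x))) by [].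
by apply/funext => h /=; rewrite [_%:A]mulr1 scalerDl addrA.
Qed.

Lemma derive_translate (V W : normedModType R) (f : V -> W) c x v :
  'D_v (fun y => f (y + c)) x = 'D_v f (x + c) /\
  (derivable (fun y => f (y + c)) x v <-> derivable f (x + c) v).
Proof.
rewrite /derive /derivable.
suff -> : (fun h : R => h^-1 *: (((fun y => f (y + c)) \o shift x) (h *: v) - f (x + c)))
  = (fun h => h^-1 *: ((f \o shift (x + c)) (h *: v) - f (x + c))) by [].
by apply/funext => h /=; rewrite addrA.
Qed.

Lemma dir_MVT (V : normedModType R) (f : V -> R) x v (h : R) :
  (forall t : R, `|t| <= `|h| -> derivable f (t *: v + x) v) ->
  exists2 t : R, `|t| <= `|h| & f (h *: v + x) - f x = h * 'D_v f (t *: v + x).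
Proof.
move=> df; pose g := fun s : R => f (s *: v + x).
have dg (t : R) : `|t| <= `|h| -> is_derive t 1 g ('D_v f (t *: v + x)).
  move=> th; have [g1 g2] := derive_line f x v t.
  by apply: DeriveDef => //; apply/g2; exact: df.
have gc (t : R) : `|t| <= `|h| -> {for t, continuous g}.
  move=> /dg [gt _]; apply: differentiable_continuous.
  exact/derivable1_diffP.
have g0 : g 0 = f x by rewrite /g scale0r add0r.
have [h0|h0] := leP 0 h.
- have bd (t : R) : t \in `[0, h] -> `|t| <= `|h|.
    by rewrite in_itv /= => /andP[t0 th]; rewrite !ger0_norm.
  have [||c ch eq] := @MVT_segment R g (fun t => 'D_v f (t *: v + x)) 0 h h0.
  + by move=> t th; apply/dg/bd; rewrite in_itv /= !ltW ?(itvP th).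
  + apply: continuous_in_subspaceT => t; rewrite inE => th; exact/gc/bd.
  exists c; first exact: bd.
  by rewrite -g0 -/(g h) eq subr0 mulrC.
- have bd (t : R) : t \in `[h, 0] -> `|t| <= `|h|.
    rewrite in_itv /= => /andP[t0 th].
    by rewrite !ler0_norm ?lerN2 // (ltW h0).
  have [||c ch eq] := @MVT_segment R g (fun t => 'D_v f (t *: v + x)) h 0 (ltW h0).
  + by move=> t th; apply/dg/bd; rewrite in_itv /= !ltW ?(itvP th).
  + apply: continuous_in_subspaceT => t; rewrite inE => th; exact/gc/bd.
  exists c; first exact: bd.
  by rewrite -g0 -/(g h) -opprB eq sub0r mulrN opprK mulrC.
Qed.

(** Moving from [x] to [x + v] one coordinate at a time. *)
Lemma coord_MVT m (f : 'rV[R]_m -> R) x v :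
  (forall i y, `|y - x| <= `|v| -> derivable f y (delta_mx 0 i)) ->
  exists2 xi : 'I_m -> 'rV[R]_m, (forall i, `|xi i - x| <= `|v|) &
    f (x + v) - f x = \sum_i v 0 i * 'D_(delta_mx 0 i) f (xi i).
Proof.
move=> df.
pose p (k : nat) : 'rV[R]_m := \row_j (if (j < k)%N then v 0 j else 0).
have pS (i : 'I_m) : p i.+1 = v 0 i *: delta_mx 0 i + p i.
  apply/rowP => j; rewrite !mxE /= ltnS.
  case: (ltngtP j i) => [ji|ij|/val_inj ->].
  - rewrite (_ : j == i = false) ?mulr0 ?add0r //.
    by apply/negP => /eqP ji'; rewrite ji' ltnn in ji.
  - rewrite (_ : j == i = false) ?mulr0 ?add0r //.
    by apply/negP => /eqP ji'; rewrite ji' ltnn in ij.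
  - by rewrite eqxx mulr1 addr0.
have bd (i : 'I_m) t : `|t| <= `|v 0 i| -> `|(t *: delta_mx 0 i + (p i + x)) - x| <= `|v|.
  move=> ti; rewrite addrA addrK; apply: rV_norm_le => // j; rewrite !mxE /=.
  have [->|ji] := eqVneq j i.
    by rewrite ltnn mulr1 addr0; apply: le_trans ti _; exact: coord_norm_le.
  rewrite mulr0 add0r; case: ifP => _; first exact: coord_norm_le.
  by rewrite normr0.
have step (i : 'I_m) : exists y, `|y - x| <= `|v| /\
   f (x + p i.+1) - f (x + p i) = v 0 i * 'D_(delta_mx 0 i) f y.
  have [t ti|t ti eq] := @dir_MVT _ f (p i + x) (delta_mx 0 i) (v 0 i).
    by apply: df; exact: bd.
  exists (t *: delta_mx 0 i + (p i + x)); split; first exact: bd.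
  by rewrite -eq pS [x + (_ + _)]addrC -addrA [x + p i]addrC.
have [xi xiP] := choice step.
exists xi; first by move=> i; have [] := xiP i.
have -> : f (x + v) - f x = f (x + p m) - f (x + p 0%N).
  congr (f (x + _) - f _); first by apply/rowP => j; rewrite mxE ltn_ord.
  by rewrite (_ : p 0%N = 0) ?addr0 //; apply/rowP => j; rewrite !mxE.
rewrite -(telescope_sumr (fun k => f (x + p k))) // big_mkord.
by apply: eq_bigr => i _; have [_ <-] := xiP i.
Qed.

Lemma zero_partials_constant m (f : 'rV[R]_m -> R) x r :
  (forall y, ball x r y -> forall i,
     derivable f y (delta_mx 0 i) /\ 'D_(delta_mx 0 i) f y = 0) ->
  forall y, ball x r y -> f y = f x.
Proof.
move=> df y xy; have yE : x + (y - x) = y by rewrite addrC subrK.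
have inb z : `|z - x| <= `|y - x| -> ball x r z.
  move=> zx; move: xy; rewrite -!ball_normE /ball_ /= => xy.
  by rewrite distrC; apply: le_lt_trans zx _; rewrite distrC.
have [i z zx|xi xiP eq] := @coord_MVT m f x (y - x).
  by have [] := df z (inb _ zx) i.
apply/eqP; rewrite -subr_eq0 -{1}yE eq big1 // => i _.
by have [_ ->] := df (xi i) (inb _ (xiP i)) i; rewrite mulr0.
Qed.

End MeanValue.

Section ChainRule.
Context {R : realType}.

Lemma rV_cvg (T : Type) (F : set_system T) (FF : Filter F) n
    (f : T -> 'rV[R]_n) (l : 'rV[R]_n) :
  (forall k : 'I_n, f t 0 k @[t --> F] --> l 0 k) -> f @ F --> l.
Proof.
move=> fl; apply/cvgrPdist_lt => e e0; near=> t.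
apply: rV_norm_lt => // k; rewrite !mxE.
move: k; near: t; apply: filter_forall => k.
by move/cvgrPdist_lt : (fl k) => /(_ _ e0).
Unshelve. all: by end_near. Qed.

Lemma rV_continuous (T : topologicalType) n (f : T -> 'rV[R]_n) x :
  (forall k, {for x, continuous (fun t => f t 0 k)}) -> {for x, continuous f}.
Proof. by move=> fk; apply: rV_cvg => k; exact: fk. Qed.

Lemma derivable1_continuous (V : normedModType R) (f : R -> V) t :
  derivable f t 1 -> {for t, continuous f}.
Proof. by move=> ft; exact/differentiable_continuous/derivable1_diffP. Qed.

(** No differentiability of [g] is assumed: the increments of [g] are expressed by
    its partial derivatives at intermediate points, which converge to [c t]. *)
Lemma chain_curve n (c : R -> 'rV[R]_n) (g : 'rV[R]_n -> R) (t : R) (a : 'I_n -> R) :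
  (forall k, is_derive t 1 (fun s => c s 0 k) (a k)) ->
  (\forall y \near c t, forall k, derivable g y (delta_mx 0 k)) ->
  (forall k, {for c t, continuous ('D_(delta_mx 0 k) g)}) ->
  is_derive t 1 (g \o c) (\sum_k a k * 'D_(delta_mx 0 k) g (c t)).
Proof.
move=> dc dg cg; pose v h := c (h + t) - c t.
have cc : {for t, continuous c}.
  by apply: rV_continuous => k; apply: derivable1_continuous; case: (dc k).
have [r /= r0 rg] := (nbhs_ballP _ _).1 dg.
have vr : \forall h \near (0 : R), `|v h| < r.
  have : c (h + t) @[h --> (0 : R)] --> c t.
    by rewrite -[t in X in _ --> X]add0r; apply: continuous_comp;
      [apply: cvgD; [exact: cvg_id|exact: cvg_cst]|rewrite add0r].
  by move/cvgrPdist_lt => /(_ _ r0); apply: filterS => h; rewrite distrC.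
have ex h : exists xi : 'I_n -> 'rV[R]_n, (forall k, `|xi k - c t| <= `|v h|) /\
    (`|v h| < r -> g (c (h + t)) - g (c t) = \sum_k v h 0 k * 'D_(delta_mx 0 k) g (xi k)).
  have [vh|vh] := ltP `|v h| r; last first.
    exists (fun=> c t); split => // k; by rewrite subrr normr0.
  have [k y yv|xi xi1 xi2] := @coord_MVT R n g (c t) (v h).
    apply: rg; rewrite -ball_normE /ball_ /= distrC; exact: le_lt_trans vh.
  by exists xi; split => // _; rewrite -xi2 /v [c t + _]addrC subrK.
have [xi xiP] := choice ex.
have v0 : v h @[h --> 0] --> (0 : 'rV[R]_n).
  rewrite -(subrr (c t)); apply: cvgB; last exact: cvg_cst.
  rewrite -[t in X in _ --> X]add0r; apply: continuous_comp;
      [apply: cvgD; [exact: cvg_id|exact: cvg_cst]|by rewrite add0r].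
have xic k : xi h k @[h --> 0^'] --> c t.
  apply/cvgrPdist_lt => e e0; near=> h.
  rewrite distrC; apply: le_lt_trans (proj1 (xiP h) k) _; near: h.
  apply: nbhs_dnbhs; move/cvgrPdist_lt : v0 => /(_ _ e0).
  by apply: filterS => h; rewrite sub0r normrN.
have lim : h^-1 *: (((g \o c) \o shift t) (h *: 1) - (g \o c) t) @[h --> 0^'] -->
    \sum_k a k * 'D_(delta_mx 0 k) g (c t).
  have : \sum_k (h^-1 * v h 0 k) * 'D_(delta_mx 0 k) g (xi h k) @[h --> 0^'] -->
      \sum_k a k * 'D_(delta_mx 0 k) g (c t).
    apply: (cvg_big add_continuous) => i _ /=.
    apply: cvgM; last exact: cvg_comp (xic i) (cg i).
    have [d1 <-] := dc i; rewrite /derive.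
    suff -> : (fun h => h^-1 * v h 0 i) = (fun h => h^-1 *:
         (((fun s => c s 0 i) \o shift t) (h *: 1) - c t 0 i)) by [].
    by apply/funext => h; rewrite /v /= !mxE [_%:A]mulr1.
  apply: cvg_trans; apply: near_eq_cvg; apply: cvg_within; near=> h.
  rewrite /= [_%:A]mulr1 (proj2 (xiP h)); last by near: h.
  by rewrite /GRing.scale /= mulr_sumr; apply: eq_bigr => k _; rewrite mulrA.
by apply: DeriveDef; [apply/cvg_ex; eexists; exact: lim|exact: cvg_lim lim].
Unshelve. all: by end_near. Qed.

End ChainRule.

(** * Smooth functions on open sets *)

Section Smooth.
Context {R : realType}.

Lemma derive_comp_rV (V : normedModType R) n (f : V -> 'rV[R]_n) (g : 'rV[R]_n -> R) x v :
  (forall k, derivable (fun y => f y 0 k) x v) ->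
  (\forall y \near f x, forall k, derivable g y (delta_mx 0 k)) ->
  (forall k, {for f x, continuous ('D_(delta_mx 0 k) g)}) ->
  derivable (g \o f) x v /\
  'D_v (g \o f) x = \sum_k 'D_v (fun y => f y 0 k) x * 'D_(delta_mx 0 k) g (f x).
Proof.
move=> df dg cg.
have x0 : 0 *: v + x = x by rewrite scale0r add0r.
have [k| | |dgf eq] := @chain_curve R n (fun s => f (s *: v + x)) g 0
    (fun k => 'D_v (fun y => f y 0 k) x); rewrite ?x0 //.
  have [eq dl] := derive_line (fun y => f y 0 k) x v 0.
  by split; [apply/dl; rewrite x0; exact: df|rewrite eq x0].
have [eq' dl] := derive_line (g \o f) x v 0.
rewrite x0 in eq' dl; split; first exact: dl.1 dgf.
by rewrite -eq'; move: eq; rewrite x0.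
Qed.

Lemma is_derive_coord m (x v : 'rV[R]_m) k :
  is_derive x v (fun y : 'rV[R]_m => y 0 k) (v 0 k).
Proof.
have dx : derivable (fun y : 'rV[R]_m => y) x v by exact: derivable_id.
split; first exact: (derivable_mxP (fun y : 'rV[R]_m => y) x v).1 dx 0 k.
have := derive_mx dx; rewrite derive_id => /matrixP/(_ 0 k) ->.
by rewrite mxE.
Qed.

Definition ipartial m (s : seq 'I_m) (f : 'rV[R]_m -> R) : 'rV[R]_m -> R :=
  foldr (fun i g x => 'D_(delta_mx 0 i) g x) f s.

Definition smooth_on m (U : set 'rV[R]_m) (f : 'rV[R]_m -> R) :=
  forall (s : seq 'I_m) x, U x -> {for x, continuous (ipartial s f)} /\
    (forall i, derivable (ipartial s f) x (delta_mx 0 i)).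

Lemma ipartial_rcons m s i (f : 'rV[R]_m -> R) :
  ipartial (rcons s i) f = ipartial s ('D_(delta_mx 0 i) f).
Proof. by rewrite /ipartial foldr_rcons. Qed.

Lemma ipartial_cat m s s' (f : 'rV[R]_m -> R) :
  ipartial (s ++ s') f = ipartial s (ipartial s' f).
Proof. by rewrite /ipartial foldr_cat. Qed.

Lemma ipartial_eq m (U : set 'rV[R]_m) f g s : open U ->
  (forall x, U x -> f x = g x) -> forall x, U x -> ipartial s f x = ipartial s g x.
Proof.
move=> oU fg; elim: s => [|i s IH] //= x Ux.
by apply: near_eq_derive; apply: filterS (open_nbhs_nbhs (conj oU Ux)) => y /IH.
Qed.

Lemma near_eq_continuous (S T : topologicalType) (f g : S -> T) x :
  (\near x, f x = g x) -> {for x, continuous f} -> {for x, continuous g}.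
Proof.
move=> fg fc; rewrite /prop_for /continuous_at -(nbhs_singleton fg).
by apply: cvg_trans fc; apply: near_eq_cvg; apply: filterS fg => y ->.
Qed.

Section OnOpen.
Variables (m : nat) (U : set 'rV[R]_m).
Hypothesis oU : open U.

Lemma smooth_on_eq f g :
  (forall x, U x -> f x = g x) -> smooth_on U f -> smooth_on U g.
Proof.
move=> fg sf s x Ux; have [cf df] := sf s x Ux.
have nfg : \forall y \near x, ipartial s f y = ipartial s g y.
  by apply: filterS (open_nbhs_nbhs (conj oU Ux)) => y; exact: ipartial_eq.
split; first exact: near_eq_continuous cf.
by move=> i; apply: near_eq_derivable (df i).
Qed.

Lemma smooth_on_ipartial s f : smooth_on U f -> smooth_on U (ipartial s f).
Proof. by move=> sf s' x Ux; rewrite -ipartial_cat; exact: sf. Qed.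

Lemma smooth_onD1 i f : smooth_on U f -> smooth_on U ('D_(delta_mx 0 i) f).
Proof. exact: (@smooth_on_ipartial [:: i]). Qed.

Lemma smooth_on_continuous f x : smooth_on U f -> U x -> {for x, continuous f}.
Proof. by move=> sf Ux; have [] := sf [::] x Ux. Qed.

Lemma smooth_on_derivable1 f x i :
  smooth_on U f -> U x -> derivable f x (delta_mx 0 i).
Proof. by move=> sf Ux; have [] := sf [::] x Ux. Qed.

Lemma smooth_on_near f x : smooth_on U f -> U x ->
  \forall y \near x, forall i, derivable f y (delta_mx 0 i).
Proof.
move=> sf Ux; apply: filterS (open_nbhs_nbhs (conj oU Ux)) => y Uy i.
exact: smooth_on_derivable1.
Qed.

Lemma smooth_on_derive_comp (V : normedModType R) (f : V -> 'rV[R]_m) g x v :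
  (forall k, derivable (fun y => f y 0 k) x v) -> smooth_on U g -> U (f x) ->
  derivable (g \o f) x v /\
  'D_v (g \o f) x = \sum_k 'D_v (fun y => f y 0 k) x * 'D_(delta_mx 0 k) g (f x).
Proof.
move=> df sg Ufx; apply: derive_comp_rV => //; first exact: smooth_on_near.
by move=> k; apply: smooth_on_continuous Ufx; exact: smooth_onD1.
Qed.

Lemma smooth_on_derive f x v : smooth_on U f -> U x ->
  derivable f x v /\ 'D_v f x = \sum_k v 0 k * 'D_(delta_mx 0 k) f x.
Proof.
move=> sf Ux; have dk k := is_derive_coord x v k.
have [|df] := @smooth_on_derive_comp _ id f x v _ sf Ux.
  by move=> k; case: (dk k).
rewrite (_ : f \o id = f) // => ->; split => //.
by apply: eq_bigr => k _; have [_ ->] := dk k.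
Qed.

Inductive ring_closure (B : set ('rV[R]_m -> R)) : ('rV[R]_m -> R) -> Prop :=
| ring_closure_base f : B f -> ring_closure B f
| ring_closure_cst c : ring_closure B (cst c)
| ring_closure_add f g : ring_closure B f -> ring_closure B g -> ring_closure B (f + g)
| ring_closure_mul f g : ring_closure B f -> ring_closure B g -> ring_closure B (f * g).

Lemma ring_closure_sum B n (f : 'I_n -> 'rV[R]_m -> R) :
  (forall k, ring_closure B (f k)) -> ring_closure B (\sum_k f k).
Proof.
move=> Bf; elim/big_ind : _ => //; first exact: (ring_closure_cst _ 0).
exact: ring_closure_add.
Qed.

(** Smoothness by coinduction: if the first partial derivatives of the members of
    [B] are polynomial expressions in members of [B], then so are those of all
    orders, by the rules for sums and products. *)
Lemma smooth_on_coind (B : set ('rV[R]_m -> R)) :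
  (forall f x, B f -> U x -> {for x, continuous f}) ->
  (forall f x i, B f -> U x -> derivable f x (delta_mx 0 i)) ->
  (forall f i, B f -> exists2 g, ring_closure B g &
     forall x, U x -> 'D_(delta_mx 0 i) f x = g x) ->
  forall f, ring_closure B f -> smooth_on U f.
Proof.
move=> cB dB DB.
have cC f x : ring_closure B f -> U x -> {for x, continuous f}.
  move=> Bf Ux; elim: Bf => [g /cB|c|g h _ cg _ ch|g h _ cg _ ch]; first exact.
  - exact: cst_continuous.
  - exact: continuousD cg ch.
  - exact: continuousM cg ch.
have dC f x i : ring_closure B f -> U x -> derivable f x (delta_mx 0 i).
  move=> Bf Ux; elim: Bf => [g /dB|c|g h _ cg _ ch|g h _ cg _ ch]; first exact.
  - exact: derivable_cst.
  - exact: derivableD cg ch.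
  - exact: derivableM cg ch.
have DC f i : ring_closure B f -> exists2 g, ring_closure B g &
     forall x, U x -> 'D_(delta_mx 0 i) f x = g x.
  elim => [g /DB|c|g h Bg [Dg BDg eg] Bh [Dh BDh eh]|
           g h Bg [Dg BDg eg] Bh [Dh BDh eh]]; first exact.
  - exists (cst 0); first exact: ring_closure_cst.
    by move=> x _; rewrite derive_cst.
  - exists (Dg + Dh); first exact: ring_closure_add.
    by move=> x Ux; rewrite deriveD ?eg ?eh //; exact: dC.
  - exists (g * Dh + h * Dg); first by apply: ring_closure_add; exact: ring_closure_mul.
    by move=> x Ux; rewrite deriveM ?eg ?eh //; exact: dC.
move=> f Bf s; elim/last_ind: s f Bf => [|s i IH] f Bf x Ux.
  by split; [exact: cC|move=> i; exact: dC].
rewrite ipartial_rcons; have [g Bg eg] := DC f i Bf.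
have [cg dg] := IH g Bg x Ux.
have ngf : \forall y \near x, ipartial s g y = ipartial s ('D_(delta_mx 0 i) f) y.
  apply: filterS (open_nbhs_nbhs (conj oU Ux)) => y; apply: ipartial_eq => //.
  by move=> z Uz; rewrite eg.
split; first exact: near_eq_continuous cg.
by move=> j; apply: near_eq_derivable (dg j).
Qed.

Lemma smooth_on_ring f : ring_closure (smooth_on U) f -> smooth_on U f.
Proof.
apply: smooth_on_coind.
- by move=> g x sg Ux; exact: smooth_on_continuous.
- by move=> g x i sg Ux; exact: smooth_on_derivable1.
- move=> g i sg; exists ('D_(delta_mx 0 i) g) => //.
  by apply: ring_closure_base; exact: smooth_onD1.
Qed.

Lemma smooth_on_cst c : smooth_on U (cst c).
Proof. by apply: smooth_on_ring; exact: ring_closure_cst. Qed.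

Lemma smooth_onD f g : smooth_on U f -> smooth_on U g -> smooth_on U (f + g).
Proof.
by move=> sf sg; apply: smooth_on_ring; apply: ring_closure_add;
  exact: ring_closure_base.
Qed.

Lemma smooth_onM f g : smooth_on U f -> smooth_on U g -> smooth_on U (f * g).
Proof.
by move=> sf sg; apply: smooth_on_ring; apply: ring_closure_mul;
  exact: ring_closure_base.
Qed.

Lemma smooth_on_coord k : smooth_on U (fun x => x 0 k).
Proof.
apply: (@smooth_on_coind (fun f => f = fun x => x 0 k)); last exact: ring_closure_base.
- by move=> _ x -> _; exact: coord_continuous.
- by move=> _ x i -> _; by case: (is_derive_coord x (delta_mx 0 i) k).
- move=> _ i ->; exists (cst ((delta_mx 0 i : 'rV[R]_m) 0 k)).
    exact: ring_closure_cst.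
  by move=> x _; case: (is_derive_coord x (delta_mx 0 i) k).
Qed.

End OnOpen.

Lemma smooth_onS m (U V : set 'rV[R]_m) f :
  U `<=` V -> smooth_on V f -> smooth_on U f.
Proof. by move=> UV sf s x /UV; exact: sf. Qed.

(** By the chain rule, the derivatives of [g \o f] are polynomial expressions in
    functions smooth on [U] and in composites of the same kind, so
    [smooth_on_coind] applies. *)
Lemma smooth_on_comp m n (U : set 'rV[R]_m) (V : set 'rV[R]_n)
    (f : 'rV[R]_m -> 'rV[R]_n) g :
  open U -> open V -> (forall x, U x -> V (f x)) ->
  (forall k, smooth_on U (fun x => f x 0 k)) -> smooth_on V g ->
  smooth_on U (g \o f).
Proof.
move=> oU oV UV sf sg.
pose B h := smooth_on U h \/ exists2 g', smooth_on V g' & h = g' \o f.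
have comp g' x i : smooth_on V g' -> U x -> derivable (g' \o f) x (delta_mx 0 i) /\
    'D_(delta_mx 0 i) (g' \o f) x = \sum_k
      'D_(delta_mx 0 i) (fun y => f y 0 k) x * 'D_(delta_mx 0 k) g' (f x).
  move=> sg' Ux; apply: (smooth_on_derive_comp oV) => // [k|]; last exact: UV.
  exact: smooth_on_derivable1 (sf k) Ux.
apply: (@smooth_on_coind _ _ oU B); last by apply: ring_closure_base; right; exists g.
- move=> h x [sh|[g' sg' ->]] Ux; first exact: smooth_on_continuous sh Ux.
  apply: continuous_comp; last exact: smooth_on_continuous sg' (UV _ Ux).
  by apply: rV_continuous => k; exact: smooth_on_continuous (sf k) Ux.
- move=> h x i [sh|[g' sg' ->]] Ux; first exact: smooth_on_derivable1 sh Ux.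
  by have [] := comp g' x i sg' Ux.
- move=> h i [sh|[g' sg' ->]].
    exists ('D_(delta_mx 0 i) h) => //.
    by apply: ring_closure_base; left; exact: smooth_onD1.
  exists (\sum_k 'D_(delta_mx 0 i) (fun y => f y 0 k) * ('D_(delta_mx 0 k) g' \o f)).
    apply: ring_closure_sum => k; apply: ring_closure_mul; apply: ring_closure_base.
      by left; exact: smooth_onD1.
    by right; exists ('D_(delta_mx 0 k) g'); [exact: smooth_onD1 sg'|].
  move=> x Ux; have [_ ->] := comp g' x i sg' Ux.
  by rewrite fct_sumE.
Qed.

End Smooth.

(** * Jets of functions *)

(* Otherwise unification unfolds directional derivatives into limits. *)
Opaque derive.

Section Jets.
Context {R : realType}.

(** The second difference is symmetric in the two directions, and its quotient
    tends to the mixed derivative: this is the source of Schwarz' theorem. *)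
Lemma second_difference m (U : set 'rV[R]_m) (f : 'rV[R]_m -> R) x (h : R) i j :
  open U -> smooth_on U f ->
  (forall s t : R, `|s| <= `|h| -> `|t| <= `|h| ->
    U (t *: delta_mx 0 j + (s *: delta_mx 0 i + x))) ->
  exists y : 'rV[R]_m, `|y - x| <= `|h| *+ 2 /\
    f (h *: delta_mx 0 j + (h *: delta_mx 0 i + x)) - f (h *: delta_mx 0 i + x)
      - (f (h *: delta_mx 0 j + x) - f x) =
    h * (h * 'D_(delta_mx 0 j) ('D_(delta_mx 0 i) f) y).
Proof.
move=> oU sf Ux.
have ns (s : R) k : `|s| <= `|h| -> `|s *: delta_mx 0 k : 'rV[R]_m| <= `|h|.
  move=> sh; rewrite normrZ; apply: le_trans sh.
  by rewrite ler_piMr // norm_delta_mx_le.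
have U0 s : `|s| <= `|h| -> U (s *: delta_mx 0 i + x).
  by move=> sh; have := Ux s 0 sh; rewrite normr0 normr_ge0 scale0r add0r; exact.
have dG s : `|s| <= `|h| -> forall k,
   derivable f (s *: delta_mx 0 i + x) (delta_mx 0 k) /\
   derivable f ((s *: delta_mx 0 i + x) + h *: delta_mx 0 j) (delta_mx 0 k).
  move=> sh k; split; apply: smooth_on_derivable1 sf _; first exact: U0.
  by rewrite addrC; apply: Ux.
pose g := fun y => f (y + h *: delta_mx 0 j).
have dg s : `|s| <= `|h| -> derivable g (s *: delta_mx 0 i + x) (delta_mx 0 i).
  by move=> sh; apply/(proj2 (derive_translate f _ _ _)); exact: (dG s sh i).2.
have [s sh|s sh eqG] := @dir_MVT R _ (g - f) x (delta_mx 0 i) h.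
  exact: derivableB (dg s sh) (dG s sh i).1.
have [df df'] := dG s sh i.
have [t th|t th eqD] := @dir_MVT R _ ('D_(delta_mx 0 i) f)
    (s *: delta_mx 0 i + x) (delta_mx 0 j) h.
  by apply: smooth_on_derivable1 (Ux _ _ sh th); exact: smooth_onD1.
exists (t *: delta_mx 0 j + (s *: delta_mx 0 i + x)); split.
  rewrite addrA addrK mulr2n; apply: le_trans (ler_normD _ _) _.
  by rewrite lerD // ns.
rewrite -eqD; move: eqG; rewrite (deriveB (dg s sh) df).
rewrite (proj1 (derive_translate f _ _ _)) [(g - f) _]/(g _ - f _) [(g - f) x]/(g _ - f _) /g.
by rewrite ![_ + h *: delta_mx 0 j]addrC => <-.
Qed.

Lemma add_half_le (s t e : R) : s < e / 2 -> t < e / 2 -> s + t <= e.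
Proof. by move=> s2 t2; rewrite (splitr e) lerD // ltW. Qed.

Lemma Schwarz m (U : set 'rV[R]_m) (f : 'rV[R]_m -> R) x i j :
  open U -> smooth_on U f -> U x ->
  'D_(delta_mx 0 j) ('D_(delta_mx 0 i) f) x = 'D_(delta_mx 0 i) ('D_(delta_mx 0 j) f) x.
Proof.
move=> oU sf Ux; apply/eqP; rewrite -subr_eq0 -normr_le0; apply/ler_addgt0Pr => e e0.
rewrite add0r.
have cij := smooth_on_continuous (smooth_onD1 j (smooth_onD1 i sf)) Ux.
have cji := smooth_on_continuous (smooth_onD1 i (smooth_onD1 j sf)) Ux.
have e2 : 0 < e / 2 by rewrite divr_gt0.
have Un : nbhs x U by exact: open_nbhs_nbhs.
move/cvgrPdist_lt : cij => /(_ _ e2) nij; move/cvgrPdist_lt : cji => /(_ _ e2) nji.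
have [r /= r0 rU] := (nbhs_ballP _ _).1 (filterI Un (filterI nij nji)).
pose h := r / 3.
have h0 : 0 < h by rewrite divr_gt0.
have nh : `|h| *+ 2 < r.
  rewrite gtr0_norm // /h mulr2n; lra.
have inb (y : 'rV[R]_m) : `|y - x| <= `|h| *+ 2 -> ball x r y.
  by move=> yx; rewrite -ball_normE /ball_ /= distrC; exact: le_lt_trans yx nh.
have ns (s : R) (k : 'I_m) : `|s| <= `|h| -> `|s *: delta_mx 0 k : 'rV[R]_m| <= `|h|.
  move=> sh; rewrite normrZ; apply: le_trans sh.
  by rewrite ler_piMr // norm_delta_mx_le.
have inU k l (s t : R) : `|s| <= `|h| -> `|t| <= `|h| ->
    U (t *: delta_mx 0 k + (s *: delta_mx 0 l + x)).
  move=> sh th; apply: (rU _ _).1; apply: inb.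
  rewrite addrA addrK mulr2n; apply: le_trans (ler_normD _ _) _.
  by rewrite lerD // ns.
have [y [yx ey]] := second_difference oU sf (inU j i).
have [z [zx ez]] := second_difference oU sf (inU i j).
have eyz : 'D_(delta_mx 0 j) ('D_(delta_mx 0 i) f) y =
    'D_(delta_mx 0 i) ('D_(delta_mx 0 j) f) z.
  have hn0 : h != 0 by rewrite gt_eqF.
  apply: (mulfI hn0); apply: (mulfI hn0); apply: etrans (esym ey) (etrans _ ez).
  rewrite [h *: delta_mx 0 j + (h *: _ + x)]addrCA.
  by move: (f _) (f _) (f _) (f _) => a b c d; ring.
have [_ [/= n1 _]] := rU _ (inb _ yx); have [_ [_ /= n2]] := rU _ (inb _ zx).
rewrite -eyz in n2; move: n1 n2.
move: ('D_(delta_mx 0 j) ('D_(delta_mx 0 i) f) x) => a.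
move: ('D_(delta_mx 0 j) ('D_(delta_mx 0 i) f) y) => c.
move: ('D_(delta_mx 0 i) ('D_(delta_mx 0 j) f) x) => b n1 n2.
apply: le_trans (ler_distD c a b) _; rewrite [ `|c - b|]distrC.
exact: add_half_le n1 n2.
Qed.

Lemma ipartial_derive m (U : set 'rV[R]_m) f x s i : open U -> smooth_on U f -> U x ->
  ipartial s ('D_(delta_mx 0 i) f) x = 'D_(delta_mx 0 i) (ipartial s f) x.
Proof.
move=> oU sf; elim: s x => [|j s IH] x Ux //=.
have -> : 'D_(delta_mx 0 j) (ipartial s ('D_(delta_mx 0 i) f)) x =
    'D_(delta_mx 0 j) ('D_(delta_mx 0 i) (ipartial s f)) x.
  by apply: near_eq_derive; apply: filterS (open_nbhs_nbhs (conj oU Ux)) => y /IH.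
exact: Schwarz oU (smooth_on_ipartial s sf) Ux.
Qed.

Definition eq_jet m (j : nat) (x : 'rV[R]_m) (f g : 'rV[R]_m -> R) :=
  forall s : seq 'I_m, (size s <= j)%N -> ipartial s f x = ipartial s g x.

Lemma eq_jet_val m j (x : 'rV[R]_m) f g : eq_jet j x f g -> f x = g x.
Proof. by move=> /(_ [::] isT). Qed.

Lemma eq_jetS m j (x : 'rV[R]_m) f g : eq_jet j.+1 x f g <->
  f x = g x /\ forall i, eq_jet j x ('D_(delta_mx 0 i) f) ('D_(delta_mx 0 i) g).
Proof.
split=> [fg|[fg dfg] s].
  split=> [|i s sj]; first exact: eq_jet_val fg.
  by rewrite -!ipartial_rcons; apply: fg; rewrite size_rcons.
case/lastP: s => [|s i] //; rewrite size_rcons => sj.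
by rewrite !ipartial_rcons; exact: dfg.
Qed.

Lemma eq_jet_le m j j' (x : 'rV[R]_m) f g :
  (j <= j')%N -> eq_jet j' x f g -> eq_jet j x f g.
Proof. by move=> jj' fg s sj; apply: fg; exact: leq_trans jj'. Qed.

Lemma eq_jet_sym m j (x : 'rV[R]_m) f g : eq_jet j x f g -> eq_jet j x g f.
Proof. by move=> fg s sj; rewrite fg. Qed.

Lemma eq_jet_trans m j (x : 'rV[R]_m) f g h :
  eq_jet j x f g -> eq_jet j x g h -> eq_jet j x f h.
Proof. by move=> fg gh s sj; rewrite fg // gh. Qed.

Section JetsOnOpen.
Variables (m : nat) (U : set 'rV[R]_m) (x : 'rV[R]_m).
Hypotheses (oU : open U) (Ux : U x).

Lemma eq_on_eq_jet f g j : (forall y, U y -> f y = g y) -> eq_jet j x f g.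
Proof. by move=> fg s _; exact: ipartial_eq Ux. Qed.

Lemma eq_jetD f f' g g' j :
  smooth_on U f -> smooth_on U f' -> smooth_on U g -> smooth_on U g' ->
  eq_jet j x f f' -> eq_jet j x g g' -> eq_jet j x (f + g) (f' + g').
Proof.
elim: j f f' g g' => [|j IH] f f' g g' sf sf' sg sg' ff' gg'.
  by case=> // _; rewrite /= !fctE (eq_jet_val ff') (eq_jet_val gg').
have [v1 /= d1] := (eq_jetS _ _ _ _).1 ff'; have [v2 /= d2] := (eq_jetS _ _ _ _).1 gg'.
apply/eq_jetS; split=> [|i]; first by rewrite !fctE v1 v2.
have D a b : smooth_on U a -> smooth_on U b -> forall y, U y ->
    'D_(delta_mx 0 i) (a + b) y = ('D_(delta_mx 0 i) a + 'D_(delta_mx 0 i) b) y.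
  by move=> sa sb y Uy; rewrite deriveD //; exact: smooth_on_derivable1 Uy.
apply: eq_jet_trans (eq_on_eq_jet (D _ _ sf sg)) _.
apply: eq_jet_trans (eq_jet_sym (eq_on_eq_jet (D _ _ sf' sg'))).
apply: IH (d1 i) (d2 i); [exact: smooth_onD1 sf|exact: smooth_onD1 sf'|..].
  exact: smooth_onD1 sg.
exact: smooth_onD1 sg'.
Qed.

Lemma eq_jetM f f' g g' j :
  smooth_on U f -> smooth_on U f' -> smooth_on U g -> smooth_on U g' ->
  eq_jet j x f f' -> eq_jet j x g g' -> eq_jet j x (f * g) (f' * g').
Proof.
elim: j f f' g g' => [|j IH] f f' g g' sf sf' sg sg' ff' gg'.
  by case=> // _; rewrite /= !fctE (eq_jet_val ff') (eq_jet_val gg').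
have [v1 /= d1] := (eq_jetS _ _ _ _).1 ff'; have [v2 /= d2] := (eq_jetS _ _ _ _).1 gg'.
apply/eq_jetS; split=> [|i]; first by rewrite !fctE v1 v2.
have D a b : smooth_on U a -> smooth_on U b -> forall y, U y ->
    'D_(delta_mx 0 i) (a * b) y =
    (a * 'D_(delta_mx 0 i) b + b * 'D_(delta_mx 0 i) a) y.
  by move=> sa sb y Uy; rewrite deriveM //; exact: smooth_on_derivable1 Uy.
apply: eq_jet_trans (eq_on_eq_jet (D _ _ sf sg)) _.
apply: eq_jet_trans (eq_jet_sym (eq_on_eq_jet (D _ _ sf' sg'))).
have [Df Df'] := (smooth_onD1 i sf, smooth_onD1 i sf').
have [Dg Dg'] := (smooth_onD1 i sg, smooth_onD1 i sg').
apply: eq_jetD; try exact: smooth_onM.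
  exact: IH sf sf' Dg Dg' (eq_jet_le (leqnSn j) ff') (d2 i).
exact: IH sg sg' Df Df' (eq_jet_le (leqnSn j) gg') (d1 i).
Qed.

Lemma eq_jet_sum n (f f' : 'I_n -> 'rV[R]_m -> R) j :
  (forall k, smooth_on U (f k)) -> (forall k, smooth_on U (f' k)) ->
  (forall k, eq_jet j x (f k) (f' k)) -> eq_jet j x (\sum_k f k) (\sum_k f' k).
Proof.
move=> sf sf' ff'.
suff [] : [/\ smooth_on U (\sum_k f k), smooth_on U (\sum_k f' k) &
   eq_jet j x (\sum_k f k) (\sum_k f' k)] by [].
elim/big_ind2 : _ => //; first by split=> //; exact: smooth_on_cst.
move=> a a' b b' [s1 s2 e1] [t1 t2 e2].
by split; [exact: smooth_onD|exact: smooth_onD|exact: eq_jetD].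
Qed.

Lemma smooth_on_derive_comp_eq n (V : set 'rV[R]_n) (f : 'rV[R]_m -> 'rV[R]_n) g i :
  open V -> (forall y, U y -> V (f y)) ->
  (forall k, smooth_on U (fun y => f y 0 k)) -> smooth_on V g ->
  forall y, U y -> 'D_(delta_mx 0 i) (g \o f) y =
   (\sum_k (('D_(delta_mx 0 k) g \o f) * 'D_(delta_mx 0 i) (fun y => f y 0 k))) y.
Proof.
move=> oV UV sf sg y Uy.
have [k||_ ->] := smooth_on_derive_comp oV (f := f) (x := y) (v := delta_mx 0 i) _ sg.
- exact: smooth_on_derivable1 (sf k) Uy.
- exact: UV.
- by rewrite fct_sumE; apply: eq_bigr => k _; rewrite mulrC.
Qed.

(** The chain rule expresses the derivatives of a composite through derivatives
    of the factors of no higher order, so induction on [j] applies. *)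
Lemma eq_jet_comp n (V : set 'rV[R]_n) (f f' : 'rV[R]_m -> 'rV[R]_n) g g' j :
  open V -> (forall y, U y -> V (f y)) -> (forall y, U y -> V (f' y)) ->
  (forall k, smooth_on U (fun y => f y 0 k)) ->
  (forall k, smooth_on U (fun y => f' y 0 k)) ->
  smooth_on V g -> smooth_on V g' ->
  (forall k, eq_jet j x (fun y => f y 0 k) (fun y => f' y 0 k)) ->
  eq_jet j (f x) g g' -> eq_jet j x (g \o f) (g' \o f').
Proof.
move=> oV Vf Vf' sf sf' + + ff'.
have fx : f x = f' x by apply/rowP => k; exact: eq_jet_val (ff' k).
elim: j g g' ff' => [|j IH] g g' ff' sg sg' gg'.
  by case=> // _; rewrite /= -fx (eq_jet_val gg').
have ff'j k := eq_jet_le (leqnSn j) (ff' k).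
have [v1 d1] := (eq_jetS _ _ _ _).1 gg'.
apply/eq_jetS; split=> [|i]; first by rewrite /= v1 fx.
apply: eq_jet_trans (@eq_on_eq_jet _ _ j (smooth_on_derive_comp_eq i oV Vf sf sg)) _.
apply: eq_jet_trans (eq_jet_sym
  (@eq_on_eq_jet _ _ j (smooth_on_derive_comp_eq i oV Vf' sf' sg'))).
have sc k (a : 'rV[R]_n -> R) (c : 'rV[R]_m -> 'rV[R]_n) :
    (forall y, U y -> V (c y)) -> (forall k, smooth_on U (fun y => c y 0 k)) ->
    smooth_on V a -> smooth_on U ('D_(delta_mx 0 k) a \o c).
  by move=> Vc sc sa; exact: smooth_on_comp oU oV Vc sc (smooth_onD1 k sa).
apply: eq_jet_sum => k.
- exact: smooth_onM (sc k g f Vf sf sg) (smooth_onD1 i (sf k)).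
- exact: smooth_onM (sc k g' f' Vf' sf' sg') (smooth_onD1 i (sf' k)).
have [_ dff'] := (eq_jetS _ _ _ _).1 (ff' k).
apply: eq_jetM (dff' i).
- exact: sc k g f Vf sf sg.
- exact: sc k g' f' Vf' sf' sg'.
- exact: smooth_onD1 (sf k).
- exact: smooth_onD1 (sf' k).
- exact: IH ff'j (smooth_onD1 k sg) (smooth_onD1 k sg') (d1 k).
Qed.

End JetsOnOpen.

End Jets.

(** * Generalized Wronskians *)

Section Wronskian.
Context {R : realType} {m : nat}.
Implicit Type U : set 'rV[R]_m.

Lemma smooth_on_sum U (I : Type) (r : seq I) (P : pred I) (f : I -> 'rV[R]_m -> R) : open U ->
  (forall i, P i -> smooth_on U (f i)) -> smooth_on U (fun x => \sum_(i <- r | P i) f i x).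
Proof.
move=> oU sf; elim: r => [|i r IH].
  apply: (@smooth_on_eq _ _ _ oU (cst 0)); last exact: smooth_on_cst.
  by move=> x _; rewrite big_nil.
case Pi: (P i).
  apply: (@smooth_on_eq _ _ _ oU (f i + (fun x => \sum_(i <- r | P i) f i x))).
    by move=> x _; rewrite big_cons Pi.
  exact: smooth_onD (sf _ Pi) IH.
by apply: (smooth_on_eq oU _ IH) => x _; rewrite big_cons Pi.
Qed.

Lemma smooth_on_prod U (I : Type) (r : seq I) (f : I -> 'rV[R]_m -> R) : open U ->
  (forall i, smooth_on U (f i)) -> smooth_on U (fun x => \prod_(i <- r) f i x).
Proof.
move=> oU sf; elim: r => [|i r IH].
  apply: (@smooth_on_eq _ _ _ oU (cst 1)); last exact: smooth_on_cst.
  by move=> x _; rewrite big_nil.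
apply: (@smooth_on_eq _ _ _ oU (f i * (fun x => \prod_(i <- r) f i x))).
  by move=> x _; rewrite big_cons.
exact: smooth_onM (sf _) IH.
Qed.

Lemma smooth_on_det U n (A : 'rV[R]_m -> 'M[R]_n) : open U ->
  (forall i j, smooth_on U (fun x => A x i j)) -> smooth_on U (fun x => \det (A x)).
Proof.
move=> oU sA; apply: smooth_on_sum => // s _.
apply: (@smooth_on_eq _ _ _ oU (cst ((-1) ^+ odd_perm s) * (fun x => \prod_i A x i (s i)))).
  by [].
by apply: smooth_onM => //; [exact: smooth_on_cst|exact: smooth_on_prod].
Qed.

(** A generalized Wronskian matrix: [rows] selects pairs of a differential
    operator and a component. The functions index the matrix rows, so that
    [v *m jet_matrix f rows x = 0] is a linear relation between the functions,
    valid at [x] for the selected derivatives. *)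
Definition jet_matrix n p (f : 'I_n -> 'I_p -> 'rV[R]_m -> R)
    (rows : 'I_n -> seq 'I_m * 'I_p) (x : 'rV[R]_m) : 'M[R]_n :=
  \matrix_(k, i) ipartial (rows i).1 (f k (rows i).2) x.

Lemma smooth_jet_det U n p (f : 'I_n -> 'I_p -> 'rV[R]_m -> R) rows : open U ->
  (forall k l, smooth_on U (f k l)) -> smooth_on U (fun x => \det (jet_matrix f rows x)).
Proof.
move=> oU sf; apply: smooth_on_det => // i k.
apply: (@smooth_on_eq _ _ _ oU (ipartial (rows k).1 (f i (rows k).2))).
  by move=> x _; rewrite mxE.
by apply: smooth_on_ipartial.
Qed.

Lemma ball_open_smooth_nonzero U (g : 'rV[R]_m -> R) x : open U -> U x ->
  smooth_on U g -> g x != 0 ->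
  exists2 r : R, 0 < r & forall y, ball x r y -> U y /\ g y != 0.
Proof.
move=> oU Ux sg gx.
have ng : \forall y \near x, g y != 0.
  have cg := smooth_on_continuous sg Ux.
  have : nbhs (g x) [set t | t != 0] by apply: open_nbhs_nbhs; split; [exact: open_neq|].
  exact: cg.
have [r /= r0 rB] := (nbhs_ballP _ _).1 (filterI (open_nbhs_nbhs (conj oU Ux)) ng).
by exists r => // y /rB.
Qed.

Lemma det_neq0_inj n (A : 'M[R]_n) (v : 'rV[R]_n) : \det A != 0 -> v *m A = 0 -> v = 0.
Proof.
move=> dA vA; have uA : A \in unitmx by rewrite unitmxE unitfE.
by rewrite -[v]mulmx1 -(mulmxV uA) mulmxA vA mul0mx.
Qed.

(** If the bordered determinant vanishes, the new row is the combination of the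
    old ones with the coefficients that solve the old square system. *)
Lemma bordered_dependence n p (f : 'I_n.+1 -> 'I_p -> 'rV[R]_m -> R)
    (rows : 'I_n -> seq 'I_m * 'I_p) (rows' : 'I_n.+1 -> seq 'I_m * 'I_p) x (c : 'rV[R]_n) :
  (forall i, rows' (lift ord0 i) = rows i) ->
  \det (jet_matrix (fun k => f (lift ord0 k)) rows x) != 0 ->
  \det (jet_matrix f rows' x) = 0 ->
  (forall i, ipartial (rows i).1 (f ord0 (rows i).2) x =
     \sum_k c 0 k * ipartial (rows i).1 (f (lift ord0 k) (rows i).2) x) ->
  ipartial (rows' ord0).1 (f ord0 (rows' ord0).2) x =
     \sum_k c 0 k * ipartial (rows' ord0).1 (f (lift ord0 k) (rows' ord0).2) x.
Proof.
move=> rE dA /eqP/det0P[v v0 /rowP vN] cE.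
have col i : v 0 0 * ipartial (rows' i).1 (f ord0 (rows' i).2) x +
    \sum_k v 0 (lift ord0 k) * ipartial (rows' i).1 (f (lift ord0 k) (rows' i).2) x = 0.
  have := vN i; rewrite !mxE big_ord_recl !mxE => E; rewrite -[RHS]E.
  by congr (_ + _); apply: eq_bigr => k _; rewrite !mxE.
pose w : 'rV[R]_n := \row_k (v 0 (lift ord0 k) + v 0 0 * c 0 k).
have w0 : w = 0.
  apply: (det_neq0_inj dA); apply/rowP => i; rewrite !mxE.
  have := col (lift ord0 i); rewrite rE cE mulr_sumr -big_split /= => E.
  rewrite -[RHS]E; apply: eq_bigr => k _; rewrite !mxE mulrDl mulrA addrC //.
have vE k : v 0 (lift ord0 k) = - (v 0 0 * c 0 k).
  by move/rowP : w0 => /(_ k); rewrite !mxE => /eqP; rewrite addr_eq0 => /eqP.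
have v00 : v 0 0 != 0.
  apply: contraNneq v0 => v00; apply/eqP/rowP => k; rewrite mxE.
  by case: (unliftP ord0 k) => [k' ->|->]; rewrite ?vE v00 ?mul0r ?oppr0.
apply: (mulfI v00); have := col ord0; move/eqP; rewrite addr_eq0 => /eqP ->.
rewrite mulr_sumr -sumrN; apply: eq_bigr => k _.
by rewrite vE mulNr opprK mulrA.
Qed.

Definition row_cons n (a : R) (v : 'rV[R]_n) : 'rV[R]_n.+1 :=
  \row_i (if unlift ord0 i is Some i' then v 0 i' else a).

Lemma row_consS n a (v : 'rV[R]_n) i : row_cons a v 0 (lift ord0 i) = v 0 i.
Proof. by rewrite mxE liftK. Qed.

Lemma row_cons0 n a (v : 'rV[R]_n) : row_cons a v 0 ord0 = a.
Proof. by rewrite mxE unlift_none. Qed.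

(** The generalized Wronskian theorem, by induction on the number of functions:
    near a point where some minor of the last [n] functions is nonzero, either
    some bordered minor is nonzero, or Cramer's rule writes the first function,
    with its derivatives of order at most [n], as a combination [c] of the others.
    Differentiating these relations shows that the derivatives of [c] solve the
    homogeneous system, so that [c] is constant. *)
Theorem wronskian n p U (f : 'I_n -> 'I_p -> 'rV[R]_m -> R) :
  open U -> U !=set0 -> (forall k l, smooth_on U (f k l)) ->
  (exists2 v : 'rV[R]_n, v != 0 & exists y, exists2 r : R, 0 < r & ball y r `<=` U /\
     forall z, ball y r z -> forall l, \sum_k v 0 k * f k l z = 0) \/
  (exists2 y, U y & exists2 rows : 'I_n -> seq 'I_m * 'I_p,
     (forall i, size (rows i).1 < n)%N & \det (jet_matrix f rows y) != 0).
Proof.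
move=> oU [x0 Ux0]; elim: n f => [|n IH] f sf.
  have rows0 : 'I_0 -> seq 'I_m * 'I_p by case.
  right; exists x0 => //; exists rows0; first by case.
  by rewrite det_mx00 oner_neq0.
pose g k := f (lift ord0 k).
have [[v v0 [y [r r0 [rU fE]]]]|[y Uy [rows rn dA]]] := IH g (fun k => sf _).
  left; exists (row_cons 0 v).
    apply: contraNneq v0 => /rowP E; apply/eqP/rowP => k.
    by rewrite -(row_consS 0) E !mxE.
  exists y, r => //; split=> // z yz l; rewrite big_ord_recl row_cons0 mul0r add0r.
  by rewrite -[RHS](fE z yz l); apply: eq_bigr => k _; rewrite row_consS.
have [r r0 rU] := ball_open_smooth_nonzero oU Uy (smooth_jet_det rows oU (fun k => sf _)) dA.
pose rows' (s : seq 'I_m) (l : 'I_p) (i : 'I_n.+1) :=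
  if unlift ord0 i is Some i' then rows i' else (s, l).
have rE s l i : rows' s l (lift ord0 i) = rows i by rewrite /rows' liftK.
have r0E s l : rows' s l ord0 = (s, l) by rewrite /rows' unlift_none.
have [[s [l [z [sn yz dN]]]]|alldet] :=
  pselect (exists s l z,
    [/\ (size s <= n)%N, ball y r z & \det (jet_matrix f (rows' s l) z) != 0]).
  right; exists z; first by have [] := rU _ yz.
  exists (rows' s l) => // i; case: (unliftP ord0 i) => [i' ->|->]; rewrite ?rE ?r0E //.
  exact: leq_trans (rn i') _.
left.
pose A := jet_matrix g rows.
pose b z : 'rV[R]_n := \row_i ipartial (rows i).1 (f ord0 (rows i).2) z.
pose S k z := \sum_i b z 0 i * (\adj (A z)) i k.
pose c k z := (\det (A z))^-1 * S k z.
have cE z : ball y r z -> forall i, ipartial (rows i).1 (f ord0 (rows i).2) z =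
     \sum_k c k z * ipartial (rows i).1 (f (lift ord0 k) (rows i).2) z.
  move=> /rU[_ dz] i.
  have : (\det (A z))^-1 *: (b z *m \adj (A z)) *m A z = b z.
    by rewrite -scalemxAl -mulmxA mul_adj_mx mul_mx_scalar scalerA mulVf ?scale1r.
  move/rowP/(_ i); rewrite [RHS]mxE => <-; rewrite mxE; apply: eq_bigr => k _.
  by rewrite !mxE.
(* [bordered_dependence] extends the relation from the selected derivatives to
   all those of order at most [n]. *)
have cAll z s l : ball y r z -> (size s <= n)%N -> ipartial s (f ord0 l) z =
     \sum_k c k z * ipartial s (f (lift ord0 k) l) z.
  move=> yz sn; have [_ dz] := rU _ yz.
  have dN : \det (jet_matrix f (rows' s l) z) = 0.
    by apply/eqP; apply: contra_notT alldet => dN; exists s, l, z.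
  have := @bordered_dependence _ _ f rows (rows' s l) z (\row_k c k z) (rE s l) dz dN.
  rewrite r0E /= => H; rewrite H; first by apply: eq_bigr => k _; rewrite mxE.
  by move=> i; rewrite cE //; apply: eq_bigr => k _; rewrite mxE.
have sA i k : smooth_on U (fun z => A z i k).
  apply: (@smooth_on_eq _ _ _ oU (ipartial (rows k).1 (g i (rows k).2))).
    by move=> z _; rewrite mxE.
  exact: smooth_on_ipartial (sf (lift ord0 i) (rows k).2).
have sS k : smooth_on U (S k).
  apply: smooth_on_sum => // i _.
  apply: (@smooth_on_eq _ _ _ oU ((ipartial (rows i).1 (f ord0 (rows i).2)) *
     (cst ((-1) ^+ (k + i)) * (fun z => \det (row' k (col' i (A z))))))).
    by move=> z _; rewrite !mxE.
  apply: smooth_onM => //; first exact: smooth_on_ipartial.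
  apply: smooth_onM => //; first exact: smooth_on_cst.
  apply: smooth_on_det => // i' k'.
  by apply: (smooth_on_eq oU _ (sA (lift k i') (lift i k'))) => z _; rewrite !mxE.
have dc k z q : ball y r z -> derivable (c k) z (delta_mx 0 q).
  move=> /rU[Uz dz].
  pose D w := \det (A w); have Dz : D z != 0 := dz.
  have d1 : derivable D z (delta_mx 0 q) :=
    smooth_on_derivable1 (smooth_on_det oU sA) Uz.
  have d2 : derivable (S k) z (delta_mx 0 q) := smooth_on_derivable1 (sS k) Uz.
  have d3 : derivable (fun w => (D w)^-1) z (delta_mx 0 q) by exact: (derivableV Dz d1).
  have -> : c k = (fun w => (D w)^-1) * S k by [].
  exact: (derivableM d3 d2).
(* The selected derivatives have order below [n], so their relations can be
   differentiated once more and compared with [cAll]. *)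
have Dc z q : ball y r z -> forall k, 'D_(delta_mx 0 q) (c k) z = 0.
  move=> yz; have [Uz dz] := rU _ yz.
  suff : (\row_k 'D_(delta_mx 0 q) (c k) z) *m A z = 0.
    by move/(det_neq0_inj dz)/rowP => E k; have := E k; rewrite !mxE.
  apply/rowP => i; rewrite !mxE; set s := (rows i).1; set l := (rows i).2.
  have ds k : derivable (ipartial s (f k l)) z (delta_mx 0 q).
    by have [_] := sf k l s z Uz; exact.
  have E1 : 'D_(delta_mx 0 q) (ipartial s (f ord0 l)) z =
     'D_(delta_mx 0 q) (\sum_k (c k * ipartial s (f (lift ord0 k) l))) z.
    apply: near_eq_derive; have nb : nbhs z (ball y r).
      by apply: open_nbhs_nbhs; split=> //; exact: ball_open.
    apply: filterS nb => w yw; rewrite cAll //; last by apply: ltnW; exact: rn.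
    by rewrite fct_sumE.
  rewrite derive_sum in E1; last by move=> k; apply: derivableM => //; exact: dc.
  have := cAll z (q :: s) l yz (rn i); rewrite /= E1 => /eqP.
  rewrite -subr_eq0 -sumrB => /eqP E; rewrite -[RHS]E; apply: eq_bigr => k _.
  have := deriveM (dc k z q yz) (ds (lift ord0 k)).
  rewrite /GRing.scale /= => ->; rewrite !mxE -/s -/l.
  by rewrite addrAC subrr add0r mulrC.
have cc k z : ball y r z -> c k z = c k y.
  apply: zero_partials_constant => w yw q; split; first exact: dc.
  exact: Dc.
exists (row_cons (-1) (\row_k c k y)).
  apply/eqP => /rowP/(_ ord0); rewrite row_cons0 mxE => /eqP.
  by rewrite oppr_eq0 oner_eq0.
exists y, r => //; split=> [z /rU[]//|z yz l].
rewrite big_ord_recl row_cons0 mulN1r; have /= -> := cAll z [::] l yz isT.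
rewrite addrC; apply/eqP; rewrite subr_eq0; apply/eqP; apply: eq_bigr => k _.
by rewrite row_consS mxE (cc _ _ yz).
Qed.

End Wronskian.

(** * Leaving a ball within a level set *)

Section Escape.
Context {R : realType}.

Lemma is_derive_near (V : normedModType R) (f : R -> V) (t : R) l (e : R) : 0 < e ->
  is_derive t 1 f l ->
  \forall h \near (0 : R), `|f (h + t) - f t - h *: l| <= e * `|h|.
Proof.
move=> e0 [df <-]; have /eqaddoP := derivable_nbhs df => /(_ e e0).
apply: filterS => h; rewrite !fctE /= [_%:A]mulr1.
by rewrite opprD addrA.
Qed.

Lemma half_gain (x y D h : R) : - (D / 2 * h) <= y - x - h * D -> x + D / 2 * h <= y.
Proof. by move=> H; lra. Qed.

Lemma closure_ge0 (T : topologicalType) (S : set T) (g : T -> R) p :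
  closure S p -> {for p, continuous g} -> (forall u, S u -> 0 <= g u) -> 0 <= g p.
Proof.
move=> Sp cg S0; rewrite leNgt; apply/negP => gp.
have ng : nbhs (g p) [set y | y < 0] by apply: open_nbhs_nbhs; split; [exact: open_lt|].
have [u [Su /= gu]] := Sp _ (cg _ ng).
by have := S0 u Su; rewrite leNgt gu.
Qed.

Lemma continuous_dist (T : topologicalType) (V : normedModType R) (f : T -> V) a p :
  {for p, continuous f} -> {for p, continuous (fun u => `|f u - a|)}.
Proof. by move=> cf; apply: cvg_norm; apply: cvgB; [exact: cf|exact: cvg_cst]. Qed.

Lemma continuous_subr (T : topologicalType) (f g : T -> R) p :
  {for p, continuous f} -> {for p, continuous g} -> {for p, continuous (fun u => f u - g u)}.
Proof. by move=> cf cg; apply: cvgB; [exact: cf|exact: cg]. Qed.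

Variables (n d : nat) (T : choiceType).
Variables (u0 : 'rV[R]_n) (r : R) (k : 'I_n) (Y : set T).
Variables (A : T -> 'rV[R]_n -> 'rV[R]_d) (c : 'rV[R]_n -> R -> 'rV[R]_n).
Hypothesis r0 : 0 < r.
Hypothesis cA : forall t u, Y t -> `|u - u0| <= r -> {for u, continuous (A t)}.
Hypothesis c0 : forall u, `|u - u0| < r -> c u 0 = u.
Hypothesis cc : forall u, `|u - u0| < r -> {for 0, continuous (c u)}.
Hypothesis ck : forall u, `|u - u0| < r ->
  exists2 D : R, 0 < D & is_derive (0 : R) 1 (fun h => c u h 0 k) D.
Hypothesis cA0 : forall t u, Y t -> `|u - u0| < r ->
  is_derive (0 : R) 1 (fun h => A t (c u h)) 0.

(** The point is found by maximizing the coordinate [k] over the points of the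
    closed ball at which every [A t] with [(t, e)] in [F] has moved by at most
    [e / r] times the gain in this coordinate. At a maximizer inside the open
    ball, a small step along the curve [c] would gain more. *)
Lemma cone_maximum (F : {fset T * R}) :
  (forall i, i \in F -> Y i.1 /\ 0 < i.2) ->
  exists u, `|u - u0| = r /\ forall i, i \in F -> `|A i.1 u - A i.1 u0| <= i.2.
Proof.
move=> FY.
pose S : set 'rV[R]_n := [set u | `|u - u0| <= r /\
  forall i, i \in F -> `|A i.1 u - A i.1 u0| <= i.2 / r * (u 0 k - u0 0 k)].
have Su0 : S u0.
  by split=> [|i _]; rewrite ?subrr ?mulr0 normr0 // ltW.
have ccoord u : {for u, continuous (fun v : 'rV[R]_n => v 0 k)} by exact: coord_continuous.
have clS : closed S.
  move=> p Sp; have pr : `|p - u0| <= r.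
    rewrite -subr_ge0; apply: (@closure_ge0 _ S (fun u => r - `|u - u0|)) => //.
      by apply: continuous_subr; [exact: cst_continuous|apply: continuous_dist; exact: cvg_id].
    by move=> u [ur _]; rewrite subr_ge0.
  split=> // i iF; have [Yi _] := FY i iF.
  rewrite -subr_ge0.
  apply: (@closure_ge0 _ S (fun u => i.2 / r * (u 0 k - u0 0 k) - `|A i.1 u - A i.1 u0|)) => //.
    apply: continuous_subr; last by apply: continuous_dist; exact: cA.
    have ck' : {for p, continuous (fun u : 'rV[R]_n => u 0 k - u0 0 k)}.
      by apply: continuous_subr; [exact: ccoord|exact: cst_continuous].
    by apply: continuousM; [exact: cst_continuous|exact: ck'].
  by move=> u [_ /(_ i iF)]; rewrite subr_ge0.
have coS : compact S.
  apply: bounded_closed_compact clS.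
  exists (`|u0| + r); split; first exact: num_real.
  move=> x xr u [ur _]; apply: le_trans (ltW xr).
  rewrite -[u](subrK u0); apply: le_trans (ler_normD _ _) _.
  by rewrite addrC lerD.
have [u uS umax] : exists2 u, u \in S & forall v, v \in S -> v 0 k <= u 0 k.
  apply: EVT_max_rV => //; first by exists u0.
  by apply: continuous_subspaceT => v; exact: ccoord.
rewrite inE in uS; have [ur uF] := uS.
have ukr : u 0 k - u0 0 k <= r.
  apply: le_trans ur; apply: le_trans (ler_norm _) _.
  by rewrite (_ : u 0 k - u0 0 k = (u - u0) 0 k) ?coord_norm_le // !mxE.
exists u; split; last first.
  move=> i iF; have [_ i0] := FY i iF; apply: le_trans (uF i iF) _.
  by rewrite -mulrA ger_pMr // mulrC ler_pdivrMr // mul1r.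
apply/eqP; rewrite eq_le ur /= leNgt; apply/negP => ulr.
have [D D0 dck] := ck ulr.
have n1 : \forall h \near (0 : R), `|c u h - u0| < r.
  have cd : {for (0 : R), continuous (fun h => `|c u h - u0|)}.
    by apply: continuous_dist; exact: cc.
  have nb : nbhs `|c u 0 - u0| [set y | y < r].
    by apply: open_nbhs_nbhs; split; [exact: open_lt|rewrite /= c0].
  exact: (cd _ nb).
(* The coordinate moves with speed [D]; half of it survives the error terms. *)
have D2 : 0 < D / 2 by rewrite divr_gt0.
have n2 := is_derive_near D2 dck.
have n3 : \forall h \near (0 : R), forall i, i \in F ->
    `|A i.1 (c u h) - A i.1 u| <= i.2 / r * (D / 2) * `|h|.
  have : \forall h \near (0 : R), (\bigcap_(i in [set i | i \in F])
    [set h | `|A i.1 (c u h) - A i.1 u| <= i.2 / r * (D / 2) * `|h| ]) h.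
    apply: filter_bigI => i iF; have [Yi i0] := FY i iF.
    have e0 : 0 < i.2 / r * (D / 2) by rewrite mulr_gt0 // divr_gt0.
    have := is_derive_near e0 (cA0 Yi ulr).
    by apply: filterS => h; rewrite addr0 scaler0 subr0 c0.
  by apply: filterS => h H i; exact: H.
have [e /= e0 eP] := (nbhs_ballP _ _).1 (filterI n1 (filterI n2 n3)).
pose h := e / 2.
have h0 : 0 < h by rewrite divr_gt0.
have [h1 [h2 h3]] : `|c u h - u0| < r /\
  (`|c u (h + 0) 0 k - c u 0 0 k - h *: D| <= D / 2 * `|h| /\
   forall i, i \in F -> `|A i.1 (c u h) - A i.1 u| <= i.2 / r * (D / 2) * `|h|).
  apply: eP; rewrite -ball_normE /ball_ /= sub0r normrN gtr0_norm // /h.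
  by rewrite ltr_pdivrMr // mulr2n mulrDr mulr1 ltrDl.
have kh : u 0 k + D / 2 * h <= c u h 0 k.
  move: h2; rewrite addr0 c0 // (gtr0_norm h0) ler_norml => /andP[+ _].
  exact: half_gain.
have cuS : S (c u h).
  split; first exact: ltW.
  move=> i iF; have [_ i0] := FY i iF; have ir : 0 < i.2 / r by rewrite divr_gt0.
  rewrite -(subrK (A i.1 u) (A i.1 (c u h))) -addrA.
  apply: le_trans (ler_normD _ _) _.
  apply: le_trans (lerD (h3 i iF) (uF i iF)) _.
  rewrite (gtr0_norm h0) -mulrA -mulrDr ler_pM2l //.
  by rewrite [X in X <= _]addrA lerD2r addrC.
have := umax (c u h); rewrite inE => /(_ cuS); apply/negP; rewrite -ltNge.
by apply: lt_le_trans kh; rewrite ltrDl mulr_gt0.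
Qed.

(** If from every point [u] of the ball the curve [c u] increases the coordinate
    [k] and has zero speed under all maps [A t], then the common level set of these
    maps through the centre reaches the sphere. No differential equation is solved:
    by compactness of the sphere, it suffices to satisfy finitely many of the
    conditions up to positive errors, as in [cone_maximum]. *)
Lemma escape : exists2 u, `|u - u0| = r & forall t, Y t -> A t u = A t u0.
Proof.
pose sphere : set 'rV[R]_n := [set u | `|u - u0| = r].
have csub u : {for u, continuous (fun v : 'rV[R]_n => `|v - u0|)}.
  by apply: continuous_dist; exact: cvg_id.
have cosph : compact sphere.
  apply: bounded_closed_compact.
    exists (`|u0| + r); split; first exact: num_real.
    move=> x xr u ur; apply: le_trans (ltW xr).
    rewrite -[u](subrK u0); apply: le_trans (ler_normD _ _) _.
    by rewrite ur addrC.
  move=> p Sp; apply/eqP; rewrite eq_le -subr_ge0 -[X in _ && X]subr_ge0; apply/andP; split.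
    apply: (@closure_ge0 _ sphere (fun u => r - `|u - u0|)) => //.
      by apply: continuous_subr; [exact: cst_continuous|exact: csub].
    by move=> u ->; rewrite subrr.
  apply: (@closure_ge0 _ sphere (fun u => `|u - u0| - r)) => //.
    by apply: continuous_subr; [exact: csub|exact: cst_continuous].
  by move=> u ->; rewrite subrr.
pose f (i : T * R) : set 'rV[R]_n := [set u | sphere u /\ `|A i.1 u - A i.1 u0| <= i.2].
pose D : set (T * R) := [set i | Y i.1 /\ 0 < i.2].
have : \bigcap_(i in D) f i !=set0.
  move: cosph; rewrite compact_In0; apply.
    exists (fun i => closure (f i)); first by move=> i _; exact: closed_closure.
    move=> i [Yi i0]; apply/seteqP; split=> u.
      by move=> fu; split; [case: fu|exact: subset_closure].
    case=> su cfu; split=> //; rewrite -subr_ge0.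
    apply: (closure_ge0 (g := fun u => i.2 - `|A i.1 u - A i.1 u0|) cfu).
      apply: continuous_subr; first exact: cst_continuous.
      by apply: continuous_dist; apply: cA => //; rewrite su.
    by move=> v [_]; rewrite subr_ge0.
  move=> F FD; have [|u [ur uF]] := @cone_maximum F.
    by move=> i /FD; rewrite inE.
  by exists u => i iF; split=> //; exact: uF.
case=> u uf; have [[t Yt]|nY] := pselect (exists t, Y t); last first.
  have [|v [vr _]] := @cone_maximum fset0; first by move=> i; rewrite inE.
  by exists v => // t Yt; case: nY; exists t.
exists u; first by have [] := uf (t, 1) (conj Yt ltr01).
move=> t' Yt'; apply/eqP; rewrite -subr_eq0 -normr_le0.
apply/ler_addgt0Pr => e e0; rewrite add0r.
by have [] := uf (t', e) (conj Yt' e0).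
Qed.

End Escape.

(** * Local injectivity *)

Section LocalInjectivity.
Context {R : realType}.

Lemma det_continuous n : continuous (fun A : 'M[R]_n => \det A).
Proof.
move=> A; have FF := nbhs_filter A; rewrite /continuous_at /determinant.
refine (@cvg_big _ _ _ 0 xpredT add_continuous _ (nbhs A) _
  (fun (s : 'S_n) (B : 'M[R]_n) => (-1) ^+ s * \prod_i B i (s i)) _ FF _) => s _.
apply: cvgM; first exact: cvg_cst.
refine (@cvg_big R _ _ (1 : R) xpredT mul_continuous _ (nbhs A) _
  (fun i (B : 'M[R]_n) => B i (s i)) _ FF _) => i _.
exact: coord_continuous.
Qed.

(** By the mean value theorem, [H i u - H i u0] is the product of [u - u0] with
    partial derivatives of [H i] at points near [u0]; the points vary with the
    entry, but the matrix of these derivatives is still invertible. *)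
Lemma locally_injective n (U : set 'rV[R]_n) (H : 'I_n -> 'rV[R]_n -> R) u0 :
  open U -> U u0 -> (forall i, smooth_on U (H i)) ->
  \det (\matrix_(k, i) 'D_(delta_mx 0 k) (H i) u0) != 0 ->
  \forall u \near u0, (forall i, H i u = H i u0) -> u = u0.
Proof.
move=> oU Uu0 sH d0; set N0 : 'M[R]_n := \matrix_(k, i) _ in d0.
have nd : nbhs (\det N0) [set t : R | t != 0].
  by apply: open_nbhs_nbhs; split; [exact: open_neq|].
have [e /= e0 eP] := (nbhs_ballP _ _).1 (det_continuous nd).
have nU : \forall u \near u0, U u by exact: open_nbhs_nbhs.
have nD : \forall u \near u0, forall k i,
    `|'D_(delta_mx 0 k) (H i) u0 - 'D_(delta_mx 0 k) (H i) u| < e.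
  apply: (filter_forall (nbhs_filter u0)) => k; apply: (filter_forall (nbhs_filter u0)) => i.
  have := smooth_on_continuous (smooth_onD1 k (sH i)) Uu0.
  by move/cvgrPdist_lt => /(_ _ e0).
have [r /= r0 rP] := (nbhs_ballP _ _).1 (filterI nU nD).
have nB : nbhs u0 (ball u0 r) by exact: nbhsx_ballx.
apply: filterS nB => u ub HE.
have inb (z : 'rV[R]_n) : `|z - u0| <= `|u - u0| -> ball u0 r z.
  move=> zu; move: ub; rewrite -!ball_normE /ball_ /= => ub.
  by rewrite distrC; apply: le_lt_trans zu _; rewrite distrC.
have ex i : exists xi : 'I_n -> 'rV[R]_n, (forall k, ball u0 r (xi k)) /\
    \sum_k (u - u0) 0 k * 'D_(delta_mx 0 k) (H i) (xi k) = 0.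
  have [k y yu|xi xi1 xi2] := @coord_MVT R n (H i) u0 (u - u0).
    have [Uy _] := rP _ (inb _ yu); exact: (smooth_on_derivable1 (sH i) Uy).
  exists xi; split; first by move=> k; exact: inb.
  by rewrite -xi2 [u0 + _]addrC subrK HE subrr.
have [xi xiP] := choice ex.
pose N : 'M[R]_n := \matrix_(k, i) 'D_(delta_mx 0 k) (H i) (xi i k).
have dN : \det N != 0.
  apply: (eP N); split=> // k i; rewrite !mxE -ball_normE /ball_ /=.
  by have [xib _] := xiP i; have [_] := rP _ (xib k); exact.
apply/eqP; rewrite -subr_eq0; apply/eqP; apply: (det_neq0_inj dN).
apply/rowP => i; rewrite mxE [RHS]mxE; have [_ E] := xiP i; rewrite -[RHS]E.
by apply: eq_bigr => k _; rewrite [N k i]mxE.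
Qed.

End LocalInjectivity.

(** * Slices of functions on a product *)

Section Slices.
Context {R : realType} {n d : nat}.

Lemma row_mx_shiftl (u v : 'rV[R]_n) (y : 'rV[R]_d) h :
  row_mx (h *: v + u) y = h *: row_mx v 0 + row_mx u y.
Proof. by rewrite scale_row_mx add_row_mx scaler0 add0r. Qed.

Lemma row_mx_shiftr (u : 'rV[R]_n) (v y : 'rV[R]_d) h :
  row_mx u (h *: v + y) = h *: row_mx 0 v + row_mx u y.
Proof. by rewrite scale_row_mx add_row_mx scaler0 add0r. Qed.

Lemma row_mx_delta_l (k : 'I_n) :
  row_mx (delta_mx 0 k) 0 = delta_mx 0 (lshift d k) :> 'rV[R]_(n + d).
Proof.
apply/rowP => i; case: (split_ordP i) => i' ->; rewrite ?row_mxEl ?row_mxEr !mxE eqxx /=.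
  by rewrite eq_lshift.
by rewrite eq_rlshift.
Qed.

Lemma row_mx_delta_r (k : 'I_d) :
  row_mx 0 (delta_mx 0 k) = delta_mx 0 (rshift n k) :> 'rV[R]_(n + d).
Proof.
apply/rowP => i; case: (split_ordP i) => i' ->; rewrite ?row_mxEl ?row_mxEr !mxE eqxx /=.
  by rewrite eq_lrshift.
by rewrite eq_rshift.
Qed.

Transparent derive.
Lemma derive_slicel (F : 'rV[R]_(n + d) -> R) u v y :
  'D_v (fun u => F (row_mx u y)) u = 'D_(row_mx v 0) F (row_mx u y).
Proof.
rewrite /derive.
suff -> : (fun h : R =>
    h^-1 *: (((fun u => F (row_mx u y)) \o shift u) (h *: v) - F (row_mx u y)))
  = (fun h => h^-1 *: ((F \o shift (row_mx u y)) (h *: row_mx v 0) - F (row_mx u y))) by [].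
by apply/funext => h /=; rewrite row_mx_shiftl.
Qed.

Lemma derive_slicer (F : 'rV[R]_(n + d) -> R) u v y :
  'D_v (fun y => F (row_mx u y)) y = 'D_(row_mx 0 v) F (row_mx u y).
Proof.
rewrite /derive.
suff -> : (fun h : R =>
    h^-1 *: (((fun y => F (row_mx u y)) \o shift y) (h *: v) - F (row_mx u y)))
  = (fun h => h^-1 *: ((F \o shift (row_mx u y)) (h *: row_mx 0 v) - F (row_mx u y))) by [].
by apply/funext => h /=; rewrite row_mx_shiftr.
Qed.
Opaque derive.

Lemma ipartial_slicer (F : 'rV[R]_(n + d) -> R) u (s : seq 'I_d) y :
  ipartial s (fun y => F (row_mx u y)) y = ipartial (map (@rshift n d) s) F (row_mx u y).
Proof.
elim: s y => [//|i s IH] y /=.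
rewrite -row_mx_delta_r -derive_slicer; congr ('D__ _ _); exact/funext.
Qed.

Lemma smooth_on_slicel (Om : set 'rV[R]_(n + d)) (U : set 'rV[R]_n)
    (F : 'rV[R]_(n + d) -> R) y :
  open Om -> open U -> (forall u, U u -> Om (row_mx u y)) -> smooth_on Om F ->
  smooth_on U (fun u => F (row_mx u y)).
Proof.
move=> oO oU UO sF; apply: (smooth_on_comp oU oO UO _ sF) => k.
case: (split_ordP k) => i ->.
  by apply: (smooth_on_eq oU _ (smooth_on_coord oU i)) => u _; rewrite row_mxEl.
by apply: (smooth_on_eq oU _ (smooth_on_cst oU (y 0 i))) => u _; rewrite row_mxEr.
Qed.

Lemma smooth_on_slicer (Om : set 'rV[R]_(n + d)) (V : set 'rV[R]_d)
    (F : 'rV[R]_(n + d) -> R) u :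
  open Om -> open V -> (forall y, V y -> Om (row_mx u y)) -> smooth_on Om F ->
  smooth_on V (fun y => F (row_mx u y)).
Proof.
move=> oO oV VO sF; apply: (smooth_on_comp oV oO VO _ sF) => k.
case: (split_ordP k) => i ->.
  by apply: (smooth_on_eq oV _ (smooth_on_cst oV (u 0 i))) => y _; rewrite row_mxEl.
by apply: (smooth_on_eq oV _ (smooth_on_coord oV i)) => y _; rewrite row_mxEr.
Qed.

Lemma ball_row_mx (u0 u : 'rV[R]_n) (y0 y : 'rV[R]_d) r :
  ball u0 r u -> ball y0 r y -> ball (row_mx u0 y0) r (row_mx u y).
Proof.
move=> [r0 bu] [_ by_]; split=> // i k; case: (split_ordP k) => k' ->.
  by rewrite !row_mxEl.
by rewrite !row_mxEr.
Qed.

End Slices.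

(** * Smooth partial maps between Euclidean spaces *)

Section VectorSmooth.
Context {R : realType}.

Definition vsmooth_on m n (U : set 'rV[R]_m) (f : 'rV[R]_m -> 'rV[R]_n) :=
  forall l, smooth_on U (fun x => f x 0 l).

Lemma iter_partial_coord_of_smooth m n (U : set 'rV[R]_m) (f : 'rV[R]_m -> 'rV[R]_n) s x :
  open U -> vsmooth_on U f -> U x ->
  (forall l, iter_partial s f x 0 l = ipartial s (fun y => f y 0 l) x) /\
  {for x, continuous (iter_partial s f)} /\
  (forall i, derivable (iter_partial s f) x (delta_mx 0 i)).
Proof.
move=> oU sf; elim: s x => [|i s IH] x Ux.
  split => //; split; first by apply: rV_continuous => l; exact: smooth_on_continuous (sf l) Ux.
  move=> i; apply/derivable_mxP => k l; rewrite ord1.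
  exact: smooth_on_derivable1 (sf l) Ux.
have near_x (P : 'rV[R]_m -> Prop) : (forall y, U y -> P y) -> \forall y \near x, P y.
  by move=> UP; apply: filterS (open_nbhs_nbhs (conj oU Ux)).
have E y : U y -> forall l,
    iter_partial (i :: s) f y 0 l = ipartial (i :: s) (fun z => f z 0 l) y.
  move=> Uy l; have [_ [_ /(_ i) ds]] := IH y Uy.
  rewrite /= (derive_mx ds) mxE; apply: near_eq_derive.
  by apply: filterS (open_nbhs_nbhs (conj oU Uy)) => z /IH[].
split; first exact: E.
split.
  apply: rV_continuous => l.
  apply: (@near_eq_continuous _ _ (ipartial (i :: s) (fun z => f z 0 l))).
    by apply: near_x => y Uy; rewrite E.
  exact: (sf l (i :: s) x Ux).1.
move=> j; apply/derivable_mxP => k l; rewrite ord1.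
apply: (near_eq_derivable _ ((sf l (i :: s) x Ux).2 j)).
by apply: near_x => y Uy; rewrite E.
Qed.

Lemma vsmooth_on_iter_partial m n (U : set 'rV[R]_m) (f : 'rV[R]_m -> 'rV[R]_n) :
  open U ->
  (forall s x, U x -> {for x, continuous (iter_partial s f)} /\
     forall i, derivable (iter_partial s f) x (delta_mx 0 i)) ->
  vsmooth_on U f.
Proof.
move=> oU sf l.
have E s y : U y -> iter_partial s f y 0 l = ipartial s (fun z => f z 0 l) y.
  elim: s y => [|i s IH] // y Uy; have [_ /(_ i) ds] := sf s y Uy.
  rewrite /= (derive_mx ds) mxE; apply: near_eq_derive.
  by apply: filterS (open_nbhs_nbhs (conj oU Uy)) => z /IH.
move=> s x Ux; have [cs ds] := sf s x Ux.
have nE : \forall y \near x, iter_partial s f y 0 l = ipartial s (fun z => f z 0 l) y.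
  by apply: filterS (open_nbhs_nbhs (conj oU Ux)) => y; exact: E.
split; first apply: near_eq_continuous nE _.
  by apply: (@continuous_comp _ _ _ (iter_partial s f) (fun M : 'rV_n => M 0 l)) => //;
    exact: coord_continuous.
move=> i; apply: near_eq_derivable nE _.
exact: (derivable_mxP _ _ _).1 (ds i) 0 l.
Qed.

(** The local form of [partials_continuous], which is stable under composition of
    partial maps and under changes away from the point. *)
Definition smooth_at m n (F : 'rV[R]_m -> option 'rV[R]_n) x :=
  exists2 U : set 'rV[R]_m, [/\ open U, U x & U `<=` pdom F] &
    vsmooth_on U (total_ext F).

Lemma smooth_at_partials m n (F : 'rV[R]_m -> option 'rV[R]_n) :
  (forall x, pdom F x -> smooth_at F x) -> partials_continuous F.
Proof.
move=> sF s x /sF[U [oU Ux _] sU].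
by have [_] := iter_partial_coord_of_smooth s oU sU Ux.
Qed.

Lemma partials_smooth_on m n (F : 'rV[R]_m -> option 'rV[R]_n) :
  open (pdom F) -> partials_continuous F -> vsmooth_on (pdom F) (total_ext F).
Proof. by move=> oF sF; apply: vsmooth_on_iter_partial. Qed.

Lemma partials_smooth_at m n (F : 'rV[R]_m -> option 'rV[R]_n) x :
  open (pdom F) -> partials_continuous F -> pdom F x -> smooth_at F x.
Proof. by move=> oF sF Fx; exists (pdom F); [split|exact: partials_smooth_on]. Qed.

Lemma vsmooth_onS m n (U V : set 'rV[R]_m) (f : 'rV[R]_m -> 'rV[R]_n) :
  U `<=` V -> vsmooth_on V f -> vsmooth_on U f.
Proof. by move=> UV sf l; exact: smooth_onS (sf l). Qed.

Lemma vsmooth_on_eq m n (U : set 'rV[R]_m) (f g : 'rV[R]_m -> 'rV[R]_n) :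
  open U -> (forall x, U x -> f x = g x) -> vsmooth_on U f -> vsmooth_on U g.
Proof. by move=> oU fg sf l; apply: smooth_on_eq (sf l) => // x Ux; rewrite fg. Qed.

Lemma vsmooth_on_continuous m n (U : set 'rV[R]_m) (f : 'rV[R]_m -> 'rV[R]_n) x :
  vsmooth_on U f -> U x -> {for x, continuous f}.
Proof.
by move=> sf Ux; apply: rV_continuous => l; exact: smooth_on_continuous (sf l) Ux.
Qed.

Lemma smooth_at_eq m n (F G : 'rV[R]_m -> option 'rV[R]_n) x :
  (\forall y \near x, F y = G y) -> smooth_at F x -> smooth_at G x.
Proof.
move=> FG [U [oU Ux UF] sF]; move: FG; rewrite /prop_near1 nbhsE => -[V [oV Vx] FG].
exists (U `&` V).
  split=> //; first exact: openI.
  by move=> y [/UF Fy Vy]; rewrite /pdom /= -FG.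
apply: (@vsmooth_on_eq _ _ _ (total_ext F)); first exact: openI.
  by move=> y [_ Vy]; rewrite /total_ext /= FG.
by apply: vsmooth_onS sF => y [].
Qed.

Lemma smooth_at_comp m n p (F : 'rV[R]_m -> option 'rV[R]_n)
    (G : 'rV[R]_n -> option 'rV[R]_p) x y :
  F x = Some y -> smooth_at F x -> smooth_at G y -> smooth_at (pcomp G F) x.
Proof.
move=> Fx [U [oU Ux UF] sF] [V [oV Vy VG] sG].
have nW : nbhs x (total_ext F @^-1` V).
  apply: (vsmooth_on_continuous sF Ux).
  by rewrite /total_ext /= Fx; exact: open_nbhs_nbhs.
move: nW; rewrite nbhsE => -[W [oW Wx] WV].
have FE z : U z -> F z = Some (total_ext F z).
  by move=> /UF; rewrite /pdom /total_ext /=; case: (F z).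
have oUW : open (U `&` W) by exact: openI.
exists (U `&` W).
  split=> // z [Uz Wz]; rewrite /pdom /pcomp /= FE //=; apply: VG; exact: WV.
apply: (@vsmooth_on_eq _ _ _ (total_ext G \o total_ext F)) => //.
  by move=> z [Uz Wz]; rewrite /total_ext /pcomp /= FE.
move=> l; apply: (smooth_on_comp oUW oV _ _ (sG l)).
  by move=> z [_ Wz]; exact: WV.
by move=> k; apply: smooth_onS (sF k) => z [].
Qed.

End VectorSmooth.

(** * Composition, inversion and continuity of partial maps *)

Section PartialMaps.
Context {X Y Z : choiceType}.

Lemma pinvE (f : X -> option Y) x y : pinjective f -> (pinv f y = Some x <-> f x = Some y).
Proof.
move=> fi; rewrite /pinv; split=> [|fx].
  by case: xgetP => [_ -> [x' fx' <-] [<-]|].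
case: xgetP => [_ -> [x' fx' <-]|/(_ (Some x))]; first by rewrite (fi _ _ _ fx fx').
by case; exists x.
Qed.

Lemma pinv_inj (f : X -> option Y) : pinjective f -> pinjective (pinv f).
Proof. by move=> fi y y' x /(pinvE _ _ fi) fy /(pinvE _ _ fi); rewrite fy => -[]. Qed.

Lemma option_ext (a b : option X) : (forall x, a = Some x <-> b = Some x) -> a = b.
Proof.
move=> ab; case: a ab => [a|] ab; first by apply/esym/ab.
by case: b ab => // b /(_ b)[_ /(_ erefl)].
Qed.

End PartialMaps.

Lemma pcompE (X Y Z : Type) (f : Y -> option Z) (g : X -> option Y) x z :
  pcomp f g x = Some z <-> exists2 y, g x = Some y & f y = Some z.
Proof.
rewrite /pcomp; split; first by case: (g x) => //= y; exists y.
by case=> y -> /=.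
Qed.

Lemma pcompA (X Y Z T : Type) (f : Z -> option T) (g : Y -> option Z) (h : X -> option Y) :
  pcomp f (pcomp g h) = pcomp (pcomp f g) h.
Proof. by apply/funext => x; rewrite /pcomp; case: (h x). Qed.

Lemma pcomp_Somel (X Y : Type) (f : X -> option Y) : pcomp Some f = f.
Proof. by apply/funext => x; rewrite /pcomp; case: (f x). Qed.

Lemma pcomp_Somer (X Y : Type) (f : X -> option Y) : pcomp f Some = f.
Proof. by []. Qed.

Lemma pinv_pinv (X Y : choiceType) (f : X -> option Y) : pinjective f -> pinv (pinv f) = f.
Proof.
move=> fi; apply/funext => x; apply: option_ext => y.
split=> [/(pinvE _ _ (pinv_inj fi))/(pinvE _ _ fi)|fx] //.
by apply/(pinvE _ _ (pinv_inj fi))/(pinvE _ _ fi).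
Qed.

Lemma pcomp_inj (X Y Z : choiceType) (f : Y -> option Z) (g : X -> option Y) :
  pinjective f -> pinjective g -> pinjective (pcomp f g).
Proof.
move=> fi gi x x' z /pcompE[y gx fy] /pcompE[y' gx' fy'].
by rewrite (fi _ _ _ fy' fy) in gx'; exact: gi gx gx'.
Qed.

Lemma pinv_pcomp (X Y Z : choiceType) (f : Y -> option Z) (g : X -> option Y) :
  pinjective f -> pinjective g -> pinv (pcomp f g) = pcomp (pinv g) (pinv f).
Proof.
move=> fi gi; apply/funext => z; apply: option_ext => x; split.
  move/(pinvE _ _ (pcomp_inj fi gi))/pcompE => [y gx fy].
  apply/pcompE; exists y; first exact/(pinvE _ _ fi).
  exact/(pinvE _ _ gi).
case/pcompE=> y /(pinvE _ _ fi) fy /(pinvE _ _ gi) gx.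
by apply/(pinvE _ _ (pcomp_inj fi gi))/pcompE; exists y.
Qed.

Lemma pinv_cancel (X : choiceType) (f g : X -> option X) :
  (forall x y, f x = Some y <-> g y = Some x) -> pinjective f /\ pinv f = g.
Proof.
move=> fg; have fi : pinjective f by move=> x x' y /fg gy /fg; rewrite gy => -[].
split=> //; apply/funext => y; apply: option_ext => x.
by split=> [/(pinvE _ _ fi)/fg|/fg/(pinvE _ _ fi)].
Qed.

Lemma pinv_Some (X : choiceType) : @pinjective X X Some /\ pinv (@Some X) = Some.
Proof. by apply: pinv_cancel => x y; split=> -[->]. Qed.

Lemma ppreimageE (X Y : choiceType) (f : X -> option Y) V x :
  ppreimage f V x <-> exists2 y, f x = Some y & V y.
Proof.
by rewrite /ppreimage /=; split=> [[y Vy <-]|[y fx Vy]]; exists y.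
Qed.

Lemma pdomE (X Y : choiceType) (f : X -> option Y) x : pdom f x <-> exists y, f x = Some y.
Proof.
by rewrite /pdom /=; case: (f x) => [y|]; split=> //; [exists y|case].
Qed.

Lemma ppreimageT (X Y : choiceType) (f : X -> option Y) : ppreimage f setT = pdom f.
Proof.
apply/seteqP; split=> x; first by case/ppreimageE=> y fx _; apply/pdomE; exists y.
by move/pdomE=> [y fx]; apply/ppreimageE; exists y.
Qed.

Lemma pcontinuous_pdom (X Y : topologicalType) (f : X -> option Y) :
  pcontinuous f -> open (pdom f).
Proof. by move=> cf; rewrite -ppreimageT; apply: cf; exact: openT. Qed.

Lemma ppreimage_pcomp (X Y Z : choiceType) (f : Y -> option Z) (g : X -> option Y) V :
  ppreimage (pcomp f g) V = ppreimage g (ppreimage f V).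
Proof.
apply/seteqP; split=> x.
  case/ppreimageE=> z /pcompE[y gx fy] Vz; apply/ppreimageE; exists y => //.
  by apply/ppreimageE; exists z.
case/ppreimageE=> y gx /ppreimageE[z fy Vz]; apply/ppreimageE; exists z => //.
by apply/pcompE; exists y.
Qed.

Lemma pcontinuous_pcomp (X Y Z : topologicalType) (f : Y -> option Z) (g : X -> option Y) :
  pcontinuous f -> pcontinuous g -> pcontinuous (pcomp f g).
Proof. by move=> cf cg V oV; rewrite ppreimage_pcomp; apply/cg/cf. Qed.

Lemma pcontinuous_Some (X Y : topologicalType) (f : X -> Y) :
  continuous f -> pcontinuous (fun x => Some (f x)).
Proof.
move=> /continuousP cf V oV; rewrite (_ : ppreimage _ _ = f @^-1` V); first exact: cf.
apply/seteqP; split=> x; first by case/ppreimageE=> _ [<-].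
by move=> Vx; apply/ppreimageE; exists (f x).
Qed.

Lemma pcontinuous_nbhs (X Y : topologicalType) (f : X -> option Y) x y (A : set Y) :
  pcontinuous f -> f x = Some y -> nbhs y A -> nbhs x (ppreimage f A).
Proof.
move=> cf fx; rewrite nbhsE => -[V [oV Vy] VA]; apply: (@filterS _ _ _ (ppreimage f V)).
  by move=> z /ppreimageE[w fz /VA Aw]; apply/ppreimageE; exists w.
by apply: open_nbhs_nbhs; split; [exact: cf|apply/ppreimageE; exists y].
Qed.

(** * Smooth partial maps between charted spaces *)

Section Atlases.
Context {R : realType}.

(** The properties of an atlas are kept as predicates on charted spaces, so that
    they apply to Euclidean spaces and to products of manifolds as well. *)
Definition homeo_atlas d (M : chartedType R d) :=
  (forall phi : M -> option 'rV[R]_d, atlas phi ->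
    [/\ pinjective phi, pcontinuous phi & pcontinuous (pinv phi)]) /\
  (forall x : M, exists2 phi : M -> option 'rV[R]_d, atlas phi & pdom phi x).

Definition compatible_atlas d (M : chartedType R d) :=
  forall phi psi : M -> option 'rV[R]_d, atlas phi -> atlas psi ->
    partials_continuous (pcomp psi (pinv phi)).

Lemma manifold_homeo_atlas d (M : manifoldType R d) : homeo_atlas M.
Proof. by split; [exact: atlas_homeo|exact: atlas_cover]. Qed.

Lemma manifold_compatible d (M : manifoldType R d) : compatible_atlas M.
Proof. exact: atlas_compatible. Qed.

Lemma smooth_at_Some m (x : 'rV[R]_m) : smooth_at Some x.
Proof.
exists setT; first by split=> //; exact: openT.
by move=> l; apply: smooth_on_coord; exact: openT.
Qed.

Lemma rV_atlas m (phi : 'rV[R]_m -> option 'rV[R]_m) : atlas phi -> phi = Some.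
Proof. by []. Qed.

Lemma rV_homeo_atlas m : homeo_atlas ('rV[R]_m : chartedType R m).
Proof.
have cS : @pcontinuous 'rV[R]_m 'rV[R]_m Some.
  by apply: (@pcontinuous_Some _ _ id) => x; exact: cvg_id.
split=> [phi /rV_atlas ->|x]; last by exists Some.
by have [inj ->] := pinv_Some 'rV[R]_m.
Qed.

Lemma rV_compatible m : compatible_atlas ('rV[R]_m : chartedType R m).
Proof.
move=> phi psi /rV_atlas -> /rV_atlas ->; have [_ ->] := pinv_Some 'rV[R]_m.
by apply: smooth_at_partials => x _; exact: smooth_at_Some.
Qed.

Lemma continuous_row_mx (m n : nat) :
  continuous (fun p : 'rV[R]_m * 'rV[R]_n => row_mx p.1 p.2).
Proof.
move=> p; apply: rV_continuous => k.
case: (split_ordP k) => j ->.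
  rewrite (_ : (fun t => _) = (fun t : 'rV[R]_m * 'rV[R]_n => t.1 0 j)).
    apply: (@continuous_comp _ _ _ fst (fun v : 'rV[R]_m => v 0 j)).
      exact: cvg_fst.
    exact: coord_continuous.
  by apply/funext => t; rewrite row_mxEl.
rewrite (_ : (fun t => _) = (fun t : 'rV[R]_m * 'rV[R]_n => t.2 0 j)).
  apply: (@continuous_comp _ _ _ snd (fun v : 'rV[R]_n => v 0 j)).
    exact: cvg_snd.
  exact: coord_continuous.
by apply/funext => t; rewrite row_mxEr.
Qed.

Lemma continuous_lsubmx (m n : nat) : continuous (@lsubmx R 1 m n).
Proof.
move=> v; apply: rV_continuous => k.
rewrite (_ : (fun t => _) = (fun t : 'rV[R]_(m + n) => t 0 (lshift n k))).
  exact: coord_continuous.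
by apply/funext => t; rewrite mxE.
Qed.

Lemma continuous_rsubmx (m n : nat) : continuous (@rsubmx R 1 m n).
Proof.
move=> v; apply: rV_continuous => k.
rewrite (_ : (fun t => _) = (fun t : 'rV[R]_(m + n) => t 0 (rshift m k))).
  exact: coord_continuous.
by apply/funext => t; rewrite mxE.
Qed.

Lemma prod_chartE m n (M N : Type) (phi : M -> option 'rV[R]_m)
    (psi : N -> option 'rV[R]_n) p w :
  prod_chart phi psi p = Some w <->
  phi p.1 = Some (lsubmx w) /\ psi p.2 = Some (rsubmx w).
Proof.
rewrite /prod_chart; split.
  case: (phi _) => // u; case: (psi _) => // v [<-].
  by rewrite row_mxKl row_mxKr.
by case=> -> ->; rewrite hsubmxK.
Qed.

Lemma prod_chart_inj m n (M N : choiceType) (phi : M -> option 'rV[R]_m)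
    (psi : N -> option 'rV[R]_n) : pinjective phi -> pinjective psi ->
  pinjective (prod_chart phi psi).
Proof.
move=> i1 i2 [a b] [a' b'] w' /prod_chartE/= [pa pb] /prod_chartE/= [pa' pb'].
by rewrite (i1 _ _ _ pa pa') (i2 _ _ _ pb pb').
Qed.

Lemma pinv_prod_chart m n (M N : choiceType) (phi : M -> option 'rV[R]_m)
    (psi : N -> option 'rV[R]_n) w p : pinjective phi -> pinjective psi ->
  (pinv (prod_chart phi psi) w = Some p <->
   pinv phi (lsubmx w) = Some p.1 /\ pinv psi (rsubmx w) = Some p.2).
Proof.
move=> i1 i2; have inj := prod_chart_inj i1 i2; split.
  by move=> /(pinvE _ _ inj)/prod_chartE[/(pinvE _ _ i1) ? /(pinvE _ _ i2)].
case=> /(pinvE _ _ i1) h1 /(pinvE _ _ i2) h2.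
by apply/(pinvE _ _ inj)/prod_chartE.
Qed.

Lemma prod_homeo_atlas m n (M : chartedType R m) (N : chartedType R n) :
  homeo_atlas M -> homeo_atlas N -> homeo_atlas (M * N)%type.
Proof.
move=> [hM cM] [hN cN]; split=> [_ [phi [psi [/hM[i1 c1 d1] /hN[i2 c2 d2] ->]]]|[a b]].
  have inj := prod_chart_inj i1 i2.
  split=> //.
  - move=> V oV; rewrite openE => -[a b] /ppreimageE[w /prod_chartE[/= pa pb] Vw].
    have nV : nbhs (lsubmx w, rsubmx w)
        ((fun p : 'rV[R]_m * 'rV[R]_n => row_mx p.1 p.2) @^-1` V).
      by apply: continuous_row_mx; rewrite hsubmxK; exact: open_nbhs_nbhs.
    have [[A B] /= [nA nB] AB] := nV.
    exists (ppreimage phi A, ppreimage psi B).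
      by split; [exact: pcontinuous_nbhs nA|exact: pcontinuous_nbhs nB].
    move=> [a' b'] [/= /ppreimageE[u pu Au] /ppreimageE[v pv Bv]].
    apply/ppreimageE; exists (row_mx u v); last exact: (AB (u, v)).
    by apply/prod_chartE; rewrite row_mxKl row_mxKr.
  - move=> V oV; rewrite openE => w /ppreimageE[[a b]].
    case/(pinv_prod_chart _ _ i1 i2) => /= pa pb Vab.
    have [[A B] /= [nA nB] AB] : nbhs (a, b) V by exact: open_nbhs_nbhs.
    have n1 : nbhs w (lsubmx @^-1` ppreimage (pinv phi) A).
      by apply: continuous_lsubmx; exact: pcontinuous_nbhs nA.
    have n2 : nbhs w (rsubmx @^-1` ppreimage (pinv psi) B).
      by apply: continuous_rsubmx; exact: pcontinuous_nbhs nB.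
    apply: filterS (filterI n1 n2) => w' [/ppreimageE[a' pa' Aa] /ppreimageE[b' pb' Bb]].
    apply/ppreimageE; exists (a', b'); last exact: AB.
    exact/(pinv_prod_chart _ _ i1 i2).
have [phi ? /pdomE[u pu]] := cM a; have [psi ? /pdomE[v pv]] := cN b.
exists (prod_chart phi psi); first by exists phi, psi.
apply/pdomE; exists (row_mx u v); apply/prod_chartE.
by rewrite row_mxKl row_mxKr.
Qed.

Lemma psmooth_smooth_at m n (M : chartedType R m) (N : chartedType R n)
    (f : M -> option N) (phi : M -> option 'rV[R]_m) (psi : N -> option 'rV[R]_n) x :
  homeo_atlas M -> homeo_atlas N -> psmooth f -> atlas phi -> atlas psi ->
  pdom (pcomp psi (pcomp f (pinv phi))) x ->
  smooth_at (pcomp psi (pcomp f (pinv phi))) x.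
Proof.
move=> [hM _] [hN _] [cf sf] aphi apsi; apply: partials_smooth_at; last exact: sf.
have [_ _ c1] := hM _ aphi; have [_ c2 _] := hN _ apsi.
by apply: pcontinuous_pdom; apply: pcontinuous_pcomp => //; exact: pcontinuous_pcomp.
Qed.

Lemma psmooth_intro m n (M : chartedType R m) (N : chartedType R n) (f : M -> option N) :
  pcontinuous f ->
  (forall (phi : M -> option 'rV[R]_m) (psi : N -> option 'rV[R]_n) x,
     atlas phi -> atlas psi -> pdom (pcomp psi (pcomp f (pinv phi))) x ->
     smooth_at (pcomp psi (pcomp f (pinv phi))) x) -> psmooth f.
Proof.
by move=> cf sf; split=> // phi psi aphi apsi; apply: smooth_at_partials => x; exact: sf.
Qed.

(** A chart around the intermediate point splits the composite, read in charts,
    into two maps between Euclidean spaces. *)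
Lemma psmooth_pcomp m n p (M : chartedType R m) (N : chartedType R n) (P : chartedType R p)
    (f : N -> option P) (g : M -> option N) :
  homeo_atlas M -> homeo_atlas N -> homeo_atlas P ->
  psmooth f -> psmooth g -> psmooth (pcomp f g).
Proof.
move=> gM gN gP sf sg; apply: psmooth_intro.
  by apply: pcontinuous_pcomp; [case: sf|case: sg].
move=> phi psi w aphi apsi /pdomE[z /pcompE[c /pcompE[a pa /pcompE[b gb fc]] psic]].
have [chi achi /pdomE[v chib]] := gN.2 b.
have [ichi cchi cchi'] := gN.1 _ achi.
have gw : pcomp chi (pcomp g (pinv phi)) w = Some v.
  by apply/pcompE; exists b => //; apply/pcompE; exists a.
have sgw : smooth_at (pcomp chi (pcomp g (pinv phi))) w.
  by apply: psmooth_smooth_at => //; apply/pdomE; exists v.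
have sfv : smooth_at (pcomp psi (pcomp f (pinv chi))) v.
  apply: psmooth_smooth_at => //; apply/pdomE; exists z.
  by apply/pcompE; exists c => //; apply/pcompE; exists b => //; exact/(pinvE _ _ ichi).
apply: smooth_at_eq (smooth_at_comp gw sgw sfv).
have := sgw; case=> U [oU Uw Ud] _.
apply: filterS (open_nbhs_nbhs (conj oU Uw)) => w' /Ud/pdomE[v' gw'].
have := gw' => /pcompE[b' gb' chib'].
have chi'v : pinv chi v' = Some b' by exact/(pinvE _ _ ichi).
rewrite [LHS](_ : _ = pcomp psi (pcomp f (pinv chi)) v'); last by rewrite {1}/pcomp gw'.
rewrite /pcomp chi'v /=; move: gb'; rewrite /pcomp.
by case: (pinv phi w') => //= a' ->.
Qed.

Lemma pdiffeo_pinv m n (M : chartedType R m) (N : chartedType R n) (f : M -> option N) :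
  pdiffeo f -> pdiffeo (pinv f).
Proof. by case=> fi sf sf'; split=> //; [exact: pinv_inj|rewrite pinv_pinv]. Qed.

Lemma pdiffeo_pcomp m n p (M : chartedType R m) (N : chartedType R n) (P : chartedType R p)
    (f : N -> option P) (g : M -> option N) :
  homeo_atlas M -> homeo_atlas N -> homeo_atlas P ->
  pdiffeo f -> pdiffeo g -> pdiffeo (pcomp f g).
Proof.
move=> gM gN gP [fi sf sf'] [gi sg sg']; split; first exact: pcomp_inj.
  exact: psmooth_pcomp.
by rewrite pinv_pcomp //; exact: psmooth_pcomp.
Qed.

Lemma atlas_pdiffeo d (M : chartedType R d) (phi : M -> option 'rV[R]_d) :
  homeo_atlas M -> compatible_atlas M -> atlas phi -> pdiffeo phi.
Proof.
move=> gM cM aphi; have [iphi cphi cphi'] := gM.1 _ aphi.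
have [_ pS] := pinv_Some 'rV[R]_d.
split; first exact: iphi.
  split; first exact: cphi.
  by move=> f g af ag; rewrite (rV_atlas ag) pcomp_Somel; exact: cM.
split; first exact: cphi'.
by move=> f g af ag; rewrite (rV_atlas af) pS pcomp_Somer; exact: cM.
Qed.

Lemma pdiffeo_smooth_at m n (F : 'rV[R]_m -> option 'rV[R]_n) x :
  pdiffeo F -> pdom F x -> smooth_at F x.
Proof.
case=> _ sF _ Fx; have [_ pS] := pinv_Some 'rV[R]_m.
rewrite -[F]pcomp_Somel -[F]pcomp_Somer -[X in pcomp F X]pS.
apply: psmooth_smooth_at => //; [exact: rV_homeo_atlas|exact: rV_homeo_atlas|].
by rewrite pS pcomp_Somer pcomp_Somel.
Qed.

Lemma psmooth_rV m n (F : 'rV[R]_m -> option 'rV[R]_n) : pcontinuous F ->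
  (forall x, pdom F x -> smooth_at F x) -> psmooth F.
Proof.
move=> cF sF; apply: psmooth_intro => // phi psi x /rV_atlas -> /rV_atlas ->.
by have [_ ->] := pinv_Some 'rV[R]_m; rewrite pcomp_Somer pcomp_Somel; exact: sF.
Qed.

Definition translation m (h : 'rV[R]_m) (x : 'rV[R]_m) := Some (x + h).

Lemma translation_pdiffeo m (h : 'rV[R]_m) : pdiffeo (translation h).
Proof.
have smooth k : psmooth (translation (k : 'rV[R]_m)).
  have cK : continuous (fun x : 'rV[R]_m => x + k).
    move=> x.
    by apply: (@continuousD _ _ _ id (cst k) x); [exact: cvg_id|exact: cst_continuous].
  apply: psmooth_rV; first exact: pcontinuous_Some cK.
  move=> x _; exists setT; first by split=> //; exact: openT.
  move=> l; have oT := @openT ('rV[R]_m : topologicalType).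
  apply: (@smooth_on_eq _ _ _ oT ((fun y : 'rV[R]_m => y 0 l) + cst (k 0 l))).
    by move=> y _; rewrite /total_ext /= mxE.
  exact: smooth_onD (smooth_on_coord oT l) (smooth_on_cst oT _).
have [inj inv] : pinjective (translation h) /\ pinv (translation h) = translation (- h).
  apply: pinv_cancel => x y; rewrite /translation; split=> -[<-].
    by rewrite addrK.
  by rewrite subrK.
by split=> //; rewrite inv.
Qed.

Definition pid_on (X : Type) (W : set X) (x : X) : option X :=
  if `[< W x >] then Some x else None.

Lemma pid_onE (X : Type) (W : set X) x y : pid_on W x = Some y <-> x = y /\ W x.
Proof.
rewrite /pid_on; case: asboolP => Wx; split=> //; first by case=> <-.
  by case=> ->.
by case.
Qed.

Lemma pid_on_pdiffeo d (M : chartedType R d) (W : set M) :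
  homeo_atlas M -> compatible_atlas M -> open W -> pdiffeo (pid_on W).
Proof.
move=> gM cM oW; have [inj inv] : pinjective (pid_on W) /\ pinv (pid_on W) = pid_on W.
  by apply: pinv_cancel => x y; split=> /pid_onE[-> Wy]; apply/pid_onE.
suff sm : psmooth (pid_on W) by split=> //; rewrite inv.
have cW : pcontinuous (pid_on W).
  move=> V oV; rewrite (_ : ppreimage _ _ = W `&` V); first exact: openI.
  apply/seteqP; split=> x; first by case/ppreimageE=> y /pid_onE[<-].
  by case=> Wx Vx; apply/ppreimageE; exists x => //; apply/pid_onE.
apply: psmooth_intro => // phi psi w aphi apsi.
case/pdomE=> z /pcompE[a /pcompE[b pb /pid_onE[eab Wb]] psia]; subst a.
have [iphi cphi cphi'] := gM.1 _ aphi; have [_ cpsi _] := gM.1 _ apsi.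
have sw : smooth_at (pcomp psi (pinv phi)) w.
  apply: partials_smooth_at; last by apply/pdomE; exists z; apply/pcompE; exists b.
    by apply: pcontinuous_pdom; exact: pcontinuous_pcomp.
  exact: cM.
apply: smooth_at_eq sw; near=> w'.
have : ppreimage (pinv phi) W w'.
  near: w'; apply: pcontinuous_nbhs pb _ => //; exact: open_nbhs_nbhs.
case/ppreimageE=> b' pb' Wb'; rewrite /pcomp pb' /=.
by rewrite (_ : pid_on W b' = Some b') //; apply/pid_onE.
Unshelve. all: by end_near. Qed.

End Atlases.

(** * Jets of partial maps *)

Section PartialJets.
Context {R : realType}.

Definition peq_jet m n (j : nat) x (F G : 'rV[R]_m -> option 'rV[R]_n) :=
  forall k, eq_jet j x (fun y => total_ext F y 0 k) (fun y => total_ext G y 0 k).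

Lemma peq_jet_near m n j x (F G : 'rV[R]_m -> option 'rV[R]_n) :
  (\forall y \near x, F y = G y) -> peq_jet j x F G.
Proof.
rewrite /prop_near1 nbhsE => -[U [oU Ux] FG] k.
by apply: (eq_on_eq_jet oU Ux) => y /FG; rewrite /total_ext /= => ->.
Qed.

Lemma peq_jet_sym m n j x (F G : 'rV[R]_m -> option 'rV[R]_n) :
  peq_jet j x F G -> peq_jet j x G F.
Proof. by move=> FG k; exact: eq_jet_sym. Qed.

Lemma peq_jet_trans m n j x (F G H : 'rV[R]_m -> option 'rV[R]_n) :
  peq_jet j x F G -> peq_jet j x G H -> peq_jet j x F H.
Proof. by move=> FG GH k; exact: eq_jet_trans (FG k) (GH k). Qed.

Lemma peq_jet_iter_partial m n j x (F G : 'rV[R]_m -> option 'rV[R]_n) :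
  smooth_at F x -> smooth_at G x ->
  (peq_jet j x F G <-> forall s : seq 'I_m, (size s <= j)%N ->
     iter_partial s (total_ext F) x = iter_partial s (total_ext G) x).
Proof.
move=> [U [oU Ux _] sF] [V [oV Vx _] sG].
have EF s := (iter_partial_coord_of_smooth s oU sF Ux).1.
have EG s := (iter_partial_coord_of_smooth s oV sG Vx).1.
split=> [FG s sj|FG k s sj]; last by rewrite -EF -EG FG.
by apply/rowP => k; rewrite EF EG; exact: FG.
Qed.

Lemma smooth_at_total m n (F : 'rV[R]_m -> option 'rV[R]_n) x y : F x = Some y ->
  smooth_at F x -> forall V : set 'rV[R]_n, open V -> V y ->
  exists2 U : set 'rV[R]_m, [/\ open U, U x & vsmooth_on U (total_ext F)] &
    forall z, U z -> F z = Some (total_ext F z) /\ V (total_ext F z).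
Proof.
move=> Fx [U [oU Ux UF] sF] V oV Vy.
have nW : nbhs x (total_ext F @^-1` V).
  apply: (vsmooth_on_continuous sF Ux).
  by rewrite /total_ext /= Fx; exact: open_nbhs_nbhs.
move: nW; rewrite nbhsE => -[W [oW Wx] WV].
exists (U `&` W).
  by split; [exact: openI|split|apply: vsmooth_onS sF => z []].
move=> z [/UF Uz /WV Vz]; split=> //.
by move: Uz; rewrite /pdom /total_ext /=; case: (F z).
Qed.

Lemma peq_jet_comp m n p j x y (F F' : 'rV[R]_m -> option 'rV[R]_n)
    (G G' : 'rV[R]_n -> option 'rV[R]_p) :
  F x = Some y -> F' x = Some y -> smooth_at F x -> smooth_at F' x ->
  smooth_at G y -> smooth_at G' y ->
  peq_jet j x F F' -> peq_jet j y G G' -> peq_jet j x (pcomp G F) (pcomp G' F').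
Proof.
move=> Fx F'x sF sF' [V [oV Vy _] sG] [V' [oV' Vy' _] sG'] FF' GG' k.
have oVV : open (V `&` V') by exact: openI.
have [U [oU Ux sU] UF] := smooth_at_total Fx sF oVV (conj Vy Vy').
have [U' [oU' Ux' sU'] UF'] := smooth_at_total F'x sF' oVV (conj Vy Vy').
have oUU : open (U `&` U') by exact: openI.
have E : eq_jet j x ((fun z => total_ext G z 0 k) \o total_ext F)
    ((fun z => total_ext G' z 0 k) \o total_ext F').
  apply: (eq_jet_comp oUU (conj Ux Ux') oVV).
  - by move=> z [/UF[]].
  - by move=> z [_ /UF'[]].
  - by move=> l; apply: smooth_onS (sU l) => z [].
  - by move=> l; apply: smooth_onS (sU' l) => z [].
  - by apply: smooth_onS (sG k) => z [].
  - by apply: smooth_onS (sG' k) => z [].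
  - exact: FF'.
  - by rewrite {1}/total_ext /= Fx; exact: GG'.
apply: eq_jet_trans (eq_jet_trans E _).
  by apply: (eq_on_eq_jet oUU (conj Ux Ux')) => z [/UF[Fz _] _];
    rewrite {1}/total_ext /= /pcomp {1}Fz.
by apply: (eq_on_eq_jet oUU (conj Ux Ux')) => z [_ /UF'[Fz _]];
    rewrite [in RHS]/total_ext /= /pcomp [in RHS]Fz.
Qed.

End PartialJets.

(** * Frames and frame maps *)

Section Frames.
Context {R : realType} {d : nat}.
Variable j : nat.

Lemma frame_germ_smooth_at (M : chartedType R d) (l : 'rV[R]_d -> option M)
    (phi : M -> option 'rV[R]_d) : homeo_atlas M -> frame_germ l -> pdiffeo phi ->
  pdom (pcomp phi l) 0 -> smooth_at (pcomp phi l) 0.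
Proof.
move=> gM [dl _] dphi; apply: pdiffeo_smooth_at.
by apply: pdiffeo_pcomp => //; exact: rV_homeo_atlas.
Qed.

Lemma frame_germ_pcomp (M N : chartedType R d) (l : 'rV[R]_d -> option M) (f : M -> option N) :
  homeo_atlas M -> homeo_atlas N -> frame_germ l -> pdiffeo f -> pdom (pcomp f l) 0 ->
  frame_germ (pcomp f l).
Proof.
move=> gM gN [dl _] df f0; split; last exact: f0.
exact: pdiffeo_pcomp (@rV_homeo_atlas R d) gM gN df dl.
Qed.

Lemma pdom_pcomp0 (M : chartedType R d) (N : Type)
    (l l' : 'rV[R]_d -> option M) (f : M -> option N) :
  l 0 = l' 0 -> isSome (pcomp f l 0) = isSome (pcomp f l' 0).
Proof. by rewrite /pcomp => ->. Qed.

(** The change of charts from [phi] to [psi] is smooth, and the jet of a composite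
    depends only on the jets of the factors. *)
Lemma agree_any_chart (M : chartedType R d) (l l' : 'rV[R]_d -> option M)
    (psi : M -> option 'rV[R]_d) :
  homeo_atlas M -> frame_germ l -> frame_germ l' -> agree_to_order j l l' ->
  pdiffeo psi -> pdom (pcomp psi l) 0 -> peq_jet j 0 (pcomp psi l) (pcomp psi l').
Proof.
move=> gM gl gl' [l0 [phi [dphi phil0 E]]] dpsi psil0.
have phil0' : pdom (pcomp phi l') 0 by rewrite /pdom /= -(pdom_pcomp0 _ l0).
have psil0' : pdom (pcomp psi l') 0 by rewrite /pdom /= -(pdom_pcomp0 _ l0).
have s1 := frame_germ_smooth_at gM gl dphi phil0.
have s1' := frame_germ_smooth_at gM gl' dphi phil0'.
have J := (peq_jet_iter_partial j s1 s1').2 E.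
have [iphi _ _] := dphi.
pose T := pcomp psi (pinv phi).
have TE (k : 'rV[R]_d -> option M) : smooth_at (pcomp phi k) 0 ->
    \forall y \near (0 : 'rV[R]_d), pcomp T (pcomp phi k) y = pcomp psi k y.
  case=> U [oU U0 Uk] _; apply: filterS (open_nbhs_nbhs (conj oU U0)) => y /Uk.
  case/pdomE=> z /pcompE[a ka phia]; rewrite /T /pcomp ka /= phia /=.
  by rewrite (_ : pinv phi z = Some a) //; exact/(pinvE _ _ iphi).
have [y /[dup] ly /pcompE[a la phia]] := (pdomE _ _).1 phil0.
have l'y : pcomp phi l' 0 = Some y by apply/pcompE; exists a; rewrite -?l0.
have sT : smooth_at T y.
  apply: pdiffeo_smooth_at.
    by apply: pdiffeo_pcomp; [exact: rV_homeo_atlas| |exact: rV_homeo_atlas| |exact: pdiffeo_pinv].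
  have [z /pcompE[a' la' psia]] := (pdomE _ _).1 psil0.
  apply/pdomE; exists z; apply/pcompE; exists a; first exact/(pinvE _ _ iphi).
  by move: la'; rewrite la => -[->].
have C := peq_jet_comp ly l'y s1 s1' sT sT J (fun k s _ => erefl).
have E1 : peq_jet j 0 (pcomp psi l) (pcomp T (pcomp phi l)).
  exact: peq_jet_sym (peq_jet_near (TE _ s1)).
exact: peq_jet_trans E1 (peq_jet_trans C (peq_jet_near (TE _ s1'))).
Qed.

Lemma peq_jet_agree (M : chartedType R d) (l l' : 'rV[R]_d -> option M)
    (psi : M -> option 'rV[R]_d) :
  homeo_atlas M -> frame_germ l -> frame_germ l' -> pdiffeo psi -> l 0 = l' 0 ->
  pdom (pcomp psi l) 0 -> peq_jet j 0 (pcomp psi l) (pcomp psi l') ->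
  agree_to_order j l l'.
Proof.
move=> gM gl gl' dpsi l0 psil J; split=> //; exists psi; split=> //.
have psil' : pdom (pcomp psi l') 0 by rewrite /pdom /= -(pdom_pcomp0 _ l0).
apply: (peq_jet_iter_partial j _ _).1 J; exact: frame_germ_smooth_at.
Qed.

Lemma chart_at_germ (M : chartedType R d) (l : 'rV[R]_d -> option M) :
  homeo_atlas M -> compatible_atlas M -> frame_germ l ->
  exists2 phi : M -> option 'rV[R]_d, pdiffeo phi & pdom (pcomp phi l) 0.
Proof.
move=> gM cM [_ /pdomE[x lx]]; have [phi aphi /pdomE[y phix]] := gM.2 x.
exists phi; first exact: atlas_pdiffeo.
by apply/pdomE; exists y; apply/pcompE; exists x.
Qed.

Section Equivalence.
Variable M : chartedType R d.
Hypotheses (gM : homeo_atlas M) (cM : compatible_atlas M).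
Implicit Types l : 'rV[R]_d -> option M.

Lemma agree_refl l : frame_germ l -> agree_to_order j l l.
Proof.
move=> gl; have [phi dphi phil] := chart_at_germ gM cM gl.
by split=> //; exists phi.
Qed.

Lemma agree_sym l l' : frame_germ l -> frame_germ l' ->
  agree_to_order j l l' -> agree_to_order j l' l.
Proof.
move=> gl gl' [l0 [phi [dphi phil E]]]; split; first by rewrite l0.
exists phi; split=> //; first by rewrite /pdom /= -(pdom_pcomp0 _ l0).
by move=> s sj; rewrite E.
Qed.

Lemma agree_trans l l' l'' : frame_germ l -> frame_germ l' -> frame_germ l'' ->
  agree_to_order j l l' -> agree_to_order j l' l'' -> agree_to_order j l l''.
Proof.
move=> gl gl' gl'' a1 a2; have [phi dphi phil] := chart_at_germ gM cM gl.
have [[l0 _] [l0' _]] := (a1, a2).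
have phil' : pdom (pcomp phi l') 0 by rewrite /pdom /= -(pdom_pcomp0 _ l0).
apply: (peq_jet_agree gM gl gl'' dphi) => //; first by rewrite l0.
apply: peq_jet_trans (agree_any_chart gM gl gl' a1 dphi phil) _.
exact: agree_any_chart gM gl' gl'' a2 dphi phil'.
Qed.

Lemma jet_agree l l' : frame_germ l -> frame_germ l' ->
  (jet j l = jet j l' <-> agree_to_order j l l').
Proof.
move=> gl gl'; split=> [E|a].
  suff : jet j l l' by case.
  by rewrite E; split=> //; exact: agree_refl.
apply/seteqP; split=> k [gk lk]; split=> //.
  by apply: (agree_trans gl' gl gk) => //; exact: agree_sym.
exact: agree_trans lk.
Qed.

Definition mk_frame l (gl : frame_germ l) : frame_bundle j M :=
  Frame (ex_intro2 _ _ l gl erefl).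

Lemma frame_class_inj (q q' : frame_bundle j M) : frame_class q = frame_class q' -> q = q'.
Proof.
case: q q' => [c P] [c' P'] /= E; subst c'; congr Frame; exact: Prop_irrelevance.
Qed.

Lemma mk_frame_eq l l' (gl : frame_germ l) (gl' : frame_germ l') :
  mk_frame gl = mk_frame gl' <-> agree_to_order j l l'.
Proof.
split=> [/(congr1 (@frame_class _ _ _ _)) /= /jet_agree|a]; first by apply.
by apply: frame_class_inj => /=; exact/jet_agree.
Qed.

Lemma frame_rep_germ (q : frame_bundle j M) : frame_germ (frame_rep q).
Proof. by rewrite /frame_rep; case: cid2. Qed.

Lemma mk_frame_rep (q : frame_bundle j M) : mk_frame (frame_rep_germ q) = q.
Proof. by apply: frame_class_inj => /=; rewrite /frame_rep; case: cid2. Qed.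

Lemma frame_rep_agree l (gl : frame_germ l) : agree_to_order j (frame_rep (mk_frame gl)) l.
Proof. by apply/(mk_frame_eq (frame_rep_germ _) gl); rewrite mk_frame_rep. Qed.

Lemma frame_rep0 l (gl : frame_germ l) : frame_rep (mk_frame gl) 0 = l 0.
Proof. by have [] := frame_rep_agree gl. Qed.

Lemma jet_frameE l (gl : frame_germ l) : jet_frame j l = Some (mk_frame gl).
Proof.
rewrite /jet_frame; case: pselect => // gl'.
by congr Some; apply: frame_class_inj.
Qed.

End Equivalence.

(** A chart composed with the diffeomorphism [f] is a chart of the source, so this
    is agreement in another chart. *)
Lemma agree_pcomp (M N : chartedType R d) (l l' : 'rV[R]_d -> option M) (f : M -> option N) :
  homeo_atlas M -> homeo_atlas N -> compatible_atlas N -> pdiffeo f ->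
  frame_germ l -> frame_germ l' -> pdom (pcomp f l) 0 ->
  agree_to_order j l l' -> agree_to_order j (pcomp f l) (pcomp f l').
Proof.
move=> gM gN cN df gl gl' fl0 a; have [l0 _] := a.
have fl0' : pdom (pcomp f l') 0 by rewrite /pdom /= -(pdom_pcomp0 _ l0).
have gfl := frame_germ_pcomp gM gN gl df fl0.
have gfl' := frame_germ_pcomp gM gN gl' df fl0'.
have [phi dphi phil] := chart_at_germ gN cN gfl.
apply: (peq_jet_agree gN gfl gfl' dphi) => //; first by rewrite /pcomp l0.
have dphif := pdiffeo_pcomp gM gN (@rV_homeo_atlas R d) dphi df.
rewrite pcompA in phil; rewrite !pcompA; exact: agree_any_chart gM gl gl' a dphif phil.
Qed.

Lemma frame_map_mk (M N : chartedType R d) (l : 'rV[R]_d -> option M) (f : M -> option N)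
    (gl : frame_germ l) (gfl : frame_germ (pcomp f l)) :
  homeo_atlas M -> compatible_atlas M -> homeo_atlas N -> compatible_atlas N -> pdiffeo f ->
  frame_map f (mk_frame gl) = Some (mk_frame gfl).
Proof.
move=> gM cM gN cN df; rewrite /frame_map.
have r0 := frame_rep0 gM cM gl; have gr := frame_rep_germ (mk_frame gl).
have fr0 : pdom (pcomp f (frame_rep (mk_frame gl))) 0.
  by rewrite /pdom /= (pdom_pcomp0 _ r0); case: gfl.
have gfr := frame_germ_pcomp gM gN gr df fr0.
rewrite (jet_frameE gfr); congr Some; apply/mk_frame_eq => //.
by apply: agree_pcomp => //; exact: frame_rep_agree.
Qed.

Lemma frame_map_defined (M N : chartedType R d) (f : M -> option N) (q : frame_bundle j M) q' :
  frame_map f q = Some q' -> frame_germ (pcomp f (frame_rep q)).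
Proof. by rewrite /frame_map /jet_frame; case: pselect. Qed.

Lemma frame_chart_mk (M : chartedType R d) m (kappa : ('rV[R]_d -> 'rV[R]_d) -> 'rV[R]_m)
    (f : M -> option 'rV[R]_d) (l : 'rV[R]_d -> option M) (gl : frame_germ l) :
  homeo_atlas M -> compatible_atlas M -> pdiffeo f -> pdom (pcomp f l) 0 ->
  frame_chart kappa f (mk_frame gl) = Some (kappa (taylor j (total_ext (pcomp f l)))).
Proof.
move=> gM cM df fl0; have gE := @rV_homeo_atlas R d; have cE := @rV_compatible R d.
have gfl := frame_germ_pcomp gM gE gl df fl0.
rewrite /frame_chart (frame_map_mk gl gfl gM cM gE cE df) /=; congr (Some (kappa _)).
have gr := frame_rep_germ (mk_frame gfl).
have a := frame_rep_agree gE cE gfl.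
have [[dr r0] [dfl _]] := (gr, gfl).
have [s1 s2] : smooth_at (frame_rep (mk_frame gfl)) 0 /\ smooth_at (pcomp f l) 0.
  by split; [exact: pdiffeo_smooth_at dr r0|exact: pdiffeo_smooth_at dfl fl0].
have SE (F : 'rV[R]_d -> option ('rV[R]_d : chartedType R d)) : pcomp Some F = F.
  exact: pcomp_Somel.
have := @agree_any_chart _ _ _ Some gE gr gfl a.
rewrite !SE => J.
have dS : @pdiffeo R d d ('rV[R]_d : chartedType R d) 'rV[R]_d Some.
  exact: (@atlas_pdiffeo R d _ Some gE cE).
have {}J := J dS r0.
have E := (peq_jet_iter_partial j s1 s2).1 J.
apply/funext => x; rewrite /taylor; apply: eq_bigr => k _; congr (_ *: _).
by apply: eq_bigr => s _; rewrite E // size_tuple -ltnS.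
Qed.

End Frames.

(** * Linear coordinates on polynomial maps *)

Section SpanCoordinates.
Context {R : realType} {V : lmodType R}.

Definition lin_span n (e : 'I_n -> V) : set V :=
  [set v | exists c : 'I_n -> R, v = \sum_i c i *: e i].

Definition linear_coord (S : set V) m (kappa : V -> 'rV[R]_m) :=
  set_bij S setT kappa /\
  (forall a p q, S p -> S q -> kappa (a *: p + q) = a *: kappa p + kappa q).

Lemma lin_span_lin n (e : 'I_n -> V) a v w :
  lin_span e v -> lin_span e w -> lin_span e (a *: v + w).
Proof.
move=> [c ->] [c' ->]; exists (fun i => a * c i + c' i).
by rewrite scaler_sumr -big_split; apply: eq_bigr => i _; rewrite scalerDl scalerA.
Qed.

Lemma lin_span0 n (e : 'I_n -> V) : lin_span e 0.
Proof. by exists (fun=> 0); rewrite big1 // => i _; rewrite scale0r. Qed.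

Lemma lin_spanZ n (e : 'I_n -> V) a v : lin_span e v -> lin_span e (a *: v).
Proof. by move=> ev; rewrite -[_ *: _]addr0; apply: lin_span_lin => //; exact: lin_span0. Qed.

Lemma lin_spanD n (e : 'I_n -> V) v w : lin_span e v -> lin_span e w -> lin_span e (v + w).
Proof. by move=> ev ew; rewrite -[v]scale1r; exact: lin_span_lin. Qed.

Lemma lin_spanS n (e : 'I_n.+1 -> V) v : lin_span e v <->
  exists p a, lin_span (e \o widen_ord (leqnSn n)) p /\ v = p + a *: e ord_max.
Proof.
split=> [[c ->]|[_ [a [[c ->] ->]]]].
  exists (\sum_i c (widen_ord (leqnSn n) i) *: e (widen_ord (leqnSn n) i)), (c ord_max).
  by rewrite big_ord_recr; split=> //; exists (c \o widen_ord (leqnSn n)).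
exists (fun i => if unlift ord_max i is Some k then c k else a).
rewrite big_ord_recr /= unlift_none; congr (_ + _); apply: eq_bigr => i _.
rewrite (_ : widen_ord _ i = lift ord_max i) ?liftK //.
by apply: val_inj; rewrite /= /bump leqNgt ltn_ord.
Qed.

(** One generator at a time: either it lies in the span of the previous ones, or
    its coefficient is a new coordinate. *)
Lemma span_coordinates n (e : 'I_n -> V) :
  exists m (kappa : V -> 'rV[R]_m), linear_coord (lin_span e) kappa.
Proof.
elim: n e => [|n IH] e.
  exists 0%N, (fun=> 0); split=> [|a p q _ _]; last by rewrite scaler0 addr0.
  split=> //.
    by move=> v w; rewrite !inE => -[c ->] [c' ->] _; rewrite !big_ord0.
  by move=> w _; exists 0; [exact: lin_span0|apply/rowP => -[]].
pose e' := e \o widen_ord (leqnSn n).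
have [m [kappa [[kf ki ks] kl]]] := IH e'.
have [emax|emax] := pselect (lin_span e' (e ord_max)).
  exists m, kappa; rewrite (_ : lin_span e = lin_span e') //.
  apply/seteqP; split=> v.
    by case/lin_spanS => p [a [ep ->]]; apply: lin_spanD => //; exact: lin_spanZ.
  by move=> ev; apply/lin_spanS; exists v, 0; rewrite scale0r addr0.
have split v : exists pa : V * R,
    lin_span e v -> lin_span e' pa.1 /\ v = pa.1 + pa.2 *: e ord_max.
  have [/lin_spanS [p [a pa]]|nv] := pselect (lin_span e v); first by exists (p, a).
  by exists (0, 0).
have [g gP] := choice split.
have uniq p a p' a' : lin_span e' p -> lin_span e' p' ->
    p + a *: e ord_max = p' + a' *: e ord_max -> p = p' /\ a = a'.
  move=> ep ep' E; have [aa'|aa'] := eqVneq a a'.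
    by move: E; rewrite aa' => /addIr.
  exfalso; apply: emax.
  have -> : e ord_max = (a - a')^-1 *: (p' + (-1) *: p).
    rewrite scaleN1r.
    have -> : p' - p = (a - a') *: e ord_max.
      rewrite scalerBl; apply/eqP; rewrite subr_eq addrAC eq_sym subr_eq; apply/eqP.
      by rewrite [LHS]addrC E addrC.
    by rewrite scalerA mulVf ?scale1r // subr_eq0.
  by apply: lin_spanZ; apply: lin_spanD => //; exact: lin_spanZ.
have gE p a : lin_span e' p -> g (p + a *: e ord_max) = (p, a).
  move=> ep; have [gp gE] := gP (p + a *: e ord_max)
    ((lin_spanS _ _).2 (ex_intro _ p (ex_intro _ a (conj ep erefl)))).
  by have [e1 e2] := uniq _ _ _ _ ep gp gE; rewrite [LHS]surjective_pairing -e1 -e2.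
exists (m + 1)%N, (fun v => row_mx (kappa (g v).1) (g v).2%:M); split.
  split=> //.
    move=> v w; rewrite !inE => /gP[ev vE] /gP[ew wE] /eq_row_mx[k1 /matrixP/(_ 0 0)].
    rewrite !mxE eqxx !mulr1n => k2; rewrite vE wE k2; congr (_ + _).
    by apply: ki; rewrite ?inE.
  move=> w _; have [p ep kp] := ks (lsubmx w) I.
  exists (p + rsubmx w 0 0 *: e ord_max).
    by apply/lin_spanS; exists p, (rsubmx w 0 0).
  rewrite gE //= kp [X in row_mx _ X](_ : _ = rsubmx w) ?hsubmxK //.
  by rewrite -mx11_scalar.
move=> a v w /gP[ev vE] /gP[ew wE].
have E : a *: v + w = (a *: (g v).1 + (g w).1) + (a * (g v).2 + (g w).2) *: e ord_max.
  by rewrite {1}vE {1}wE scalerDr scalerA addrACA scalerDl.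
rewrite E gE; last exact: lin_span_lin.
rewrite /= kl // scale_row_mx add_row_mx; congr row_mx.
by apply/matrixP => i j; rewrite !ord1 !mxE eqxx !mulr1n.
Qed.

End SpanCoordinates.

Section PolyMaps.
Context {R : realType}.
Variables d j : nat.

(* A monomial, listed as a tuple of variables, and a component of the values.
   The family of monomial maps with these indices is redundant. *)
Local Notation idx := ({k : 'I_j.+1 & k.-tuple 'I_d} * 'I_d)%type.

Definition monomial_map (u : idx) : 'rV[R]_d -> 'rV[R]_d :=
  fun x => (\prod_(i <- tagged u.1) x 0 i) *: delta_mx 0 u.2.

Lemma tuple_sig_inj (t t' : {k : 'I_j.+1 & k.-tuple 'I_d}) :
  tagged t = tagged t' :> seq 'I_d -> t = t'.
Proof.
case: t t' => [k s] [k' s'] /= E.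
have kk' : k = k' by apply: val_inj; rewrite /= -(size_tuple s) E size_tuple.
by subst k'; congr existT; exact: val_inj.
Qed.

Lemma sum_monomialE (c : seq 'I_d -> 'rV[R]_d) (w : nat -> R) :
  (fun x : 'rV[R]_d => \sum_(k < j.+1) w k *:
    \sum_(s : k.-tuple 'I_d) (\prod_(i <- s) x 0 i) *: c s)
  = \sum_(u : idx) (w (tag u.1) * c (tagged u.1) 0 u.2) *: monomial_map u.
Proof.
apply/funext => x; rewrite fct_sumE.
under eq_bigr do rewrite scaler_sumr.
rewrite sig_big_dep /= -(pair_big predT predT
  (fun (t : {k : 'I_j.+1 & k.-tuple 'I_d}) (l : 'I_d) =>
    ((w (tag t) * c (tagged t) 0 l) *: monomial_map (t, l)) x)) /=.
apply: eq_bigr => -[k s] _ /=; rewrite [c s in LHS]row_sum_delta !scaler_sumr.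
apply: eq_bigr => l _; rewrite /monomial_map /= -[RHS]/(_ *: (_ *: _)) !scalerA; congr (_ *: _).
exact: mulrAC.
Qed.

Lemma poly_mapsE (p : 'rV[R]_d -> 'rV[R]_d) :
  poly_maps j p <-> exists c, p = \sum_(u : idx) c u *: monomial_map u.
Proof.
have sumE c := sum_monomialE c (fun=> 1).
have E1 (c : seq 'I_d -> 'rV[R]_d) :
    (fun x : 'rV[R]_d => \sum_(k < j.+1)
      \sum_(s : k.-tuple 'I_d) (\prod_(i <- s) x 0 i) *: c s) =
    \sum_(u : idx) c (tagged u.1) 0 u.2 *: monomial_map u.
  under eq_bigr do rewrite -[c _ 0 _]mul1r; rewrite -sumE.
  by apply/funext => x; apply: eq_bigr => k _; rewrite scale1r.
split=> [[c ->]|[c ->]]; first by exists (fun u : idx => c (tval (tagged u.1)) 0 u.2).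
pose cc (s : seq 'I_d) : 'rV[R]_d :=
  \row_l (if [pick t : {k : 'I_j.+1 & k.-tuple 'I_d} | tval (tagged t) == s]
  is Some t then c (t, l) else 0).
exists cc; rewrite (E1 cc); apply: eq_bigr => -[t l] _; congr (_ *: _); rewrite mxE /=.
case: pickP => [t' /eqP/tuple_sig_inj -> //|/(_ t)]; by rewrite eqxx.
Qed.

(** This provides charts of the frame bundle: its topology is generated by them. *)
Lemma poly_maps_iso_exists : exists m (kappa : ('rV[R]_d -> 'rV[R]_d) -> 'rV[R]_m),
  poly_maps_iso j kappa.
Proof.
pose e (i : 'I_#|{: idx}|) := monomial_map (enum_val i).
have [m [kappa [kb kl]]] := span_coordinates e.
exists m, kappa; rewrite /poly_maps_iso.
suff -> : poly_maps j = lin_span e by [].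
have re (F : idx -> 'rV[R]_d -> 'rV[R]_d) :
    \sum_(u : idx) F u = \sum_(i < #|{: idx}|) F (enum_val i).
  by rewrite (reindex _ (onW_bij _ (@enum_val_bij idx))).
apply/seteqP; split=> p.
  by case/poly_mapsE=> c ->; exists (c \o enum_val); rewrite re.
case=> c ->; apply/poly_mapsE; exists (c \o enum_rank).
by rewrite re; apply: eq_bigr => i _; rewrite /= enum_valK.
Qed.

Lemma poly_coord_sum m (kappa : ('rV[R]_d -> 'rV[R]_d) -> 'rV[R]_m) c : poly_maps_iso j kappa ->
  kappa (\sum_(u : idx) c u *: monomial_map u) = \sum_(u : idx) c u *: kappa (monomial_map u).
Proof.
case=> _ kl.
have pm u : poly_maps j (monomial_map u).
  apply/poly_mapsE; exists (fun v => (v == u)%:R).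
  rewrite (bigD1 u) //= eqxx scale1r big1 ?addr0 // => v /negPf ->.
  by rewrite scale0r.
have p0 : poly_maps j (0 : 'rV[R]_d -> 'rV[R]_d).
  by apply/poly_mapsE; exists (fun=> 0); rewrite big1 // => u _; rewrite scale0r.
have k0 : kappa 0 = 0.
  have := kl 1 0 0 p0 p0; rewrite scale1r (_ : (fun x => _) = 0); last first.
    by apply/funext => x; rewrite scaler0 addr0.
  by move/eqP; rewrite -subr_eq subrr eq_sym => /eqP.
have pl a (p q : 'rV[R]_d -> 'rV[R]_d) :
    poly_maps j p -> poly_maps j q -> poly_maps j (a *: p + q).
  case/poly_mapsE=> cp -> /poly_mapsE[cq ->]; apply/poly_mapsE.
  exists (fun u => a * cp u + cq u).
  by rewrite scaler_sumr -big_split; apply: eq_bigr => u _; rewrite scalerDl scalerA.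
suff [] : poly_maps j (\sum_(u : idx) c u *: monomial_map u) /\
   kappa (\sum_(u : idx) c u *: monomial_map u) =
     \sum_(u : idx) c u *: kappa (monomial_map u) by [].
elim/big_rec2 : _ => [|u y x _ [py ky]]; first by [].
split; first exact: pl (c u) (monomial_map u) x (pm u) py.
by rewrite -ky; exact: kl (c u) (monomial_map u) x (pm u) py.
Qed.

Lemma poly_coord_taylor m (kappa : ('rV[R]_d -> 'rV[R]_d) -> 'rV[R]_m) f : poly_maps_iso j kappa ->
  kappa (taylor j f) = \sum_(u : idx)
    (((tag u.1)`!%:R)^-1 * iter_partial (tagged u.1) f 0 0 u.2) *: kappa (monomial_map u).
Proof.
move=> ki; rewrite -poly_coord_sum //; congr kappa.
exact: (sum_monomialE (fun s => iter_partial s f 0) (fun k => (k`!%:R)^-1)).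
Qed.

End PolyMaps.

(** * The topology of the frame bundle *)

Section FrameTopology.
Context {R : realType} {d : nat}.
Variable j : nat.
Variable M : chartedType R d.
Hypotheses (gM : homeo_atlas M) (cM : compatible_atlas M).

(** Continuity of maps into the frame bundle is tested on the subbase. *)
Lemma frame_open_filter (X : Type) (F : set_system X) (FF : Filter F)
    (f : X -> frame_bundle j M) q (O : set (frame_bundle j M)) :
  open O -> O q -> (forall W, frame_subbase W -> W q -> F (f @^-1` W)) -> F (f @^-1` O).
Proof.
case=> D' D'f <- [W D'W Wq] Fsub.
have [B BD BE] := D'f _ D'W.
apply: (@filterS _ _ _ (f @^-1` W)); first by move=> x Wx; exists W.
rewrite -BE preimage_bigcap; apply: filter_bigI => V BV.
apply: Fsub; first by have := BD _ BV; rewrite inE.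
by move: Wq; rewrite -BE; exact.
Qed.

Lemma frame_subbase_open (W : set (frame_bundle j M)) : frame_subbase W -> open W.
Proof.
move=> sW; exists [set W]; last by rewrite bigcup_set1.
by move=> _ ->; exact: (@finI_from1 _ _ _ id).
Qed.

Definition frames_over (W : set M) : set (frame_bundle j M) :=
  [set q | exists2 x, frame_rep q 0 = Some x & W x].

(** A chart of [M] restricted to [W] yields a chart of the frame bundle whose
    domain lies over [W]. *)
Lemma open_frames_over (W : set M) : open W -> open (frames_over W).
Proof.
move=> oW; rewrite openE => q [x qx Wx].
have [phi aphi /pdomE[y phix]] := gM.2 x.
have [m [kappa ki]] := @poly_maps_iso_exists R d j.
pose l := pcomp phi (pid_on W).
have dl : pdiffeo l.
  apply: pdiffeo_pcomp gM gM (@rV_homeo_atlas R d) _ _; first exact: atlas_pdiffeo.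
  exact: pid_on_pdiffeo.
have l0 : pdom (pcomp l (frame_rep q)) 0.
  apply/pdomE; exists y; apply/pcompE; exists x => //; apply/pcompE; exists x => //.
  exact/pid_onE.
exists (ppreimage (frame_chart kappa l) setT).
  split; first by apply: frame_subbase_open; exists m, kappa, l, setT; split=> //; exact: openT.
  rewrite ppreimageT; apply/pdomE; rewrite -{1}(mk_frame_rep q).
  by rewrite (frame_chart_mk j kappa (frame_rep_germ q) gM cM dl l0); eexists.
rewrite ppreimageT => q' /pdomE[z]; rewrite /frame_chart.
case E: (frame_map l q') => [q''|] // _.
have [_ /pdomE[w /pcompE[x' q'x' /pcompE[x'' /pid_onE[? Wx'] _]]]] := frame_map_defined E.
by exists x' => //.
Qed.

End FrameTopology.

Lemma continuous_sumZ (R : realType) (I : finType) m n (a : I -> 'rV[R]_m -> R)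
    (v : I -> 'rV[R]_n) x :
  (forall i, {for x, continuous (a i)}) -> {for x, continuous (fun h => \sum_i a i h *: v i)}.
Proof.
move=> ca; have FF := nbhs_filter x.
refine (@cvg_big _ _ _ 0 xpredT add_continuous _ (nbhs x) _ (fun i h => a i h *: v i)
  (fun i => a i x *: v i) FF _) => i _.
exact: (@cvgZr_tmp R _ _ (nbhs x) FF _ _ _ (ca i)).
Qed.

Section FrameMaps.
Context {R : realType} {d : nat}.
Variable j : nat.
Variable M : chartedType R d.
Hypotheses (gM : homeo_atlas M) (cM : compatible_atlas M).

Lemma iter_partial_translate m n (f : 'rV[R]_m -> 'rV[R]_n) h s x :
  iter_partial s (fun y => f (y + h)) x = iter_partial s f (x + h).
Proof.
elim: s x => [//|i s IH] x; rewrite /=.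
rewrite (_ : iter_partial s _ = fun y => iter_partial s f (y + h)).
  exact: (derive_translate _ _ _ _).1.
exact/funext.
Qed.

Lemma shift_germ (l : 'rV[R]_d -> option M) h : frame_germ l -> pdom l h ->
  frame_germ (pcomp l (translation h)).
Proof.
case=> dl _ lh; split; last by rewrite /pdom /pcomp /translation /= add0r.
apply: pdiffeo_pcomp (@rV_homeo_atlas R d) (@rV_homeo_atlas R d) gM dl _.
exact: translation_pdiffeo.
Qed.

Lemma frame_chart_dom m (kappa : ('rV[R]_d -> 'rV[R]_d) -> 'rV[R]_m) (f : M -> option 'rV[R]_d)
    (l : 'rV[R]_d -> option M) (gl : frame_germ l) y :
  frame_chart kappa f (mk_frame j gl) = Some y -> pdom (pcomp f l) 0.
Proof.
rewrite /frame_chart; case E: (frame_map _ _) => [q|] // _.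
have [_ D] := frame_map_defined E.
by move: D; rewrite /pdom /= (pdom_pcomp0 _ (frame_rep0 j gM cM gl)).
Qed.

(** In a chart, the Taylor coefficients of the translated germ are the iterated
    partial derivatives of the given germ at the new base point, and these depend
    continuously on it. *)
Lemma shift_continuous (l : 'rV[R]_d -> option M) (gl : frame_germ l)
    (O : set (frame_bundle j M)) : open O -> O (mk_frame j gl) ->
  \forall h \near (0 : 'rV[R]_d), exists gh : frame_germ (pcomp l (translation h)),
    O (mk_frame j gh).
Proof.
move=> oO Ol; have [dl l0] := gl.
pose q h := if pselect (frame_germ (pcomp l (translation h))) is left gh
  then mk_frame j gh else mk_frame j gl.
have qE h (gh : frame_germ (pcomp l (translation h))) : q h = mk_frame j gh.
  rewrite /q; case: pselect => // gh'; exact: frame_class_inj.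
have nl : \forall h \near (0 : 'rV[R]_d), pdom l h.
  have [_ [cl _] _] := dl.
  exact: open_nbhs_nbhs (conj (pcontinuous_pdom cl) l0).
suff nq : \forall h \near (0 : 'rV[R]_d), O (q h).
  apply: filterS (filterI nl nq) => h [lh Oh].
  have gh := shift_germ gl lh; exists gh; by rewrite -qE.
apply: (frame_open_filter _ oO Ol) => W [m [kappa [f [V [ki df oV ->]]]]].
case/ppreimageE=> y fy Vy; have fl0 := frame_chart_dom fy.
have dG : pdiffeo (pcomp f l).
  exact: pdiffeo_pcomp (@rV_homeo_atlas R d) gM (@rV_homeo_atlas R d) df dl.
have [U [oU U0 UG] sU] := pdiffeo_smooth_at dG fl0.
pose G := total_ext (pcomp f l).
pose c h := \sum_(u : {k : 'I_j.+1 & k.-tuple 'I_d} * 'I_d)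
    (((tag u.1)`!%:R)^-1 * iter_partial (tagged u.1) G h 0 u.2) *: kappa (monomial_map u).
have cE h : U h -> pdom l h -> frame_chart kappa f (q h) = Some (c h).
  move=> Uh lh; have gh := shift_germ gl lh; rewrite (qE _ gh).
  have fh : pdom (pcomp f (pcomp l (translation h))) 0.
    by have := UG _ Uh; rewrite /pdom /pcomp /translation /= add0r.
  rewrite (frame_chart_mk j kappa gh gM cM df fh) poly_coord_taylor //.
  congr Some; apply: eq_bigr => u _.
  have -> : total_ext (pcomp f (pcomp l (translation h))) = fun x => G (x + h) by [].
  by rewrite iter_partial_translate add0r.
have q0 : q 0 = mk_frame j gl.
  have E0 : pcomp l (translation 0) = l.
    by apply/funext => x; rewrite /pcomp /translation /= addr0.
  have g0 : frame_germ (pcomp l (translation 0)) by rewrite E0.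
  by rewrite (qE 0 g0); apply: frame_class_inj; rewrite /= E0.
have cc : {for (0 : 'rV[R]_d), continuous c}.
  apply: (@continuous_sumZ R _ d m) => u.
  apply: continuousM; first exact: cst_continuous.
  have [_ [cs _]] := iter_partial_coord_of_smooth (tagged u.1) oU sU U0.
  apply: (@continuous_comp _ _ _
    (iter_partial (tagged u.1) G) (fun N : 'rV_d => N 0 u.2)) => //.
  exact: coord_continuous.
have c0 : c 0 = y by have := cE 0 U0 l0; rewrite q0 fy => -[].
have nV : \forall h \near (0 : 'rV[R]_d), V (c h).
  by apply: cc; rewrite c0; exact: open_nbhs_nbhs.
have nU : \forall h \near (0 : 'rV[R]_d), U h by exact: open_nbhs_nbhs.
apply: filterS (filterI nV (filterI nU nl)) => h [Vh [Uh lh]] /=.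
by apply/ppreimageE; exists (c h) => //; exact: cE.
Qed.

(** Composing a chart with [f] gives a chart, so the preimage of a subbasic open
    set under the frame map of [f] is again subbasic. *)
Lemma frame_map_preimage_open (f : M -> option M) (O : set (frame_bundle j M)) :
  pdiffeo f -> (forall x, pdom f x) -> open O ->
  open [set q | exists2 q', frame_map f q = Some q' & O q'].
Proof.
move=> df tf oO; rewrite openE => q0 [q0' fq0 Oq0'].
have gf (l : 'rV[R]_d -> option M) (gl : frame_germ l) : frame_germ (pcomp f l).
  apply: frame_germ_pcomp => //; have [_ /pdomE[x lx]] := gl.
  by rewrite /pdom /pcomp /= lx /=; exact: tf.
pose F (q : frame_bundle j M) := mk_frame j (gf _ (frame_rep_germ q)).
have FE q : frame_map f q = Some (F q).
  rewrite -{1}(mk_frame_rep q).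
  exact: (frame_map_mk j (frame_rep_germ q) (gf _ (frame_rep_germ q)) gM cM gM cM df).
have F0 : F q0 = q0' by move: fq0; rewrite FE => -[].
have OF0 : O (F q0) by rewrite F0.
suff nF : nbhs q0 (F @^-1` O) by apply: filterS nF => q Oq; exists (F q).
apply: (frame_open_filter _ oO OF0) => W [m [kappa [g [V [ki dg oV ->]]]]].
have CE q : pdom (pcomp g (pcomp f (frame_rep q))) 0 ->
    frame_chart kappa g (F q) = frame_chart kappa (pcomp g f) q.
  move=> D; rewrite (frame_chart_mk j kappa _ gM cM dg D) -{2}(mk_frame_rep q).
  have dgf : pdiffeo (pcomp g f) := pdiffeo_pcomp gM gM (@rV_homeo_atlas R d) dg df.
  by rewrite pcompA in D *; rewrite (frame_chart_mk j kappa _ gM cM dgf D).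
case/ppreimageE=> y gy Vy; have D0 := frame_chart_dom gy.
have dgf : pdiffeo (pcomp g f) := pdiffeo_pcomp gM gM (@rV_homeo_atlas R d) dg df.
apply: (@filterS _ _ _ (ppreimage (frame_chart kappa (pcomp g f)) V)); last first.
  apply: open_nbhs_nbhs; split; last by apply/ppreimageE; exists y => //; rewrite -CE.
  by apply: frame_subbase_open; exists m, kappa, (pcomp g f), V.
move=> q /ppreimageE[z gz Vz] /=; apply/ppreimageE; exists z => //.
rewrite CE //; move: gz; rewrite -{1}(mk_frame_rep q) => /frame_chart_dom.
by rewrite -pcompA.
Qed.

End FrameMaps.

(** * The induced action on frames *)

Section Groups.
Context {R : realType}.

Lemma continuous_pcontinuous (X Y : topologicalType) (f : X -> Y) :
  pcontinuous (fun x => Some (f x)) -> continuous f.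
Proof.
move=> cf; apply/continuousP => V /cf.
suff -> : ppreimage (fun x => Some (f x)) V = f @^-1` V by [].
apply/seteqP; split=> x; first by case/ppreimageE=> _ [<-].
by move=> Vx; apply/ppreimageE; exists (f x).
Qed.

Lemma smooth_at_row_mx m n p (F : 'rV[R]_m -> option 'rV[R]_n)
    (G : 'rV[R]_m -> option 'rV[R]_p) x :
  smooth_at F x -> smooth_at G x ->
  smooth_at (fun y => if (F y, G y) is (Some u, Some v) then Some (row_mx u v) else None) x.
Proof.
move=> [U [oU Ux UF] sF] [V [oV Vx VG] sG].
have oUV : open (U `&` V) by exact: openI.
exists (U `&` V).
  split=> // y [/UF Fy /VG Gy]; move: Fy Gy; rewrite /pdom /=.
  by case: (F y) => // u; case: (G y).
apply: (@vsmooth_on_eq _ _ _ _ (fun y => row_mx (total_ext F y) (total_ext G y))) => //.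
  move=> y [/UF Fy /VG Gy]; move: Fy Gy; rewrite /pdom /total_ext /=.
  by case: (F y) => // u; case: (G y).
move=> k; case: (split_ordP k) => i ->.
  apply: (@smooth_on_eq _ _ _ oUV (fun y => total_ext F y 0 i)).
    by move=> y _; rewrite row_mxEl.
  by apply: smooth_onS (sF i) => y [].
apply: (@smooth_on_eq _ _ _ oUV (fun y => total_ext G y 0 i)).
  by move=> y _; rewrite row_mxEr.
by apply: smooth_onS (sG i) => y [].
Qed.

Lemma smooth_at_cst m n (u : 'rV[R]_n) (x : 'rV[R]_m) : smooth_at (fun=> Some u) x.
Proof.
exists setT; first by split=> //; exact: openT.
by move=> l; apply: smooth_on_cst; exact: openT.
Qed.

Lemma slice_psmooth n d (G : manifoldType R n) (M : manifoldType R d) (g : G) :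
  psmooth (fun x : M => Some (g, x)).
Proof.
have gM := manifold_homeo_atlas M; have cM : compatible_atlas M := @manifold_compatible R d M.
apply: psmooth_intro.
  apply: (@pcontinuous_Some _ _ (fun x : M => (g, x))) => x.
  by apply: cvg_pair; [exact: cvg_cst|exact: cvg_id].
move=> phi _ w aphi [a [b [aa ab ->]]].
case/pdomE=> z /pcompE[_ /pcompE[x phix [<-]] /prod_chartE[/= ag bx]].
have sb : smooth_at (pcomp b (pinv phi)) w.
  apply: pdiffeo_smooth_at; last by apply/pdomE; exists (rsubmx z); apply/pcompE; exists x.
  have db := atlas_pdiffeo gM cM ab; have dp := pdiffeo_pinv (atlas_pdiffeo gM cM aphi).
  exact: pdiffeo_pcomp (@rV_homeo_atlas R d) gM (@rV_homeo_atlas R d) db dp.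
have [U [oU Uw Ub] _] := sb.
apply: smooth_at_eq (smooth_at_row_mx (smooth_at_cst (lsubmx z) w) sb).
apply: filterS (open_nbhs_nbhs (conj oU Uw)) => y /Ub/pdomE[v /pcompE[x' px' bx']].
by rewrite /pcomp px' /= bx' /prod_chart /= ag bx'.
Qed.

Section Action.
Context {n d : nat} {G : lieGroupType R n} {M : manifoldType R d}.
Variable act : G -> M -> M.
Hypothesis act_action : group_action act.
Hypothesis act_smooth : smooth (fun gx : G * M => act gx.1 gx.2).

Lemma actK g : cancel (act g) (act g^-1%g).
Proof. by have [a1 aM] := act_action; move=> x; rewrite -aM mulVg a1. Qed.

Lemma actVK g : cancel (act g^-1%g) (act g).
Proof. by have [a1 aM] := act_action; move=> x; rewrite -aM mulgV a1. Qed.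

Lemma act_pdiffeo g : pdiffeo (fun x => Some (act g x)).
Proof.
have gM := manifold_homeo_atlas M; have gG := manifold_homeo_atlas G.
have sm h : psmooth (fun x => Some (act h x)).
  exact: (psmooth_pcomp gM (prod_homeo_atlas gG gM) gM act_smooth (slice_psmooth M h)).
have [inj inv] : pinjective (fun x => Some (act g x)) /\
   pinv (fun x => Some (act g x)) = fun x => Some (act g^-1%g x).
  by apply: pinv_cancel => x y; split=> -[<-]; rewrite ?actK ?actVK.
by split; [|exact: sm|rewrite inv; exact: sm].
Qed.

Lemma act_germ (l : 'rV[R]_d -> option M) g : frame_germ l ->
  frame_germ (pcomp (fun x => Some (act g x)) l).
Proof.
move=> gl; have gM := manifold_homeo_atlas M.
have D : pdom (pcomp (fun x => Some (act g x)) l) 0.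
  by have [_ /pdomE[x lx]] := gl; rewrite /pdom /pcomp /= lx.
exact: (frame_germ_pcomp gM gM gl (act_pdiffeo g) D).
Qed.

Variable j : nat.

Lemma frame_action_mk (l : 'rV[R]_d -> option M) (gl : frame_germ l) g :
  frame_action j act g (mk_frame j gl) = Some (mk_frame j (act_germ g gl)).
Proof.
have gM := manifold_homeo_atlas M; have cM : compatible_atlas M := @manifold_compatible R d M.
exact: (frame_map_mk j gl (act_germ g gl) gM cM gM cM (act_pdiffeo g)).
Qed.

Definition frame_act g (q : frame_bundle j M) : frame_bundle j M :=
  mk_frame j (act_germ g (frame_rep_germ q)).

Lemma frame_actE g q : frame_action j act g q = Some (frame_act g q).
Proof. by rewrite -{1}(mk_frame_rep q) frame_action_mk. Qed.

Lemma mk_frame_ext (l l' : 'rV[R]_d -> option M) (gl : frame_germ l) (gl' : frame_germ l') :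
  l = l' -> mk_frame j gl = mk_frame j gl'.
Proof. by move=> E; apply: frame_class_inj; rewrite /= E. Qed.

Lemma frame_act_mk (l : 'rV[R]_d -> option M) (gl : frame_germ l) g :
  frame_act g (mk_frame j gl) = mk_frame j (act_germ g gl).
Proof. by have := frame_action_mk gl g; rewrite frame_actE => /Some_inj. Qed.

Lemma frame_act1 q : frame_act 1%g q = q.
Proof.
rewrite -[RHS]mk_frame_rep; apply: mk_frame_ext; apply/funext => x.
by rewrite /pcomp; case: (frame_rep q x) => //= y; have [-> _] := act_action.
Qed.

Lemma frame_actM g h q : frame_act (g * h)%g q = frame_act g (frame_act h q).
Proof.
rewrite {3}/frame_act frame_act_mk; apply: mk_frame_ext; apply/funext => x.
by rewrite /pcomp; case: (frame_rep q x) => //= y; have [_ ->] := act_action.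
Qed.

Lemma mul_left_continuous (g : G) : continuous (fun h : G => (g * h)%g).
Proof.
have [cm _] := @mulg_smooth R n G.
have cm' := continuous_pcontinuous cm => h.
apply: (@continuous_comp _ _ _ (fun h : G => (g, h)) (fun gh : G * G => (gh.1 * gh.2)%g)).
  by apply: cvg_pair; [exact: cvg_cst|exact: cvg_id].
exact: cm'.
Qed.

Lemma mul_right_continuous (g : G) : continuous (fun h : G => (h * g)%g).
Proof.
have [cm _] := @mulg_smooth R n G.
have cm' := continuous_pcontinuous cm => h.
apply: (@continuous_comp _ _ _ (fun h : G => (h, g)) (fun gh : G * G => (gh.1 * gh.2)%g)).
  by apply: cvg_pair; [exact: cvg_id|exact: cvg_cst].
exact: cm'.
Qed.

Lemma discrete_conj (S : set G) g : discrete_subset S ->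
  discrete_subset [set h | S (g^-1 * h * g)%g].
Proof.
move=> dS h /= Sh; have [_ [V nV VS]] := dS _ Sh.
split; first by rewrite inE.
exists ((fun k => (g^-1 * k * g)%g) @^-1` V).
  have ck : {for h, continuous (fun k => (g^-1 * k * g)%g)}.
    apply: (@continuous_comp _ _ _ (fun k : G => (g^-1 * k)%g) (fun k : G => (k * g)%g)).
      exact: mul_left_continuous.
    exact: mul_right_continuous.
  exact: ck.
apply/seteqP; split=> k /=.
  case=> Vk Sk; have : (V `&` S) (g^-1 * k * g)%g by [].
  by rewrite VS => /= /mulIg /mulgI.
move=> ->; split=> //=; have : (V `&` S) (g^-1 * h * g)%g by rewrite VS.
by case.
Qed.

Lemma discrete_of_isolated1 (S : set G) (V : set G) :
  (forall g h, S g -> S h -> S (g^-1 * h)%g) -> nbhs (1%g : G) V ->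
  (forall g, V g -> S g -> g = 1%g) -> discrete_subset S.
Proof.
move=> Sd nV V1 g Sg; split; first by rewrite inE.
exists ((fun k => (g^-1 * k)%g) @^-1` V).
  by apply: mul_left_continuous; rewrite mulVg.
apply/seteqP; split=> k /=.
  case=> Vk Sk; have /(congr1 (fun x => (g * x)%g)) := V1 _ Vk (Sd _ _ Sg Sk).
  by rewrite mulgA mulgV mul1g mulg1.
by move=> ->; rewrite mulVg; split=> //; exact: nbhs_singleton.
Qed.

Definition stabilizer (q : frame_bundle j M) : set G :=
  [set g | frame_action j act g q = Some q].

Lemma stabilizerE q g : stabilizer q g <-> frame_act g q = q.
Proof. by rewrite /stabilizer /= frame_actE; split=> [/Some_inj|->]. Qed.

Lemma stabilizer_div q g h : stabilizer q g -> stabilizer q h -> stabilizer q (g^-1 * h)%g.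
Proof.
move=> /stabilizerE gq /stabilizerE hq; apply/stabilizerE.
by rewrite frame_actM hq -{1}gq -frame_actM mulVg frame_act1.
Qed.

Definition discrete_locus : set (frame_bundle j M) :=
  [set q | discrete_subset (stabilizer q)].

(** Stabilizers of frames in the same orbit are conjugate. *)
Lemma discrete_locus_act g q : discrete_locus q -> discrete_locus (frame_act g q).
Proof.
move=> dq; have := @discrete_conj _ g dq; rewrite /discrete_locus /=.
suff -> : [set h | stabilizer q (g^-1 * h * g)%g] = stabilizer (frame_act g q) by [].
apply/seteqP; split=> h /=.
  move/stabilizerE; rewrite !frame_actM => /(congr1 (frame_act g)) E.
  by apply/stabilizerE; rewrite -[RHS]E -[in RHS]frame_actM mulgV frame_act1.
move/stabilizerE => E; apply/stabilizerE.
by rewrite !frame_actM E -frame_actM mulVg frame_act1.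
Qed.

(** The group acts on the frame bundle by homeomorphisms. *)
Lemma interior_discrete_locus_invariant :
  invariant_set (frame_action j act) (interior discrete_locus).
Proof.
move=> g q Dq; exists (frame_act g q); first exact: frame_actE.
have gM := manifold_homeo_atlas M; have cM : compatible_atlas M := @manifold_compatible R d M.
have oP := frame_map_preimage_open gM cM (act_pdiffeo g^-1%g) (fun x => isT)
  (open_interior discrete_locus).
have E0 : frame_action j act g^-1%g (frame_act g q) = Some q.
  by rewrite frame_actE -frame_actM mulVg frame_act1.
have Pq : [set q1 | exists2 q', frame_map (fun x => Some (act g^-1%g x)) q1 = Some q' &
    interior discrete_locus q'] (frame_act g q) by exists q.
apply: filterS (open_nbhs_nbhs (conj oP Pq)).
move=> q' [q'' E Dq'']; have {}E : frame_act g^-1%g q' = q''.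
  by have := frame_actE g^-1%g q'; rewrite /frame_action E => /Some_inj.
have -> : q' = frame_act g q'' by rewrite -E -frame_actM mulgV frame_act1.
by apply: discrete_locus_act; exact: interior_subset.
Qed.

End Action.
End Groups.

(** * Stabilizers of frames, in charts *)

Section LocalFreeness.
Context {R : realType}.

Lemma smooth_in_charts m n p (X : manifoldType R m) (Y : manifoldType R n)
    (Z : manifoldType R p)
    (f : X * Y -> Z) (phi : X -> option 'rV[R]_m) (psi : Y -> option 'rV[R]_n)
    (chi : Z -> option 'rV[R]_p) x0 y0 a b c :
  smooth f -> atlas phi -> atlas psi -> atlas chi ->
  phi x0 = Some a -> psi y0 = Some b -> chi (f (x0, y0)) = Some c ->
  exists (Om : set 'rV[R]_(m + n)) (F : 'rV[R]_(m + n) -> 'rV[R]_p),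
   [/\ open Om, vsmooth_on Om F, Om (row_mx a b) &
     forall u v, Om (row_mx u v) -> exists x y,
       [/\ phi x = Some u, psi y = Some v & chi (f (x, y)) = Some (F (row_mx u v))]].
Proof.
move=> [cf sf] aphi apsi achi phix psiy chif.
have gX := manifold_homeo_atlas X; have gY := manifold_homeo_atlas Y.
have gZ := manifold_homeo_atlas Z.
have aprod : @atlas R (m + n) (X * Y)%type (prod_chart phi psi) by exists phi, psi.
have [iphi _ _] := gX.1 _ aphi; have [ipsi _ _] := gY.1 _ apsi.
have [iprod _ cprod] := (prod_homeo_atlas gX gY).1 _ aprod.
have [_ cchi _] := gZ.1 _ achi.
pose H := pcomp chi (pcomp (fun x => Some (f x)) (pinv (prod_chart phi psi))).
have oH : open (pdom H).
  by apply: pcontinuous_pdom; apply: pcontinuous_pcomp => //; exact: pcontinuous_pcomp.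
have sH := partials_smooth_on oH (sf _ _ aprod achi).
exists (pdom H), (total_ext H); split=> //.
  apply/pdomE; exists c; apply/pcompE; exists (f (x0, y0)) => //.
  apply/pcompE; exists (x0, y0) => //; apply/(pinv_prod_chart _ _ iphi ipsi) => /=.
  by rewrite row_mxKl row_mxKr; split; [exact/(pinvE _ _ iphi)|exact/(pinvE _ _ ipsi)].
move=> u v /pdomE[w Hw]; have := Hw.
case/pcompE=> z /pcompE[[x y] /(pinv_prod_chart _ _ iphi ipsi)/= [px py] [fz]] chiz.
exists x, y; rewrite row_mxKl in px; rewrite row_mxKr in py; split.
- exact/(pinvE _ _ iphi).
- exact/(pinvE _ _ ipsi).
- by rewrite fz chiz /total_ext /= Hw.
Qed.

Section InCharts.
Context {n d : nat} {G : lieGroupType R n} {M : manifoldType R d}.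
Variable act : G -> M -> M.
Hypothesis act_action : group_action act.
Hypothesis act_smooth : smooth (fun gx : G * M => act gx.1 gx.2).
Variables (phi : G -> option 'rV[R]_n) (psi : M -> option 'rV[R]_d) (u0 : 'rV[R]_n).
Hypotheses (aphi : atlas phi) (apsi : atlas psi) (phi1 : phi 1%g = Some u0).
(* [A] is the action read in the charts [phi] and [psi], on the open set [Om] of
   pairs of coordinates. *)
Variables (Om : set 'rV[R]_(n + d)) (A : 'rV[R]_(n + d) -> 'rV[R]_d).
Hypotheses (oO : open Om) (sA : vsmooth_on Om A).
Hypothesis AE : forall u y, Om (row_mx u y) -> exists g x,
  [/\ phi g = Some u, psi x = Some y & psi (act g x) = Some (A (row_mx u y))].

Let iphi : pinjective phi. Proof. by have [] := (manifold_homeo_atlas G).1 _ aphi. Qed.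
Let ipsi : pinjective psi. Proof. by have [] := (manifold_homeo_atlas M).1 _ apsi. Qed.

Lemma act_in_charts g x u y : phi g = Some u -> psi x = Some y -> Om (row_mx u y) ->
  psi (act g x) = Some (A (row_mx u y)).
Proof.
move=> gu xy /AE[g' [x' [gu' xy' <-]]].
by rewrite (iphi gu gu') (ipsi xy xy').
Qed.

Lemma A_unit y : Om (row_mx u0 y) -> A (row_mx u0 y) = y.
Proof.
move=> /[dup] Oy /AE[g' [x [_ xy _]]].
have := act_in_charts phi1 xy Oy; have [-> _] := act_action.
by rewrite xy => -[].
Qed.

(** The generating vector fields of the action, in the chart [psi]. *)
Definition generator (k : 'I_n) (l : 'I_d) (y : 'rV[R]_d) : R :=
  'D_(delta_mx 0 (lshift d k)) (fun w => A w 0 l) (row_mx u0 y).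

Lemma smooth_generator (V : set 'rV[R]_d) k l : open V ->
  (forall y, V y -> Om (row_mx u0 y)) -> smooth_on V (generator k l).
Proof. by move=> oV VO; exact: (smooth_on_slicer oO oV VO (smooth_onD1 _ (sA l))). Qed.

(** If [g] fixes the frame of the germ [la], then [g \o la] and [la] have the same
    jet; composing with the inverse of [la] shows that [g] has, at the base point,
    the jet of the identity. *)
Lemma stabilizer_jet j (q : frame_bundle j M) x y g u :
  frame_rep q 0 = Some x -> psi x = Some y -> stabilizer act q g ->
  phi g = Some u -> Om (row_mx u y) -> Om (row_mx u0 y) ->
  forall l, eq_jet j y (fun z => A (row_mx u z) 0 l) (fun z => A (row_mx u0 z) 0 l).
Proof.
move=> qx xy Sg gu Ouy Ou0y.
have gM := manifold_homeo_atlas M; have cM : compatible_atlas M := @manifold_compatible R d M.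
have dpsi := atlas_pdiffeo gM cM apsi.
have gq := frame_rep_germ q; set la := frame_rep q in gq qx *.
have gE := @rV_homeo_atlas R d.
pose ga (x : M) := Some (act g x).
have dga : pdiffeo ga := act_pdiffeo act_action act_smooth g.
have ag : agree_to_order j (pcomp ga la) la.
  apply/(mk_frame_eq j gM cM (act_germ act_action act_smooth g gq) gq).
  have qE : mk_frame j gq = q by rewrite -[RHS]mk_frame_rep; exact: mk_frame_ext.
  move: Sg; rewrite /stabilizer /= -qE.
  by rewrite (frame_action_mk act_action act_smooth j gq g) => /Some_inj.
have gga : frame_germ (pcomp ga la) := act_germ act_action act_smooth g gq.
have D1 : pdom (pcomp psi (pcomp ga la)) 0.
  apply/pdomE; exists (A (row_mx u y)); apply/pcompE; exists (act g x).
    by apply/pcompE; exists x.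
  exact: act_in_charts.
have D2 : pdom (pcomp psi la) 0 by apply/pdomE; exists y; apply/pcompE; exists x.
have J := agree_any_chart gM gga gq ag dpsi D1.
have [dla la0] := gq; have [ila _ _] := dla.
pose mu := pcomp (pinv la) (pinv psi).
have muy : mu y = Some 0.
  apply/pcompE; exists x; first exact/(pinvE _ _ ipsi).
  exact/(pinvE _ _ ila).
have smu : smooth_at mu y.
  apply: pdiffeo_smooth_at; last by apply/pdomE; exists 0.
  exact: (pdiffeo_pcomp gE gM gE (pdiffeo_pinv dla) (pdiffeo_pinv dpsi)).
have s1 := frame_germ_smooth_at gM gga dpsi D1.
have s2 := frame_germ_smooth_at gM gq dpsi D2.
have JJ := peq_jet_comp muy muy smu smu s1 s2 (fun k s _ => erefl) J.
have [U [oU Uy Umu] _] := smu.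
have near_slice w : Om (row_mx w y) -> \forall z \near y, Om (row_mx w z).
  move=> Owy; have nO := open_nbhs_nbhs (conj oO Owy).
  have [r /= r0 rO] := (nbhs_ballP _ _).1 nO.
  apply: filterS (nbhsx_ballx y r r0) => z yz; apply: rO.
  by apply: ball_row_mx => //; exact: ballxx.
have nU : \forall z \near y, U z by exact: open_nbhs_nbhs.
have muE z : U z -> exists x', [/\ psi x' = Some z & obind la (mu z) = Some x'].
  move=> /Umu/pdomE[t mut]; have := mut.
  case/pcompE=> x' /(pinvE _ _ ipsi) px' /(pinvE _ _ ila) lx'.
  by exists x'; rewrite mut.
move=> l; have {}JJ := JJ l.
apply: (@eq_jet_trans _ _ _ _ _
  (fun z => total_ext (pcomp (pcomp psi (pcomp ga la)) mu) z 0 l)).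
  have : \forall z \near y,
      A (row_mx u z) 0 l = total_ext (pcomp (pcomp psi (pcomp ga la)) mu) z 0 l.
    apply: filterS (filterI nU (near_slice u Ouy)) => z [/muE[x' [px' lx']] Oz].
    have := act_in_charts gu px' Oz; rewrite /total_ext /= => E.
    move: lx'; rewrite /pcomp; case: (mu z) => //= t -> /=; by rewrite E.
  rewrite /prop_near1 nbhsE => -[V [oV Vy] VE]; exact: (eq_on_eq_jet oV Vy).
apply: (eq_jet_trans JJ).
have : \forall z \near y, total_ext (pcomp (pcomp psi la) mu) z 0 l = A (row_mx u0 z) 0 l.
  apply: filterS (filterI nU (near_slice u0 Ou0y)) => z [/muE[x' [px' lx']] Oz].
  rewrite (A_unit Oz) /total_ext /= /pcomp.
  by move: lx'; case: (mu z) => //= t -> /=; rewrite px'.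
rewrite /prop_near1 nbhsE => -[V [oV Vy] VE]; exact: (eq_on_eq_jet oV Vy).
Qed.

(** The elements that fix [q] satisfy the equations [H i w = H i u0] between
    coordinates of jets. The derivative of [H i] along the group at the unit is a
    partial derivative of a generating vector field, since partial derivatives
    commute; hence the assumption on [jet_matrix] isolates the unit. *)
Lemma stabilizer_discrete j (q : frame_bundle j M) x y (rows : 'I_n -> seq 'I_d * 'I_d) :
  frame_rep q 0 = Some x -> psi x = Some y -> Om (row_mx u0 y) ->
  (forall i, (size (rows i).1 <= j)%N) -> \det (jet_matrix generator rows y) != 0 ->
  discrete_subset (stabilizer act q).
Proof.
move=> qx xy Oy rj dJ.
have [r /= r0 rO] := (nbhs_ballP _ _).1 (open_nbhs_nbhs (conj oO Oy)).
have inO w : ball u0 r w -> Om (row_mx w y).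
  by move=> bw; apply: rO; apply: ball_row_mx => //; exact: ballxx.
have oU : open (ball u0 r) by exact: ball_open.
have uU : ball u0 r u0 by exact: ballxx.
pose H i w := ipartial (map (@rshift n d) (rows i).1) (fun w => A w 0 (rows i).2) (row_mx w y).
have HE i w : H i w = ipartial (rows i).1 (fun z => A (row_mx w z) 0 (rows i).2) y.
  by rewrite /H -ipartial_slicer.
have sH i : smooth_on (ball u0 r) (H i).
  apply: (smooth_on_slicel oO oU _ (smooth_on_ipartial _ (sA (rows i).2))).
  by move=> w bw; exact: inO.
have dH : \det (\matrix_(k, i) 'D_(delta_mx 0 k) (H i) u0) != 0.
  rewrite (_ : \matrix_(k, i) _ = jet_matrix generator rows y) //.
  apply/matrixP => k i; rewrite !mxE derive_slicel row_mx_delta_l.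
  rewrite -(ipartial_derive _ _ oO (sA (rows i).2)) //.
  by rewrite /generator
    (ipartial_slicer ('D_(delta_mx 0 (lshift d k)) (fun w => A w 0 (rows i).2))).
have nN := locally_injective oU uU sH dH.
have nV : nbhs (1%g : G) (ppreimage phi
    (ball u0 r `&` [set w | (forall i, H i w = H i u0) -> w = u0])).
  have [_ cphi _] := (manifold_homeo_atlas G).1 _ aphi.
  apply: (pcontinuous_nbhs cphi phi1); apply: filterI => //; exact: nbhsx_ballx.
apply: (discrete_of_isolated1 _ nV).
  by move=> g h; exact: stabilizer_div.
move=> g /ppreimageE[w gw [bw Hw]] Sg.
have wu : w = u0.
  apply: Hw => i; rewrite !HE.
  by apply: (stabilizer_jet qx xy Sg gw _ Oy); [exact: inO|exact: rj].
by rewrite wu in gw; exact: iphi gw phi1.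
Qed.

Lemma is_derive_line (V : normedModType R) (f : V -> R) x v :
  derivable f x v -> is_derive (0 : R) 1 (fun h : R => f (h *: v + x)) ('D_v f x).
Proof.
move=> df; have [E dl] := derive_line f x v 0; rewrite scale0r add0r in E dl.
by split; [exact: dl.2 df|exact: E].
Qed.

Lemma is_derive_rV (V : normedModType R) m (f : V -> 'rV[R]_m) x v (a : 'rV[R]_m) :
  (forall l, is_derive x v (fun y => f y 0 l) (a 0 l)) -> is_derive x v f a.
Proof.
move=> df; have D : derivable f x v.
  by apply/derivable_mxP => i l; rewrite ord1; case: (df l).
split=> //; rewrite (derive_mx D); apply/matrixP => i l; rewrite ord1 mxE.
by case: (df l).
Qed.

Lemma exists_normalized m (v : 'rV[R]_m) : v != 0 ->
  exists k, exists2 a : R, a != 0 & (a *: v) 0 k = 1.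
Proof.
move=> v0; have [k vk] : exists k, v 0 k != 0.
  apply/not_existsP => H; move/eqP: v0; apply; apply/rowP => k; rewrite mxE.
  by have := H k; move/negP; rewrite negbK => /eqP.
by exists k; exists (v 0 k)^-1; rewrite ?invr_eq0 // mxE mulVf.
Qed.

Lemma continuous_near (S T : topologicalType) (f : S -> T) x (B : set T) :
  {for x, continuous f} -> nbhs (f x) B -> \forall y \near x, B (f y).
Proof. by move=> cf; exact: cf. Qed.

Lemma continuous_affine (T : topologicalType) (V : normedModType R) (f : T -> R) (v x : V) p :
  {for p, continuous f} -> {for p, continuous (fun u => f u *: v + x)}.
Proof.
by move=> cf; apply: cvgD; [apply: cvgZr_tmp; exact: cf|exact: cvg_cst].
Qed.

Lemma continuous_line m (v x : 'rV[R]_m) (s : R) :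
  {for s, continuous (fun h : R => h *: v + x)}.
Proof. by apply: (@continuous_affine R _ id); exact: cvg_id. Qed.

(** If the generating vector field in the direction [w] vanishes at [t], then the
    group elements with coordinates [u0 + h w] move [t] with speed zero at
    [h = 0], and so do their products with the element of coordinates [u]. *)
Lemma vanishing_generator_slow (w : 'rV[R]_n) t u : Om (row_mx u0 t) -> Om (row_mx u t) ->
  (forall l, \sum_k w 0 k * generator k l t = 0) ->
  is_derive (0 : R) 1 (fun h : R => A (row_mx u (A (row_mx (h *: w + u0) t)))) 0.
Proof.
move=> O0 Ou w0; pose E (h : R) := A (row_mx (h *: w + u0) t).
have dE l : is_derive (0 : R) 1 (fun h => E h 0 l) 0.
  have [df fE] := smooth_on_derive oO (row_mx w 0) (sA l) O0.
  have := is_derive_line df; rewrite fE big_split_ord /=.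
  under eq_bigr do rewrite row_mxEl.
  rewrite w0 big1 ?addr0; last by move=> k _; rewrite row_mxEr mxE mul0r.
  rewrite (_ : (fun h : R => _) = (fun h => E h 0 l)) //.
  by apply/funext => h; rewrite /E row_mx_shiftl.
apply: is_derive_rV => l; rewrite mxE.
pose f (h : R) := row_mx u (E h).
have df k : is_derive (0 : R) 1 (fun h => f h 0 k) 0.
  case: (split_ordP k) => i ->.
    rewrite (_ : (fun h => _) = cst (u 0 i)); last by apply/funext => h; rewrite /f row_mxEl.
    exact: is_derive_cst.
  by rewrite (_ : (fun h => _) = (fun h => E h 0 i)) //; apply/funext => h; rewrite /f row_mxEr.
have f0 : f 0 = row_mx u t by rewrite /f /E scale0r add0r A_unit.
have [|||D1 D2] := @smooth_on_derive_comp R _ Om oO _ f (fun z => A z 0 l) 0 1.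
- by move=> k; case: (df k).
- exact: sA.
- by rewrite f0.
split=> //; rewrite [LHS]D2 big1 // => k _.
by have [_ ->] := df k; rewrite mul0r.
Qed.

(** The segment from [u0] to [u] in the chart is a path in the group. *)
Lemma path_identity_component (g : G) u r : phi g = Some u ->
  (forall w, ball u0 r w -> exists h, phi h = Some w) -> ball u0 r u ->
  identity_component G g.
Proof.
move=> gu im bu; pose p (s : R) := s *: (u - u0) + u0.
have cp s : {for s, continuous p} by exact: continuous_line.
have bp (s : R) : s \in `[0, 1] -> ball u0 r (p s).
  rewrite in_itv /= => /andP[s0 s1]; move: bu; rewrite -!ball_normE /ball_ /= => bu.
  rewrite /p opprD addrCA subrr addr0 normrN normrZ ger0_norm //.
  apply: le_lt_trans bu; rewrite -[X in _ <= X]normrN opprB.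
  by rewrite ler_piMl.
pose c s := odflt 1%g (pinv phi (p s)).
have cE s g' : phi g' = Some (p s) -> c s = g'.
  by move=> g's; rewrite /c (_ : pinv phi (p s) = Some g') //; exact/(pinvE _ _ iphi).
exists (c @` `[0, 1]).
  split=> //.
    exists 0; first by rewrite /= in_itv /= lexx ler01.
    by apply: cE; rewrite /p scale0r add0r.
  apply: connected_continuous_connected; first exact: segment_connected.
  apply: continuous_in_subspaceT => s; rewrite inE => /bp/im[g' g's].
  have [_ _ cphi] := (manifold_homeo_atlas G).1 _ aphi.
  move=> N; rewrite (cE _ _ g's) => nN.
  have pg' : pinv phi (p s) = Some g' by exact/(pinvE _ _ iphi).
  have nP : \forall s' \near s, ppreimage (pinv phi) N (p s').
    exact: (cp s _ (pcontinuous_nbhs cphi pg' nN)).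
  apply: filterS nP => s' /ppreimageE[g'' pg'' Ng'']; rewrite /= /c pg''.
  exact: Ng''.
exists 1; first by rewrite /= in_itv /= lexx ler01.
by apply: cE; rewrite /p scale1r subrK.
Qed.

Hypothesis act_rare : fixpoint_rare (identity_component G) act.

(** An infinitesimal generator that vanishes on an open set integrates to group
    elements that fix this open set. The integration is done by [escape], with the
    curves that multiply the element of coordinates [u] on the right by those of
    coordinates [u0 + h w]. *)
Lemma no_vanishing_generator (v : 'rV[R]_n) y1 (rho : R) : v != 0 -> 0 < rho ->
  (forall y, ball y1 rho y -> Om (row_mx u0 y)) ->
  (forall y, ball y1 rho y -> forall l, \sum_k v 0 k * generator k l y = 0) -> False.
Proof.
move=> v0 rho0 bO vf.
have [k [a a0 wk]] := exists_normalized v0; pose w := a *: v.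
have wf y : ball y1 rho y -> forall l, \sum_k w 0 k * generator k l y = 0.
  move=> yb l; have := congr1 ( *%R a) (vf y yb l); rewrite mulr0 mulr_sumr => E.
  rewrite -[RHS]E.
  by apply: eq_bigr => i _; rewrite mxE mulrA.
have mul11 : phi (1 * 1)%g = Some u0 by rewrite mulg1.
have [Om2 [Mu [oOm2 sM Om2u M2]]] :=
  smooth_in_charts (@mulg_smooth R n G) aphi aphi aphi phi1 phi1 mul11.
have mulE g h b c : phi g = Some b -> phi h = Some c -> Om2 (row_mx b c) ->
    phi (g * h)%g = Some (Mu (row_mx b c)).
  move=> gb hc /M2[g' [h' [gb' hc' <-]]].
  by rewrite (iphi gb gb') (iphi hc hc').
have MuE b : Om2 (row_mx b u0) -> Mu (row_mx b u0) = b.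
  move=> /[dup] Ob /M2[g [h [gb h1 _]]].
  by have := mulE _ _ _ _ gb phi1 Ob; rewrite mulg1 gb => -[].
have MuE' b : Om2 (row_mx u0 b) -> Mu (row_mx u0 b) = b.
  move=> /[dup] Ob /M2[g [h [gu hb _]]].
  by have := mulE _ _ _ _ phi1 hb Ob; rewrite mul1g hb => -[].
have [r2 /= r20 r2O] := (nbhs_ballP _ _).1 (open_nbhs_nbhs (conj oOm2 Om2u)).
have Oy1 : Om (row_mx u0 y1) by apply: bO; exact: ballxx.
have [r3 /= r30 r3O] := (nbhs_ballP _ _).1 (open_nbhs_nbhs (conj oO Oy1)).
have in2 b c : ball u0 r2 b -> ball u0 r2 c -> Om2 (row_mx b c).
  by move=> bb bc; apply: r2O; exact: ball_row_mx.
have in3 b y : ball u0 r3 b -> ball y1 r3 y -> Om (row_mx b y).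
  by move=> bb by_; apply: r3O; exact: ball_row_mx.
have o2 : open (ball u0 r2) by exact: ball_open.
have o3 : open (ball u0 r3) by exact: ball_open.
have u2 : ball u0 r2 u0 by exact: ballxx.
have u3 : ball u0 r3 u0 by exact: ballxx.
pose Muk z : R := Mu z 0 k.
(* The speed of the coordinate [k] along these curves; it is 1 at [u0] because
   [w] is normalized. *)
pose kap u : R := 'D_(row_mx 0 w) Muk (row_mx u u0).
have dMu i u : ball u0 r2 u ->
    is_derive (0 : R) 1 (fun h : R => Mu (row_mx u (h *: w + u0)) 0 i)
      ('D_(row_mx 0 w) (fun z => Mu z 0 i) (row_mx u u0)).
  move=> bu; have [df _] := smooth_on_derive oOm2 (row_mx 0 w) (sM i) (in2 _ _ bu u2).
  have := is_derive_line df.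
  rewrite (_ : (fun h : R => Mu (h *: row_mx 0 w + _) 0 i) =
    (fun h => Mu (row_mx u (h *: w + u0)) 0 i)) //.
  by apply/funext => h; rewrite row_mx_shiftr.
have lin_near : \forall h \near (0 : R), ball u0 r2 (h *: w + u0) /\ ball u0 r3 (h *: w + u0).
  have cl : {for (0 : R), continuous (fun h : R => h *: w + u0)} by exact: continuous_line.
  have nb : nbhs (0 *: w + u0) (ball u0 r2 `&` ball u0 r3).
    by rewrite scale0r add0r; apply: filterI; exact: nbhsx_ballx.
  have nl : \forall h \near (0 : R), (ball u0 r2 `&` ball u0 r3) (h *: w + u0).
    exact: (continuous_near cl nb).
  by apply: filterS nl => h [].
have kap0 : kap u0 = 1.
  rewrite /kap /Muk; have [_ <-] := dMu k u0 u2; rewrite -[RHS]wk.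
  have [dk E1] := is_derive_coord u0 w k; have [_ E2] := is_derive_line dk.
  rewrite -[RHS]E1 -E2.
  refine (near_eq_derive (f := fun h : R => Mu (row_mx u0 (h *: w + u0)) 0 k)
    (g := fun h : R => (h *: w + u0) 0 k) _ _).
  refine (@filterS _ _ (nbhs_filter (0 : R)) _ _ _ lin_near) => h [b2 _].
  by rewrite MuE' //; exact: in2.
have ckap : {for u0, continuous kap}.
  have sk : smooth_on (ball u0 r2) (fun u => \sum_i (row_mx 0 w) 0 i *
       'D_(delta_mx 0 i) Muk (row_mx u u0)).
    apply: smooth_on_sum => // i _.
    apply: (@smooth_onM _ _ _ o2 (cst ((row_mx 0 w) 0 i))); first exact: smooth_on_cst.
    apply: (smooth_on_slicel (F := 'D_(delta_mx 0 i) Muk) oOm2 o2).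
      by move=> u bu; exact: in2.
    exact: smooth_onD1 (sM k).
  apply: (near_eq_continuous _ (smooth_on_continuous sk u2)).
  apply: filterS (nbhsx_ballx u0 r2 r20) => u bu.
  by have [_ E] := smooth_on_derive oOm2 (row_mx 0 w) (sM k) (in2 _ _ bu u2); rewrite /kap E.
have [r4 /= r40 kap_gt0] : exists2 r4 : R, 0 < r4 & forall u, ball u0 r4 u -> 0 < kap u.
  have nk : nbhs (kap u0) [set s : R | 0 < s].
    by apply: open_nbhs_nbhs; split; [exact: open_gt|rewrite /= kap0 ltr01].
  by have [r4 /= r40 r4P] := (nbhs_ballP _ _).1 (continuous_near ckap nk); exists r4.
(* Halved, so that the closed ball of radius [r] lies in the three open balls. *)
pose r := Num.min r2 (Num.min r3 r4) / 2.
have m0 : 0 < Num.min r2 (Num.min r3 r4) by rewrite !lt_min r20 r30 r40.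
have r0 : 0 < r by rewrite divr_gt0.
have rlt : r < Num.min r2 (Num.min r3 r4).
  by rewrite /r ltr_pdivrMr // mulr2n mulrDr mulr1 ltrDl.
have inb u : `|u - u0| <= r -> [/\ ball u0 r2 u, ball u0 r3 u & ball u0 r4 u].
  move=> ur; have := le_lt_trans ur rlt; rewrite !lt_min => /and3P[h2 h3 h4].
  by rewrite -!ball_normE /ball_ /= [ `|u0 - u|]distrC.
pose rho' := Num.min rho r3.
have rho'0 : 0 < rho' by rewrite lt_min rho0 r30.
have inY y : ball y1 rho' y -> ball y1 rho y /\ ball y1 r3 y.
  by move=> yb; split; apply: le_ball yb; rewrite ge_min lexx ?orbT.
pose c u (h : R) := Mu (row_mx u (h *: w + u0)).
have cc u : `|u - u0| < r -> {for 0, continuous (c u)}.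
  move=> /ltW/inb[b2 _ _]; apply: rV_continuous => i.
  by apply: derivable1_continuous; case: (dMu i u b2).
have c0 u : `|u - u0| < r -> c u 0 = u.
  by move=> /ltW/inb[b2 _ _]; rewrite /c scale0r add0r MuE //; exact: in2.
have cA0 t u : ball y1 rho' t -> `|u - u0| < r ->
    is_derive (0 : R) 1 (fun h => A (row_mx (c u h) t)) 0.
  move=> /inY[tr t3] ur; have [b2 b3 _] := inb u (ltW ur).
  have Ou := in3 _ _ b3 t3; have O0 := in3 _ _ u3 t3.
  apply: near_eq_is_derive (vanishing_generator_slow O0 Ou (wf t tr)).
  have n1 : \forall h \near (0 : R), ball u0 r3 (c u h).
    have nb : nbhs (c u 0) (ball u0 r3) by rewrite c0 //; apply: open_nbhs_nbhs.
    exact: (continuous_near (cc u ur) nb).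
  have n2 : \forall h \near (0 : R), Om (row_mx u (A (row_mx (h *: w + u0) t))).
    have cf : {for (0 : R), continuous (fun h : R => A (row_mx (h *: w + u0) t))}.
      apply: rV_continuous => i; apply: derivable1_continuous.
      have [df _] := smooth_on_derive oO (row_mx w 0) (sA i) O0.
      have [D _] := is_derive_line df; move: D.
      rewrite (_ : (fun h : R => _) = (fun h : R => A (row_mx (h *: w + u0) t) 0 i)) //.
      by apply/funext => h; rewrite row_mx_shiftl.
    have [e /= e0 eO] := (nbhs_ballP _ _).1 (open_nbhs_nbhs (conj oO Ou)).
    have nb : nbhs (A (row_mx (0 *: w + u0) t)) (ball t e).
      by rewrite scale0r add0r A_unit //; exact: nbhsx_ballx.
    apply: filterS (continuous_near cf nb) => h he; apply: eO; apply: ball_row_mx => //.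
    exact: ballxx.
  apply: filterS (filterI lin_near (filterI n1 n2)) => h [[l2 l3] [ch Oh]].
  have [g [x [gu xt _]]] := AE Ou.
  have [h' [x' [hw _ _]]] := AE (in3 _ _ l3 t3).
  have E1 := act_in_charts hw xt (in3 _ _ l3 t3).
  have E2 := act_in_charts gu E1 Oh.
  have gh : phi (g * h')%g = Some (c u h) := mulE _ _ _ _ gu hw (in2 _ _ b2 l2).
  have E3 := act_in_charts gh xt (in3 _ _ ch t3).
  have [_ aM] := act_action; move: E3; rewrite aM E2 => -[]; exact.
have cA t u : ball y1 rho' t -> `|u - u0| <= r -> {for u, continuous (fun u => A (row_mx u t))}.
  move=> /inY[_ t3] /inb[_ b3 _]; apply: rV_continuous => i.
  have sl := smooth_on_slicel oO o3 (fun b bb => in3 b t bb t3) (sA i).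
  exact: (smooth_on_continuous sl b3).
have ck u : `|u - u0| < r -> exists2 D : R, 0 < D & is_derive (0 : R) 1 (fun h => c u h 0 k) D.
  move=> /ltW/inb[b2 _ b4]; exists (kap u); first exact: kap_gt0.
  exact: dMu.
have [u ur uF] := escape r0 cA c0 cc ck cA0.
have [b2 b3 _] : [/\ ball u0 r2 u, ball u0 r3 u & ball u0 r4 u] by apply: inb; rewrite ur.
have [g [_ [gu _ _]]] := M2 _ _ (in2 _ _ b2 u2).
have fix_ball x y : psi x = Some y -> ball y1 rho' y -> act g x = x.
  move=> xy yb; have [yr y3] := inY y yb.
  have E := act_in_charts gu xy (in3 _ _ b3 y3).
  rewrite (uF y yb) A_unit in E; last exact: in3.
  exact: (ipsi E xy).
have gid : identity_component G g.
  apply: (path_identity_component gu _ b2) => b bb.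
  by have [h [_ [hb _ _]]] := M2 _ _ (in2 _ _ bb u2); exists h.
have g1 : g <> 1%g.
  move=> g1; move: gu; rewrite g1 phi1 => -[uu].
  by move: ur r0; rewrite -uu subrr normr0 => <-; rewrite ltxx.
have [_ [x1 [_ x1y _]]] := AE Oy1.
have : interior [set x | act g x = x] x1.
  have [_ cpsi _] := (manifold_homeo_atlas M).1 _ apsi.
  have nb : nbhs y1 (ball y1 rho') by exact: nbhsx_ballx.
  apply: filterS (pcontinuous_nbhs cpsi x1y nb) => x /ppreimageE[y xy yb].
  exact: (fix_ball x y).
by rewrite (act_rare gid g1).
Qed.

End InCharts.
End LocalFreeness.

(** * Density *)

Section Density.
Context {R : realType} {n d : nat} {G : lieGroupType R n} {M : manifoldType R d}.
Variable act : G -> M -> M.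
Hypothesis act_action : group_action act.
Hypothesis act_smooth : smooth (fun gx : G * M => act gx.1 gx.2).
Hypothesis act_rare : fixpoint_rare (identity_component G) act.
Hypothesis n_ge1 : (1 <= n)%N.

(** By [wronskian], either the generating vector fields have independent jets of
    order less than [n] at some point of [W], hence at all points nearby, or a
    nontrivial combination of them vanishes on an open set, which
    [no_vanishing_generator] excludes. *)
Lemma discrete_frames_over (x0 : M) (W : set M) : open W -> W x0 ->
  exists P : set M, [/\ open P, P !=set0, P `<=` W &
    frames_over P `<=` @discrete_locus R n d G M act (n - 1)].
Proof.
move=> oW Wx0.
have gM := manifold_homeo_atlas M; have gG := manifold_homeo_atlas G.
have [phi aphi /pdomE[u0 phi1]] := gG.2 1%g.
have [psi apsi /pdomE[y0 psix]] := gM.2 x0.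
have [ipsi cpsi cpsi'] := gM.1 _ apsi.
have psix' : psi (act 1%g x0) = Some y0 by have [-> _] := act_action.
have [Om [A [oO sA O0 AE]]] := smooth_in_charts act_smooth aphi apsi apsi phi1 psix psix'.
have nW : nbhs y0 (ppreimage (pinv psi) W).
  apply: (pcontinuous_nbhs cpsi' _ (open_nbhs_nbhs (conj oW Wx0))).
  exact/(pinvE _ _ ipsi).
have [r1 /= r10 r1O] := (nbhs_ballP _ _).1 (open_nbhs_nbhs (conj oO O0)).
have [r2 /= r20 r2W] := (nbhs_ballP _ _).1 nW.
pose r := Num.min r1 r2.
have r0 : 0 < r by rewrite lt_min r10 r20.
have inr y : ball y0 r y -> Om (row_mx u0 y) /\ ppreimage (pinv psi) W y.
  move=> yr; split.
    apply: r1O; apply: ball_row_mx; first exact: ballxx.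
    by apply: le_ball yr; rewrite ge_min lexx.
  by apply: r2W; apply: le_ball yr; rewrite ge_min lexx orbT.
have oB : open (ball y0 r) by exact: ball_open.
pose f := generator u0 A.
have sf k l : smooth_on (ball y0 r) (f k l).
  by apply: (smooth_generator oO sA) => // y /inr[].
have B0 : ball y0 r !=set0 by exists y0; exact: ballxx.
have [[v v0 [y [rho rho0 [sub vf]]]]|[y yb [rows rn dJ]]] := wronskian oB B0 sf.
  exfalso; apply: (no_vanishing_generator act_action aphi apsi phi1 oO sA AE act_rare v0 rho0 _ vf).
  by move=> z /sub/inr[].
have [rho rho0 rhoP] := ball_open_smooth_nonzero oB yb (smooth_jet_det rows oB sf) dJ.
exists (ppreimage psi (ball y rho)); split.
- by apply: cpsi; exact: ball_open.
- have [Oy _] := inr y yb; have [_ [x [_ xy _]]] := AE _ _ Oy.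
  by exists x; apply/ppreimageE; exists y => //; exact: ballxx.
- move=> x /ppreimageE[z xz /rhoP[zb _]].
  have [_ /ppreimageE[x' /(pinvE _ _ ipsi) x'z Wx']] := inr z zb.
  by rewrite (ipsi _ _ _ xz x'z).
- move=> q [x qx /ppreimageE[z xz /rhoP[zb dz]]].
  have [Oz _] := inr z zb.
  apply: (stabilizer_discrete act_action act_smooth aphi apsi phi1 oO sA AE qx xz Oz _ dz).
  by move=> i; rewrite subn1 -ltnS prednK.
Qed.

(** A frame in an open set [O] can be moved along its germ to nearby base points
    without leaving [O], so it suffices to find, near its base point, an open set
    over which all stabilizers are discrete. *)
Lemma dense_interior_discrete_locus :
  dense (interior (@discrete_locus R n d G M act (n - 1))).
Proof.
move=> O [q0 Oq0] oO.
have gM := manifold_homeo_atlas M; have cM : compatible_atlas M := @manifold_compatible R d M.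
have gl := frame_rep_germ q0; have [dl l0] := gl; set l := frame_rep q0 in gl dl l0.
have [il [cl _] [cl' _]] := dl.
have Ol : O (mk_frame (n - 1)%N gl).
  by rewrite (_ : mk_frame _ _ = q0) // -[RHS]mk_frame_rep; exact: mk_frame_ext.
have [r /= r0 rP] := (nbhs_ballP _ _).1 (shift_continuous gM cM oO Ol).
have [x0 lx0] := (pdomE _ _).1 l0.
have oW : open (ppreimage (pinv l) (ball 0 r)) by apply: cl'; exact: ball_open.
have Wx0 : ppreimage (pinv l) (ball 0 r) x0.
  by apply/ppreimageE; exists 0; [exact/(pinvE _ _ il)|exact: ballxx].
have [P [oP [x Px] PW PD]] := discrete_frames_over oW Wx0.
have /ppreimageE[h /(pinvE _ _ il) lh hb] := PW x Px.
have [gh Ogh] := rP h hb.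
exists (mk_frame (n - 1)%N gh); split=> //.
have oov : open (frames_over P : set (frame_bundle (n - 1) M)) by exact: open_frames_over.
apply: filterS PD _; apply: open_nbhs_nbhs; split=> //.
exists x => //; rewrite (frame_rep0 _ gM cM gh).
by rewrite /pcomp /translation /= add0r.
Qed.

End Density.

Theorem theorem12p1 (R : realType) (n d : nat)
    (G : lieGroupType R n) (M : manifoldType R d) (act : G -> M -> M)
    (act_action : group_action act)
    (act_smooth : smooth (fun gx : G * M => act gx.1 gx.2))
    (act_rare : fixpoint_rare (identity_component G) act)
    (n_ge1 : (1 <= n)%N) :
  exists Q : set (frame_bundle (n - 1) M),
    [/\ open Q, dense Q,
        invariant_set (frame_action (n - 1) act) Q &
        locally_free_on (frame_action (n - 1) act) Q].
Proof.
exists (interior (@discrete_locus R n d G M act (n - 1))); split.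
- exact: open_interior.
- exact: dense_interior_discrete_locus.
- exact: interior_discrete_locus_invariant.
- by move=> q /interior_subset.
Qed.
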